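(* Let $\mathcal T$ be a conforming triangular grid of a two-dimensional polygonal domain $\Omega$. Let $r_1=l+\tfrac12$ for some integer $l\ge-1$, let $r_2\ge 2r_1+1$ be a nonnegative integer, and let $k$ be an integer with $k\ge2r_2+2$. Put $\mathbf r=(r_1+\tfrac12,r_2+1)$, $\mathbf r'=(r_1,r_2)$, $\mathbf r''=(r_1-\tfrac12,r_2-1)$. Then the sequence $$\mathbb R\xrightarrow{\ \hookrightarrow\ }V_{k+1}^{(\mathbf r)}(\mathcal T)\xrightarrow{\ \operatorname{curl}\ }\mathbf S_k^{(\mathbf r')}(\mathcal T)\xrightarrow{\ \operatorname{div}\ }V_{k-1}^{(\mathbf r'')}(\mathcal T)\longrightarrow0$$ is a complex and exact, provided that the domain $\Omega$ is simply connected.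
   Context: For a scalar function $\phi$ on a planar domain, $\operatorname{curl}\phi=(\partial_{x_2}\phi,-\partial_{x_1}\phi)$; for a vector field $\mathbf v=(v_1,v_2)$, $\operatorname{div}\mathbf v=\partial_{x_1}v_1+\partial_{x_2}v_2$. ''Complex'' means that the operators map each space into the next and consecutive compositions vanish; ''exact'' means that the image of each map equals the kernel of the next one. For each edge $e$ of $\mathcal T$ a unit normal $\mathbf n$ and unit tangent $\mathbf t$ are fixed. A degree of freedom attached to a vertex or edge is single-valued for a piecewise polynomial function if it takes the same value when computed from any triangle containing that vertex or edge. $\mathcal P_j(e)$ denotes polynomials of degree $\le j$ on $e$. The space $V_m^{(\boldsymbol\rho)}(\mathcal T)$, for $\boldsymbol\rho=(\rho_1,\rho_2)$ with integers $\rho_1,\rho_2\ge-1$, is the set of $u\in L^2(\Omega)$ such that $u|_K$ is a polynomial of degree $\le m$ for every triangle $K\in\mathcal T$ and the following are single-valued: (i) at every vertex, all partial derivatives of $u$ of order $\le\rho_2$ (no condition if $\rho_2=-1$); (ii) on every edge $e$, with barycentric coordinates $\lambda_{e,1},\lambda_{e,2}$, for every integer $0\le n\le\rho_1$, the moments $\frac1{|e|}\int_e\frac{\partial^nu}{\partial\mathbf n^n}v$ for all $v\in\operatorname{span}\{\lambda_{e,1}^{\sigma_1}\lambda_{e,2}^{\sigma_2}:\sigma_1,\sigma_2\in\mathbb N_0,\ \sigma_1+\sigma_2=m-n,\ \sigma_1,\sigma_2>\rho_2-n\}$ (no condition if $\rho_1=-1$). The generalized Stenberg space $\mathbf S_k^{(\mathbf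 r')}(\mathcal T)$, $\mathbf r'=(r_1,r_2)$, is the set of vector fields $\mathbf u\in[L^2(\Omega)]^2$ such that $\mathbf u|_K\in[\mathcal P_k(K)]^2$ for every triangle $K\in\mathcal T$ and the following degrees of freedom are single-valued: (a) $D^\alpha\mathbf u(\mathbf x)$ for $|\alpha|\le r_2$ at every vertex $\mathbf x$; (b) $\int_e\frac{\partial^m}{\partial\mathbf n^m}(\mathbf u\cdot\mathbf n)\,q$ for $q\in\mathcal P_{k-2r_2-2+m}(e)$, $m=0,1,\dots,r_1+\tfrac12$, on every edge $e$; (c) $\int_e\frac{\partial^m}{\partial\mathbf n^m}(\mathbf u\cdot\mathbf t)\,q$ for $q\in\mathcal P_{k-2r_2-2+m}(e)$, $m=0,1,\dots,r_1-\tfrac12$, on every edge $e$ (none if $r_1=-\tfrac12$). (The remaining degrees of freedom are interior to the elements and impose no inter-element condition.) *)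

(* Defs.v *)
From HB Require Import structures.
From mathcomp Require Import all_boot all_order all_algebra.
From mathcomp Require Import all_classical all_reals all_analysis.
(* The notations of mpoly clash with those of analysis. *)
From mathcomp Require Import -(notations) mpoly.

Set Implicit Arguments.
Unset Strict Implicit.
Unset Printing Implicit Defensive.

Import Order.TTheory GRing.Theory Num.Theory.
Import numFieldNormedType.Exports.

Local Open Scope classical_set_scope.
Local Open Scope ring_scope.

(** * Plane geometry *)

Notation plane R := 'rV[R]_2.
Notation poly2 R := (mpoly 2 R).

Definition on_line (R : realType) (a b : plane R) (t : R) : plane R :=
  (1 - t) *: a + t *: b.

(* [norm2] is the Euclidean norm; the library norm on matrices is the sup
   norm. *)
Definition norm2 (R : realType) (x : plane R) : R :=
  Num.sqrt (x 0 0 ^+ 2 + x 0 1 ^+ 2).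

Definition hull (R : realType) (I : finType) (x : I -> plane R) (A : {set I}) :
    set (plane R) :=
  [set y | exists w : I -> R,
    [/\ forall i, 0 <= w i, \sum_(i in A) w i = 1
      & y = \sum_(i in A) w i *: x i]].

Definition affinely_independent (R : realType) (I : finType)
    (x : I -> plane R) (A : {set I}) : Prop :=
  forall w : I -> R, \sum_(i in A) w i = 0 -> \sum_(i in A) w i *: x i = 0 ->
  forall i, i \in A -> w i = 0.

(** * Polygonal domains *)

(* [polygon p] is the closed polygonal line p_0 p_1 ... p_{n-1} p_0. *)
Definition polygon (R : realType) (n : nat) (p : 'I_n -> plane R) :
    set (plane R) :=
  [set y | exists i t, 0 <= t <= 1 /\ y = on_line (p i) (p (ordS i)) t].

(* Injectivity of the parametrization by 'I_n x [0, 1[ also forces n >= 3 as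
   soon as n > 0. *)
Definition simple_closed (R : realType) (n : nat) (p : 'I_n -> plane R) : Prop :=
  (0 < n)%N /\
  forall i j s t, 0 <= s < 1 -> 0 <= t < 1 ->
    on_line (p i) (p (ordS i)) s = on_line (p j) (p (ordS j)) t ->
    i = j /\ s = t.

(* The boundary consists of finitely many disjoint simple closed polygons, so
   it is a 1-manifold: slits, and boundary points at which the domain touches
   itself, are excluded.  The clause on interior (closure Omega) says that
   Omega lies on one side of its boundary only. *)
Definition polygonal_domain (R : realType) (Omega : set (plane R)) : Prop :=
  [/\ Omega !=set0, open Omega, connected Omega, bounded_set Omega &
      interior (closure Omega) = Omega /\
      exists (m : nat) (n : 'I_m -> nat) (p : forall i, 'I_(n i) -> plane R),
      [/\ forall i, simple_closed (p i),
          forall i j, i != j -> polygon (p i) `&` polygon (p j) = set0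
        & closure Omega `\` interior Omega = \bigcup_i polygon (p i)]].

Definition path_in (R : realType) (Omega : set (plane R)) (g : R -> plane R) :=
  {within `[0, 1], continuous g} /\
  (forall t, 0 <= t <= 1 -> Omega (g t)).

Definition simply_connected (R : realType) (Omega : set (plane R)) : Prop :=
  (forall x y, Omega x -> Omega y ->
     exists g, [/\ path_in Omega g, g 0 = x & g 1 = y]) /\
  (forall g, path_in Omega g -> g 0 = g 1 ->
     exists H : R * R -> plane R,
     [/\ {within `[0, 1] `*` `[0, 1], continuous H},
         forall s t, 0 <= s <= 1 -> 0 <= t <= 1 -> Omega (H (s, t)),
         forall t, 0 <= t <= 1 -> H (0, t) = g t,
         forall t, 0 <= t <= 1 -> H (1, t) = g 0
       & forall s, 0 <= s <= 1 -> H (s, 0) = g 0 /\ H (s, 1) = g 0]).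

(** * Conforming triangular grids *)

(* Triangles are given by their three vertices.  By affine independence, the
   intersection condition says that two distinct triangles are disjoint or
   meet exactly in a common vertex or in a common edge. *)
Record grid (R : realType) := Grid {
  vertex : finType;
  cell : finType;
  pos : vertex -> plane R;
  corners : cell -> {set vertex};
  corners_inj : injective corners;
  card_corners : forall K, #|corners K| = 3%N;
  corners_free : forall K, affinely_independent pos (corners K);
  conforming : forall K L,
    hull pos (corners K) `&` hull pos (corners L)
    = hull pos (corners K :&: corners L)
}.

Definition grid_of (R : realType) (Omega : set (plane R)) (T : grid R) : Prop :=
  closure Omega = \bigcup_(K : cell T) hull (@pos R T) (corners K).

(** * Piecewise polynomials and differential operators *)

(* A class u in L^2(Omega) whose restriction to each triangle is a polynomial
   is determined by these polynomials; conversely, every family of polynomials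
   indexed by the triangles defines such a class, since Omega is bounded and
   the union of the edges is negligible. *)
Definition pwpoly (R : realType) (T : grid R) := {ffun cell T -> poly2 R}.
Definition pwvect (R : realType) (T : grid R) := (pwpoly T * pwpoly T)%type.

Section Operators.
Context {R : realType} {T : grid R}.
Implicit Types (u : pwpoly T) (p : poly2 R).

Definition eval_at p (x : plane R) : R := meval (fun i => x 0 i) p.

Definition d1 p : poly2 R := mderiv 0 p.
Definition d2 p : poly2 R := mderiv 1 p.

Definition D (alpha : multinom 2) p : poly2 R := mderivm alpha p.

Definition dirD (nu : plane R) p : poly2 R := nu 0 0 *: d1 p + nu 0 1 *: d2 p.

Definition pwconst (c : R) : pwpoly T := [ffun => mpolyC 2 c].

Definition curl u : pwvect T := ([ffun K => d2 (u K)], [ffun K => - d1 (u K)]).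

Definition div (v : pwvect T) : pwpoly T := [ffun K => d1 (v.1 K) + d2 (v.2 K)].

Definition dot (v : pwvect T) (nu : plane R) : pwpoly T :=
  [ffun K => nu 0 0 *: v.1 K + nu 0 1 *: v.2 K].

(* Polynomials of degree at most m on each triangle; [msize p] is the
   total degree of p plus one, and 0 for p = 0. *)
Definition pw_degree (m : nat) u : Prop := forall K, (msize (u K) <= m.+1)%N.

(** * Degrees of freedom *)

(* An edge is given by two distinct vertices a, b of a triangle and is
   parametrized by t |-> (1 - t) a + t b, so that its barycentric coordinates
   are 1 - t and t.  Its unit tangent points from a to b; exchanging a and b
   reverses the tangent and the normal, hence only changes the signs of the
   degrees of freedom. *)
Definition tangent (a b : plane R) : plane R := (norm2 (b - a))^-1 *: (b - a).

Definition normal (a b : plane R) : plane R :=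
  \row_(i < 2) if i == 0 then tangent a b 0 1 else - tangent a b 0 0.

Definition edge_int (a b : plane R) p (q : {poly R}) : R :=
  norm2 (b - a) *
  \int[lebesgue_measure]_(t in `[0, 1]) (eval_at p (on_line a b t) * q.[t]).

Definition vertex_dofs (rho2 : int) u : Prop :=
  forall (v : vertex T) (K L : cell T), v \in corners K -> v \in corners L ->
  forall alpha, (mdeg alpha)%:Z <= rho2 ->
  eval_at (D alpha (u K)) (pos v) = eval_at (D alpha (u L)) (pos v).

Definition on_edges
    (P : forall (a b : plane R) (K L : cell T), Prop) : Prop :=
  forall (v w : vertex T) (K L : cell T), v != w ->
  v \in corners K -> w \in corners K -> v \in corners L -> w \in corners L ->
  P (pos v) (pos w) K L.

Definition edge_span (m n : nat) (rho2 : int) : set {poly R} :=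
  [set q | exists c : 'I_m.+1 -> 'I_m.+1 -> R,
    q = \sum_(s1 < m.+1) \sum_(s2 < m.+1 |
            [&& s1%:Z + s2%:Z == m%:Z - n%:Z,
                rho2 - n%:Z < s1%:Z & rho2 - n%:Z < s2%:Z])
          c s1 s2 *: ((1 - 'X) ^+ s1 * 'X ^+ s2)].

Definition edge_poly (j : int) : set {poly R} := [set q | (size q)%:Z <= j + 1].

Definition Vspace (m : nat) (rho1 rho2 : int) : set (pwpoly T) :=
  [set u | [/\ pw_degree m u, vertex_dofs rho2 u &
    on_edges (fun a b K L => forall n : nat, n%:Z <= rho1 ->
      forall q, edge_span m n rho2 q ->
      (norm2 (b - a))^-1 * edge_int a b (iter n (dirD (normal a b)) (u K)) q =
      (norm2 (b - a))^-1 * edge_int a b (iter n (dirD (normal a b)) (u L)) q)]].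

Definition stenberg_edge (k : nat) (r2 : nat) (m : nat)
    (a b : plane R) (u : pwpoly T) (K L : cell T) : Prop :=
  forall q, edge_poly (k%:Z - 2 * r2%:Z - 2 + m%:Z) q ->
  edge_int a b (iter m (dirD (normal a b)) (u K)) q =
  edge_int a b (iter m (dirD (normal a b)) (u L)) q.

Definition Stenberg (k : nat) (r1 : rat) (r2 : nat) : set (pwvect T) :=
  [set v | [/\ pw_degree k v.1 /\ pw_degree k v.2,
      vertex_dofs r2%:Z v.1 /\ vertex_dofs r2%:Z v.2,
      on_edges (fun a b K L => forall m : nat, m%:R <= r1 + 1 / 2 ->
        stenberg_edge k r2 m a b (dot v (normal a b)) K L)
    & on_edges (fun a b K L => forall m : nat, m%:R <= r1 - 1 / 2 ->
        stenberg_edge k r2 m a b (dot v (tangent a b)) K L)]].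

(** * Complexes *)

Definition is_complex (X : set (pwpoly T)) (Y : set (pwvect T))
    (Z : set (pwpoly T)) : Prop :=
  [/\ range pwconst `<=` X, curl @` X `<=` Y, div @` Y `<=` Z,
      forall c, curl (pwconst c) = (0, 0)
    & forall u, X u -> div (curl u) = 0].

Definition is_exact (X : set (pwpoly T)) (Y : set (pwvect T))
    (Z : set (pwpoly T)) : Prop :=
  [/\ injective pwconst,
      range pwconst = [set u | X u /\ curl u = (0, 0)],
      curl @` X = [set v | Y v /\ div v = 0]
    & div @` Y = Z].

End Operators.

Arguments Vspace {R} T m rho1 rho2 _.
Arguments Stenberg {R} T k r1 r2 _.

(* Main.v *)
(* On every triangle both kinds of degrees of freedom are unisolvent along an
   edge once the vertex derivatives are matched, so a class u in V is a family
   of polynomials whose jumps vanish to a prescribed order at the common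
   vertices and along the common edges; for a field in the Stenberg space the
   jump has zero normal component and the jumps of both components and of the
   divergence vanish to a prescribed order on the edge.

   Surjectivity of div: antiderivatives cut off in the Bernstein form match w
   at the vertices and along the edges, up to a defect that is flat there. On
   one triangle the bubble fields produce all flat defects of mean zero. The
   mean is pushed through an edge by a divergence-free flux field; an edge of
   an extreme vertex of any set of triangles belongs to only one of them, so
   the triangles can be cleared one after the other.

   Kernel of div: a potential on each triangle is unique up to a constant, and
   its jump across an edge is constant because the normal component of the
   curl does not jump. The simple connectedness of the domain (homotopy
   lifting) makes the potentials the restrictions of one function on the open
   domain, after adding constants. Triangles that meet only in a boundary
   vertex agree there because near a boundary point the domain is a single
   sector. *)
Require Import Defs.
From HB Require Import structures.
From mathcomp Require Import all_boot all_order all_algebra.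
From mathcomp Require Import all_classical all_reals all_analysis.
From mathcomp Require Import -(notations) mpoly.
From mathcomp Require Import ring lra zify.

Set Implicit Arguments.
Unset Strict Implicit.
Unset Printing Implicit Defensive.

Import Order.TTheory GRing.Theory Num.Theory.
Import numFieldNormedType.Exports.

Local Open Scope classical_set_scope.
Local Open Scope ring_scope.

(** * Bivariate polynomials and their derivatives *)

(** Let N = r_1 + 1/2 and M = r_2 + 1 count the orders of derivatives of the vector fields that
    match across edges and at vertices. The hypotheses become 2N < M and 2M <= k, and both are facts
    about Bernstein coefficients: 2M <= k keeps the coefficients that govern different vertices
    disjoint, and 2N < M keeps those that govern different edges disjoint away from the vertices.
    Hence jets at vertices and data along edges can be prescribed independently. The divergence is
    the normal derivative of the normal component plus a tangential derivative, so one additional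
    normal derivative of the normal component alone is what makes the divergence match to order N. A
    bubble field cannot change the mean of the divergence on its triangle, and this scalar is the
    only local obstruction. The flux field is a single divergence-free polynomial field on the
    plane, cut off separately in each triangle at the edge; the cut-offs match because each of them
    matches the same field. In the continuation of potentials the triangles are closed and do not
    form an open cover; instead, every triangle that contains a point near x contains x itself. *)

Lemma mpoly_alg_ind (R : nzRingType) (n : nat) (P : mpoly n R -> Prop) :
  (forall c, P (mpolyC n c)) -> (forall i, P (mpolyX R (mnm1 i))) ->
  (forall p q, P p -> P q -> P (p + q)) ->
  (forall p q, P p -> P q -> P (p * q)) -> forall p, P p.
Proof.
move=> PC PX PD PM p; rewrite (mpolyE p).
apply: (big_ind P) => [|//|m _]; first by rewrite -(mpolyC0 n).
rewrite -mul_mpolyC; apply: (PM) => //; rewrite mpolyXE_id.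
apply: (big_ind P) => [||i _]; [by rewrite -(mpolyC1 n)|by move=> *; apply: (PM)|].
by elim: (m i) => [|k IH]; rewrite ?expr0 ?exprS; [rewrite -(mpolyC1 n)|apply: PM].
Qed.

Section Calculus.
Context {R : realType}.
Implicit Types (p q : poly2 R) (x y z a b nu : plane R) (t c : R).

Local Notation eval_at := (@eval_at R).

Lemma eval0 x : eval_at 0 x = 0. Proof. exact: meval0. Qed.
Lemma evalD p q x : eval_at (p + q) x = eval_at p x + eval_at q x.
Proof. exact: mevalD. Qed.
Lemma evalB p q x : eval_at (p - q) x = eval_at p x - eval_at q x.
Proof. exact: mevalB. Qed.
Lemma evalM p q x : eval_at (p * q) x = eval_at p x * eval_at q x.
Proof. exact: mevalM. Qed.
Lemma evalZ c p x : eval_at (c *: p) x = c * eval_at p x.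
Proof. exact: mevalZ. Qed.
Lemma evalC c x : eval_at (mpolyC 2 c) x = c.
Proof. exact: mevalC. Qed.
Lemma evalX i x : eval_at (mpolyX R (mnm1 i)) x = x 0 i.
Proof. exact: mevalXU. Qed.
Lemma eval_sum (I : Type) (r : seq I) (P : pred I) (F : I -> poly2 R) x :
  eval_at (\sum_(i <- r | P i) F i) x = \sum_(i <- r | P i) eval_at (F i) x.
Proof. exact: (big_morph (eval_at^~ x) (fun p q => evalD p q x) (eval0 x)). Qed.

Lemma dirD_d1 p : d1 p = dirD (delta_mx 0 0) p.
Proof. by rewrite /dirD !mxE /= scale1r scale0r addr0. Qed.
Lemma dirD_d2 p : d2 p = dirD (delta_mx 0 1) p.
Proof. by rewrite /dirD !mxE /= scale1r scale0r add0r. Qed.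

Lemma dirD0 nu : dirD nu 0 = 0.
Proof. by rewrite /dirD /d1 /d2 !mderiv0 !scaler0 addr0. Qed.
Lemma dirD_add nu p q : dirD nu (p + q) = dirD nu p + dirD nu q.
Proof. by rewrite /dirD /d1 /d2 !mderivD !scalerDr addrACA. Qed.
Lemma dirDZ nu c p : dirD nu (c *: p) = c *: dirD nu p.
Proof. by rewrite /dirD /d1 /d2 !mderivZ scalerDr !scalerA ![c * _]mulrC. Qed.
Lemma dirDN nu p : dirD nu (- p) = - dirD nu p.
Proof. by rewrite -scaleN1r dirDZ scaleN1r. Qed.
Lemma dirDB nu p q : dirD nu (p - q) = dirD nu p - dirD nu q.
Proof. by rewrite dirD_add dirDN. Qed.
Lemma dirDM nu p q : dirD nu (p * q) = dirD nu p * q + p * dirD nu q.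
Proof.
rewrite /dirD /d1 /d2 !mderivM -!mul_mpolyC; ring.
Qed.
Lemma dirDC nu c : dirD nu (mpolyC 2 c) = 0.
Proof. by rewrite /dirD /d1 /d2 !mderivC !scaler0 addr0. Qed.
Lemma dirDX nu i : dirD nu (mpolyX R (mnm1 i)) = mpolyC 2 (nu 0 i).
Proof.
rewrite /dirD /d1 /d2; apply/mpolyP => m.
rewrite mcoeffD !mcoeffZ mcoeffC !mderivX !mcoeffZ !mcoeffX !mnm1E.
have subU (j : 'I_2) : mnm_sub (mnm1 j) (mnm1 j) = mnm0 :> multinom 2.
  by apply/mnmP => h; rewrite mnmBE subnn mnm0E.
case: i => -[|[|//]] lti.
  have -> : Ordinal lti = 0 by apply: val_inj.
  by rewrite subU eqxx /= mul0r mulr0 addr0 mul1r eq_sym.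
have -> : Ordinal lti = 1 by apply: val_inj.
by rewrite subU eqxx /= mul0r mulr0 add0r mul1r eq_sym.
Qed.
Lemma dirD_comm a b p : dirD a (dirD b p) = dirD b (dirD a p).
Proof.
rewrite /dirD /d1 /d2 !mderivD !mderivZ (mderiv_comm 1 0) -!mul_mpolyC; ring.
Qed.
Lemma iter_dirD_comm n a b p :
  iter n (dirD a) (dirD b p) = dirD b (iter n (dirD a) p).
Proof. by elim: n => //= n ->; rewrite dirD_comm. Qed.
Lemma iter_dirD_add n a p q :
  iter n (dirD a) (p + q) = iter n (dirD a) p + iter n (dirD a) q.
Proof. by elim: n => //= n ->; rewrite dirD_add. Qed.
Lemma iter_dirDB n a p q :
  iter n (dirD a) (p - q) = iter n (dirD a) p - iter n (dirD a) q.
Proof. by elim: n => //= n ->; rewrite dirDB. Qed.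
Lemma dirDZl nu c p : dirD (c *: nu) p = c *: dirD nu p.
Proof. by rewrite /dirD !mxE scalerDr !scalerA. Qed.

Definition det2 a b : R := a 0 0 * b 0 1 - a 0 1 * b 0 0.

Lemma dirD_cramer a b nu p : det2 a b != 0 ->
  dirD nu p = (det2 nu b / det2 a b) *: dirD a p + (det2 a nu / det2 a b) *: dirD b p.
Proof.
rewrite /det2 => hab; rewrite /dirD !scalerDr !scalerA addrACA -!scalerDl.
by congr (_ *: _ + _ *: _); field.
Qed.

(** * Restriction of polynomials to a line *)

Definition pol_line a b : poly2 R -> {poly R} :=
  mmap polyC (fun i => (a 0 i)%:P + (b 0 i - a 0 i)%:P * 'X).

Lemma pol_lineD a b p q : pol_line a b (p + q) = pol_line a b p + pol_line a b q.
Proof. exact: mmapD. Qed.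
Lemma pol_lineB a b p q : pol_line a b (p - q) = pol_line a b p - pol_line a b q.
Proof. exact: mmapB. Qed.
Lemma pol_lineM a b p q : pol_line a b (p * q) = pol_line a b p * pol_line a b q.
Proof. exact: rmorphM. Qed.
Lemma pol_lineC a b c : pol_line a b (mpolyC 2 c) = c%:P.
Proof. exact: mmapC. Qed.
Lemma pol_lineX a b i :
  pol_line a b (mpolyX R (mnm1 i)) = (a 0 i)%:P + (b 0 i - a 0 i)%:P * 'X.
Proof. by rewrite /pol_line mmapX mmap1U. Qed.

Lemma horner_pol_line a b p t : (pol_line a b p).[t] = eval_at p (on_line a b t).
Proof.
elim/mpoly_alg_ind: p => [c|i|p q IHp IHq|p q IHp IHq].
- by rewrite pol_lineC hornerC evalC.
- by rewrite pol_lineX evalX !hornerE !mxE; ring.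
- by rewrite pol_lineD hornerD IHp IHq evalD.
- by rewrite pol_lineM hornerM IHp IHq evalM.
Qed.

Lemma deriv_pol_line a b p : (pol_line a b p)^`() = pol_line a b (dirD (b - a) p).
Proof.
elim/mpoly_alg_ind: p => [c|i|p q IHp IHq|p q IHp IHq].
- by rewrite pol_lineC derivC dirDC pol_lineC.
- rewrite pol_lineX dirDX pol_lineC derivD derivC derivM derivC derivX mul0r.
  by rewrite mulr1 !add0r !mxE.
- by rewrite pol_lineD derivD IHp IHq dirD_add pol_lineD.
- by rewrite pol_lineM derivM IHp IHq dirDM [RHS]pol_lineD !pol_lineM.
Qed.

Lemma msizeP n (p : mpoly n R) k :
  reflect (forall m, mcoeff m p != 0 -> (mdeg m <= k)%N) (msize p <= k.+1)%N.
Proof.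
apply: (iffP idP) => [h m|h].
  by rewrite -mcoeff_msupp => /msize_mdeg_lt => h2; rewrite -ltnS (leq_trans h2).
rewrite msizeE big_seq; apply/bigmax_leqP_seq => m mp _.
by rewrite ltnS h // -mcoeff_msupp.
Qed.

Lemma size_pol_line a b p k : (msize p <= k)%N -> (size (pol_line a b p) <= k)%N.
Proof.
case: k => [|k]; first by rewrite leqn0 msize_poly_eq0 => /eqP ->; rewrite /pol_line mmap0 size_poly0.
move=> /msizeP h; rewrite /pol_line /mmap big_seq.
apply: (big_ind (fun q : {poly R} => (size q <= k.+1)%N)).
- by rewrite size_poly0.
- by move=> f g hf hg; rewrite (leq_trans (size_polyD _ _)) // geq_max hf.
- move=> m; rewrite mcoeff_msupp => /h hm.
  rewrite mul_polyC (leq_trans (size_scale_leq _ _)) // /mmap1.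
  have lin i : (size ((a 0 i)%:P + (b 0 i - a 0 i)%:P * 'X)%R <= 2)%N.
    rewrite (leq_trans (size_polyD _ _)) // geq_max mul_polyC.
    rewrite (leq_trans (size_polyC_leq1 _)) //=.
    by rewrite (leq_trans (size_scale_leq _ _)) // size_polyX.
  have pw i e : (size (((a 0 i)%:P + (b 0 i - a 0 i)%:P * 'X) ^+ e)%R <= e.+1)%N.
    rewrite (leq_trans (size_poly_exp_leq _ _)) // ltnS.
    by move: (lin i); case: (size _) => [|[|[|//]]] //= _; rewrite ?mul0n // mul1n.
  rewrite !big_ord_recl big_ord0 mulr1 (leq_trans (size_polyMleq _ _)) //.
  move: hm; rewrite mdegE !big_ord_recl big_ord0 addn0 => hm.
  rewrite -ltnS; case: (size _ + size _)%N (leq_add (pw ord0 (m ord0)) (pw (lift ord0 ord0) (m (lift ord0 ord0)))) => [//|e] /=.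
  rewrite addSn addnS ltnS => /leq_trans; apply; lia.
Qed.

Lemma poly_eq0_horner (f : {poly R}) : (forall t, f.[t] = 0) -> f = 0.
Proof.
move=> f0; apply: (@roots_geq_poly_eq0 _ _ [seq i%:R | i <- iota 0 (size f)]).
- by apply/allP => t _; rewrite /root f0.
- by rewrite map_inj_uniq ?iota_uniq // => i j /eqP; rewrite eqr_nat => /eqP.
- by rewrite size_map size_iota.
Qed.

Lemma eval_line_eq0 a b p : (forall t, eval_at p (on_line a b t) = 0) ->
  forall t, eval_at (dirD (b - a) p) (on_line a b t) = 0.
Proof.
move=> p0 t; rewrite -horner_pol_line -deriv_pol_line.
by rewrite (poly_eq0_horner (f := pol_line a b p)) ?deriv0 ?horner0 // => s; rewrite horner_pol_line.
Qed.

Lemma on_line0 a b : on_line a b 0 = a.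
Proof. by rewrite /on_line subr0 scale1r scale0r addr0. Qed.
Lemma on_line1 a b : on_line a b 1 = b.
Proof. by rewrite /on_line subrr scale1r scale0r add0r. Qed.
Lemma on_lineC a b t : on_line a b t = on_line b a (1 - t).
Proof. by rewrite /on_line addrC; congr (_ *: _ + _ *: _); ring. Qed.

(** Vanishing to order [n]: the derivatives of orders 0, ..., n - 1 are zero, so [n] is a smoothness
    index plus one. The recursion on the two partial derivatives avoids multi-indices, which enter
    through [van_D]. *)
Fixpoint van (n : nat) x p : Prop :=
  if n is n'.+1 then [/\ eval_at p x = 0, van n' x (d1 p) & van n' x (d2 p)]
  else True.

Lemma van0 n x : van n x 0.
Proof.
elim: n => //= n IH; split; first exact: eval0.
- by rewrite /d1 mderiv0.
- by rewrite /d2 mderiv0.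
Qed.
Lemma vanD n x p q : van n x p -> van n x q -> van n x (p + q).
Proof.
elim: n p q => //= n IH p q [p0 p1 p2] [q0 q1 q2]; split.
- by rewrite evalD p0 q0 addr0.
- by rewrite /d1 mderivD; apply: IH.
- by rewrite /d2 mderivD; apply: IH.
Qed.
Lemma vanZ n x c p : van n x p -> van n x (c *: p).
Proof.
elim: n p => //= n IH p [p0 p1 p2]; split.
- by rewrite evalZ p0 mulr0.
- by rewrite /d1 mderivZ; apply: IH.
- by rewrite /d2 mderivZ; apply: IH.
Qed.
Lemma vanN n x p : van n x p -> van n x (- p).
Proof. by rewrite -scaleN1r; exact: vanZ. Qed.
Lemma vanB n x p q : van n x p -> van n x q -> van n x (p - q).
Proof. by move=> hp hq; apply: vanD => //; exact: vanN. Qed.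
Lemma van_sum n x (I : Type) (r : seq I) (P : pred I) (F : I -> poly2 R) :
  (forall i, P i -> van n x (F i)) -> van n x (\sum_(i <- r | P i) F i).
Proof. by move=> h; apply: big_ind => //; [exact: van0|exact: vanD]. Qed.
Lemma van_trans n x q p r : van n x (p - q) -> van n x (q - r) -> van n x (p - r).
Proof. by move=> h1 h2; rewrite -(subrKA q); apply: vanD. Qed.
Lemma van_sym n x p q : van n x (p - q) -> van n x (q - p).
Proof. by move=> /vanN; rewrite opprB. Qed.
Lemma vanS n x p : van n.+1 x p -> van n x p.
Proof. by elim: n p => //= n IH p [p0 p1 p2]; split => //; exact: IH. Qed.
Lemma van_leq m n x p : (m <= n)%N -> van n x p -> van m x p.
Proof.
move=> /subnK <-; elim: (n - m)%N => // d IH h; apply: IH; exact: vanS.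
Qed.
Lemma van_dirD n nu x p : van n.+1 x p -> van n x (dirD nu p).
Proof. by move=> /= [_ p1 p2]; apply: vanD; apply: vanZ. Qed.
Lemma van_iter_dirD m n nu x p :
  van (m + n) x p -> van n x (iter m (dirD nu) p).
Proof.
by elim: m n => //= m IH n h; apply: van_dirD; apply: IH; rewrite addnS.
Qed.
Lemma van_basis n x a b p : det2 a b != 0 -> eval_at p x = 0 ->
  van n x (dirD a p) -> van n x (dirD b p) -> van n.+1 x p.
Proof.
move=> hab p0 pa pb /=; split => //.
- by rewrite dirD_d1 (dirD_cramer _ _ hab); apply: vanD; apply: vanZ.
- by rewrite dirD_d2 (dirD_cramer _ _ hab); apply: vanD; apply: vanZ.
Qed.

Lemma van_D n x p :
  van n x p <-> forall alpha, (mdeg alpha < n)%N -> eval_at (D alpha p) x = 0.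
Proof.
elim: n p => [|n IH] p; first by split.
split=> [[p0 p1 p2] alpha|h].
  have [->|alpha0] := eqVneq alpha mnm0; first by rewrite /D mderivm0m.
  have [i alpha_i] : exists i, alpha i != 0%N.
    apply/existsP; apply: contraNT alpha0; rewrite negb_exists => /forallP h.
    by apply/eqP/mnmP => i; rewrite mnm0E; apply/eqP; move: (h i); rewrite negbK.
  rewrite -lep1mP in alpha_i; rewrite -(submK alpha_i) mdegD mdeg1 addn1 ltnS /D addmC.
  rewrite mderivmDm mderivmU1m => hd.
  case: i alpha_i hd => -[|[|//]] lti alpha_i hd.
  - have e : Ordinal lti = 0 by apply: val_inj.
    by rewrite e; rewrite e in hd; apply: (iffLR (IH _) p1).
  - have e : Ordinal lti = 1 by apply: val_inj.
    by rewrite e; rewrite e in hd; apply: (iffLR (IH _) p2).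
split.
- by have := h mnm0; rewrite mdeg0 /D mderivm0m; apply.
- apply/IH => alpha ha; have := h (mnm_add (mnm1 0) alpha).
  by rewrite mdegD mdeg1 add1n ltnS /D mderivmDm mderivmU1m; apply.
- apply/IH => alpha ha; have := h (mnm_add (mnm1 1) alpha).
  by rewrite mdegD mdeg1 add1n ltnS /D mderivmDm mderivmU1m; apply.
Qed.

(** A tangential derivative of a polynomial that vanishes on the line vanishes there too, so only
    the transversal derivatives carry information. *)
Lemma van_line n a b nu p : det2 nu (b - a) != 0 ->
  (forall t, van n (on_line a b t) p) <->
  (forall i, (i < n)%N -> forall t,
     eval_at (iter i (dirD nu) p) (on_line a b t) = 0).
Proof.
move=> hd; split=> [h i lt_in t|].
  have : van 1 (on_line a b t) (iter i (dirD nu) p); last by case.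
  by apply: van_iter_dirD; apply: van_leq (h t); rewrite addn1.
elim: n p => // n IH p h t; apply: (van_basis hd).
- exact: (h 0%N).
- apply: (IH (dirD nu p)) => i lt_in s; rewrite -iterSr; exact: h.
- apply: (IH (dirD (b - a) p)) => i lt_in s.
  rewrite iter_dirD_comm; apply: eval_line_eq0 => r; apply: h.
  exact: ltnW.
Qed.

Lemma van_coef n a b p : van n a p ->
  forall i, (i < n)%N -> (pol_line a b p)`_i = 0.
Proof.
elim: n p => // n IH p h [_|i lt_in].
  by rewrite -horner_coef0 horner_pol_line on_line0; case: h.
have /IH/(_ i lt_in) := van_dirD (b - a) h.
by rewrite -deriv_pol_line coef_deriv => /eqP; rewrite mulrn_eq0 => /eqP.
Qed.

Lemma van_dvdX n a p b : van n a p -> exists g, pol_line a b p = g * 'X^n.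
Proof.
move=> hp; have h i := @van_coef n a b p hp i; exists (drop_poly n (pol_line a b p)).
rewrite -{1}(poly_take_drop n (pol_line a b p)).
suff -> : take_poly n (pol_line a b p) = 0 by rewrite add0r.
by apply/polyP => i; rewrite coef_take_poly coef0; case: ifP => // /h.
Qed.

Lemma pol_line_rev a b p : pol_line a b p = pol_line b a p \Po (1 - 'X).
Proof.
apply/eqP; rewrite -subr_eq0; apply/eqP/poly_eq0_horner => t.
by rewrite !hornerE horner_comp !horner_pol_line on_lineC !hornerE subrr.
Qed.

(** The zeros of order [n] at the two ends give coprime factors, so their product divides the
    restriction. The cofactor [g] is what remains for the edge moments to determine. *)
Lemma van_bubble n a b p : van n a p -> van n b p ->
  exists g, pol_line a b p = g * ((1 - 'X) ^+ n * 'X^n).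
Proof.
move=> ha hb; have [g hg] := van_dvdX b ha; have [g' hg'] := van_dvdX a hb.
have : ((1 - 'X) ^+ n * 'X^n %| pol_line a b p)%R.
  rewrite Gauss_dvdp.
    rewrite {2}hg dvdp_mull // andbT pol_line_rev hg'.
    by rewrite comp_polyM comp_Xn_poly dvdp_mull.
  rewrite coprimep_expl // coprimep_expr // -(opprB 'X) -scaleN1r.
  by rewrite coprimepZl ?oppr_eq0 ?oner_eq0 // coprimepX rootE !hornerE oppr_eq0 oner_eq0.
by case/dvdpP => f ->; exists f.
Qed.
End Calculus.

(** * Degrees of freedom *)

Section UnivariateIntegral.
Context {R : realType}.
Implicit Types (f g h : {poly R}).

(* The term i = 0 vanishes because of the junk value 0^-1 = 0. *)
Definition prim f : {poly R} := \poly_(i < (size f).+1) (f`_i.-1 / i%:R).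

Lemma coef_prim f i : (prim f)`_i = f`_i.-1 / i%:R.
Proof.
rewrite coef_poly; case: ltnP => // hi; rewrite nth_default ?mul0r //.
by case: i hi.
Qed.

Lemma deriv_prim f : (prim f)^`() = f.
Proof.
apply/polyP => i; rewrite coef_deriv coef_prim /= -[LHS]mulr_natr divfK // pnatr_eq0.
Qed.

Lemma prim0 f : (prim f).[0] = 0.
Proof. by rewrite horner_coef0 coef_prim invr0 mulr0. Qed.

Lemma primB f g : prim (f - g) = prim f - prim g.
Proof. by apply/polyP => i; rewrite !(coefB, coef_prim) mulrBl. Qed.

Lemma integral_poly f :
  \int[lebesgue_measure]_(t in `[0, 1]) f.[t] = (prim f).[1] :> R.
Proof.
rewrite /Rintegral (@continuous_FTC2 _ _ (horner (prim f))).
- by rewrite prim0 /= oppr0 addr0.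
- exact: ltr01.
- apply: continuous_subspaceT => x; exact: continuous_horner.
- split=> [x _| |]; first exact: derivable_horner.
  + by apply: cvg_at_right_filter; exact: continuous_horner.
  + by apply: cvg_at_left_filter; exact: continuous_horner.
- by move=> x _; rewrite -derivE deriv_prim.
Qed.

(** By the mean value theorem the primitive is nondecreasing on the unit interval; being zero at
    both ends it is zero in between. *)
Lemma integral_poly_ge0_eq0 f : (forall t, 0 <= t <= 1 -> 0 <= f.[t]) ->
  (prim f).[1] = 0 -> f = 0.
Proof.
move=> f0 F1; set F := prim f in F1 *.
have mvt x y : 0 <= x -> x <= y -> y <= 1 -> F.[x] <= F.[y].
  move=> x0 xy y1.
  have [||c] := @MVT_segment R (horner F) (horner f) x y xy.
  - move=> z _; split; first exact: derivable_horner.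
    by rewrite -derive1E -derivE deriv_prim.
  - apply: continuous_subspaceT => z; exact: continuous_horner.
  rewrite in_itv /= => /andP[xc cy] e.
  rewrite -subr_ge0 e mulr_ge0 ?subr_ge0 // f0 //.
  by rewrite (le_trans x0 xc) (le_trans cy y1).
have Fz t : 0 <= t <= 1 -> F.[t] = 0.
  case/andP=> t0 t1; apply/eqP; rewrite eq_le -{1}F1 mvt //=.
  by rewrite -(prim0 f) mvt.
(* The reciprocals of the positive integers provide as many distinct roots in the interval as the
   size of [F]. *)
suff -> : f = F^`() by rewrite (_ : F = 0) ?deriv0 //;
  apply: (@roots_geq_poly_eq0 _ _ [seq i.+1%:R^-1 | i <- iota 0 (size F)]);
  [apply/allP => _ /mapP[i _ ->]; rewrite /root Fz //; apply/andP; split;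
     [by rewrite invr_ge0|by rewrite invf_le1 ?ltr0n // ler1n]
  |rewrite map_inj_uniq ?iota_uniq // => i j /invr_inj /eqP;
     by rewrite eqr_nat eqSS => /eqP
  |by rewrite size_map size_iota].
by rewrite deriv_prim.
Qed.

(** Subtracting the value at 0 times the power of 1 - X of top degree leaves a multiple of X, whose
    quotient has a smaller degree bound. *)
Lemma bernstein1 d g : (size g <= d.+1)%N ->
  exists c : nat -> R, g = \sum_(i < d.+1) c i *: ((1 - 'X) ^+ (d - i) * 'X ^+ i).
Proof.
elim: d g => [|d IH] g hg.
  exists (fun=> g`_0); rewrite big_ord1 !expr0 mulr1.
  by rewrite {1}(size1_polyC hg) alg_polyC.
have h0 : (g - g.[0] *: (1 - 'X) ^+ d.+1).[0] = 0.
  by rewrite !hornerE subr0 expr1n mulr1 subrr.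
have [g' eg'] := factor_theorem _ _ (introT rootP h0).
rewrite subr0 in eg'.
have sg' : (size g' <= d.+1)%N.
  have [->|g'0] := eqVneq g' 0; first by rewrite size_poly0.
  have : (size (g' * 'X)%R <= d.+2)%N.
    rewrite -eg' (leq_trans (size_polyD _ _)) // geq_max hg size_polyN.
    rewrite (leq_trans (size_scale_leq _ _)) //.
    rewrite (leq_trans (size_poly_exp_leq _ _)) // ltnS.
    rewrite -[X in (_ <= X)%N]mul1n leq_mul2r /= -subn1 leq_subLR.
    by rewrite (leq_trans (size_polyD _ _)) // geq_max size_poly1 size_polyN size_polyX.
  by rewrite size_mulX.
have [c ec] := IH _ sg'.
exists (fun i => if i is j.+1 then c j else g.[0]).
rewrite big_ord_recl subn0 expr0 mulr1 /= -[LHS](subrK (g.[0] *: (1 - 'X) ^+ d.+1)) eg'.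
rewrite addrC ec mulr_suml; congr (_ + _); apply: eq_bigr => i _.
by rewrite -scalerAl -mulrA -exprSr /bump /= add1n subSS.
Qed.

Lemma edge_span_mon m n (rho2 : int) (s1 s2 : nat) c :
  (s1 + s2)%:Z = m%:Z - n%:Z -> rho2 - n%:Z < s1%:Z -> rho2 - n%:Z < s2%:Z ->
  edge_span m n rho2 (c *: ((1 - 'X) ^+ s1 * 'X ^+ s2) : {poly R}).
Proof.
move=> e h1 h2.
have l1 : (s1 < m.+1)%N by lia.
have l2 : (s2 < m.+1)%N by lia.
exists (fun i j => if (i == Ordinal l1) && (j == Ordinal l2) then c else 0).
rewrite (bigD1 (Ordinal l1)) //= [X in _ = _ + X]big1 ?addr0; last first.
  by move=> i /negPf ->; rewrite big1 // => j _; rewrite scale0r.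
rewrite (bigD1 (Ordinal l2)) /=; last by rewrite h1 h2 !andbT; apply/eqP; lia.
rewrite [X in _ = _ + X]big1 ?addr0 ?eqxx //.
by move=> j /andP[_ /negPf ->]; rewrite andbF scale0r.
Qed.

Lemma edge_span_add m n (rho2 : int) (f g : {poly R}) :
  edge_span m n rho2 f -> edge_span m n rho2 g -> edge_span m n rho2 (f + g).
Proof.
move=> [c ->] [c' ->]; exists (fun i j => c i j + c' i j).
rewrite -big_split; apply: eq_bigr => i _ /=.
by rewrite -big_split; apply: eq_bigr => j _; rewrite scalerDl.
Qed.

Lemma edge_span0 m n (rho2 : int) : edge_span m n rho2 (0 : {poly R}).
Proof.
exists (fun _ _ => 0); rewrite big1 // => i _; rewrite big1 // => j _.
by rewrite scale0r.
Qed.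

Lemma size_bubble s : size ((1 - 'X) ^+ s * 'X^s : {poly R}) = (2 * s).+1.
Proof.
have X0 : (1 - 'X : {poly R}) != 0.
  by rewrite -size_poly_eq0 -opprB size_polyN size_XsubC.
rewrite size_mulXn ?expf_neq0 //.
rewrite -(opprB 'X) exprNn -signr_odd mulr_sign (fun_if (fun p : {poly R} => size p)).
by rewrite size_polyN size_exp_XsubC if_same mulSn mul1n addnS.
Qed.

Lemma bubble_cofactor_size s g (k : nat) :
  (size (g * ((1 - 'X) ^+ s * 'X^s))%R <= k)%N -> g != 0 ->
  (size g + 2 * s <= k)%N.
Proof.
move=> h g0; move: h; rewrite size_mul ?size_bubble ?addnS //.
by rewrite -size_poly_gt0 size_bubble.
Qed.

Lemma edge_span_bubble m n s (rho2 : int) g : (n <= m)%N ->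
  rho2 - n%:Z < s%:Z ->
  (size (g * ((1 - 'X) ^+ s * 'X^s))%R <= (m - n).+1)%N ->
  edge_span m n rho2 (g * ((1 - 'X) ^+ s * 'X^s)).
Proof.
move=> lnm hs hsize; have [->|g0] := eqVneq g 0; first by rewrite mul0r; exact: edge_span0.
have := bubble_cofactor_size hsize g0; have : (0 < size g)%N by rewrite size_poly_gt0.
move=> sg0 sg.
have [|c ->] := @bernstein1 (m - n - 2 * s)%N g; first by lia.
rewrite mulr_suml; apply: big_ind => [|f h|i _]; [exact: edge_span0|exact: edge_span_add|].
rewrite -scalerAl mulrACA -!exprD; apply: edge_span_mon => //; have := ltn_ord i; lia.
Qed.

(** The alternatives are the two kinds of edge moments. In [Vspace] the test polynomials are
    themselves multiples of the bubble, so [f] can be tested against itself. In the Stenberg space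
    they are all polynomials of the degree of the cofactor, so [f] is tested against [g], and the
    integrand is the square of [g] times a nonnegative weight. *)
Lemma bubble_orth f g s : f = g * ((1 - 'X) ^+ s * 'X^s) ->
  ((prim (f * f)).[1] = 0 \/ (prim (f * g)).[1] = 0) -> f = 0.
Proof.
move=> ef [] h.
  have : f * f = 0.
    apply: integral_poly_ge0_eq0 h => t _; rewrite hornerM; exact: sqr_ge0.
  by move=> /eqP; rewrite mulf_eq0 orbb => /eqP.
apply/eqP; have /eqP : f * g = 0.
  apply: integral_poly_ge0_eq0 h => t /andP[t0 t1].
  rewrite ef mulrAC !hornerM -expr2 mulr_ge0 ?sqr_ge0 // mulr_ge0 //.
    by rewrite horner_exp exprn_ge0 // !hornerE subr_ge0.
  by rewrite hornerXn exprn_ge0.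
by rewrite mulf_eq0 => /orP[|/eqP g0] //; rewrite ef g0 mul0r.
Qed.
End UnivariateIntegral.

(** * Unisolvence of the moments on one edge *)

Section EdgeDofs.
Context {R : realType}.
Implicit Types (p q : poly2 R) (a b : plane R).

Lemma norm2_gt0 a : a != 0 -> 0 < norm2 a.
Proof.
move=> a0; rewrite /norm2 sqrtr_gt0 lt_def addr_ge0 ?sqr_ge0 // andbT.
apply: contra_neq a0 => /eqP; rewrite paddr_eq0 ?sqr_ge0 // !sqrf_eq0 => /andP[/eqP e0 /eqP e1].
apply/rowP => -[[|[|//]] lti]; rewrite mxE; [rewrite -e0|rewrite -e1]; congr (a _ _); exact: val_inj.
Qed.

Lemma edge_intE a b p (q : {poly R}) :
  edge_int a b p q = norm2 (b - a) * (prim (pol_line a b p * q)).[1].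
Proof.
rewrite /edge_int -integral_poly; congr (_ * _).
by apply: eq_Rintegral => t _; rewrite hornerM horner_pol_line.
Qed.

Lemma edge_int_diff a b p q (g : {poly R}) : a != b ->
  (edge_int a b p g = edge_int a b q g) <->
  (prim (pol_line a b (p - q) * g)).[1] = 0.
Proof.
move=> ab; have n0 : norm2 (b - a) != 0.
  by rewrite gt_eqF // norm2_gt0 // subr_eq0 eq_sym.
rewrite !edge_intE pol_lineB mulrBl primB hornerD hornerN; split.
  by move/(mulfI n0) ->; rewrite subrr.
by move/eqP; rewrite subr_eq0 => /eqP ->.
Qed.

Lemma msize_dirD nu p k : (msize p <= k)%N -> (msize (dirD nu p) <= k.-1)%N.
Proof.
case: k => [|[|k]].
- by rewrite leqn0 msize_poly_eq0 => /eqP ->; rewrite dirD0 msize0.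
- by move=> /msize1_polyC ->; rewrite dirDC msize0.
move=> /msizeP h; apply/msizeP => m; rewrite /dirD mcoeffD !mcoeffZ !mcoeff_deriv.
apply: contraNT; rewrite -ltnNge => hm.
have z i : mcoeff (mnm_add m (mnm1 i)) p = 0.
  by apply/eqP; apply: contraTT hm => /h; rewrite mdegD mdeg1 addn1 ltnS -leqNgt.
by rewrite !z !mul0rn !mulr0 addr0.
Qed.

Lemma msize_iter_dirD n nu p k :
  (msize p <= k)%N -> (msize (iter n (dirD nu) p) <= k - n)%N.
Proof.
move=> h; elim: n => [|n IH]; first by rewrite subn0.
by rewrite /= subnS; apply: msize_dirD.
Qed.

Lemma msizeD (n k : nat) (p q : mpoly n R) :
  (msize p <= k)%N -> (msize q <= k)%N -> (msize (p + q) <= k)%N.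
Proof. by move=> hp hq; rewrite (leq_trans (msizeD_le _ _)) // geq_max hp. Qed.
Lemma msizeB (n k : nat) (p q : mpoly n R) :
  (msize p <= k)%N -> (msize q <= k)%N -> (msize (p - q) <= k)%N.
Proof. by move=> hp hq; apply: msizeD => //; rewrite msizeN. Qed.
Lemma msizeZ (n k : nat) c (p : mpoly n R) :
  (msize p <= k)%N -> (msize (c *: p) <= k)%N.
Proof. by move=> hp; rewrite (leq_trans (msizeZ_le _ _)). Qed.

Section OneEdge.
Variables (a b nu : plane R).

Lemma eval_line_pol p : (forall t, eval_at p (on_line a b t) = 0) <-> pol_line a b p = 0.
Proof.
split=> [h|h t]; last by rewrite -horner_pol_line h horner0.
by apply: poly_eq0_horner => t; rewrite horner_pol_line.
Qed.

(** After [n] derivatives the order of vanishing at the ends is still [M - n], which is the power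
    that [s1, s2 > rho2 - n] demands for [rho2 = M - 1]. *)
Lemma moment_unisolvent (m n M : nat) p : (n <= M)%N -> (n <= m)%N ->
  (msize p <= m.+1)%N -> van M a p -> van M b p ->
  (forall q : {poly R}, edge_span m n (M%:Z - 1) q ->
     (prim (pol_line a b (iter n (dirD nu) p) * q)).[1] = 0) ->
  forall t, eval_at (iter n (dirD nu) p) (on_line a b t) = 0.
Proof.
move=> nM nm mp va vb h; apply/eval_line_pol.
have [| |g eg] := @van_bubble R (M - n) a b (iter n (dirD nu) p).
- by apply: van_iter_dirD; rewrite subnKC.
- by apply: van_iter_dirD; rewrite subnKC.
have hs : (size (pol_line a b (iter n (dirD nu) p)) <= (m - n).+1)%N.
  by apply: size_pol_line; rewrite -subSn //; exact: msize_iter_dirD.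
apply: (bubble_orth eg); left; apply: h; rewrite eg.
apply: edge_span_bubble => //; last by rewrite -eg.
by rewrite -subzn //; lia.
Qed.

(** The cofactor of the bubble of order r + 1 - m has degree at most (k - m) - 2 (r + 1 - m) = k - 2
    r - 2 + m, exactly the degree of the test polynomials. *)
Lemma poly_moment_unisolvent (k r m : nat) p : (m <= r.+1)%N ->
  (msize p <= k.+1)%N -> van r.+1 a p -> van r.+1 b p ->
  (forall q : {poly R}, edge_poly (k%:Z - 2 * r%:Z - 2 + m%:Z) q ->
     (prim (pol_line a b (iter m (dirD nu) p) * q)).[1] = 0) ->
  forall t, eval_at (iter m (dirD nu) p) (on_line a b t) = 0.
Proof.
move=> mr mp va vb h; apply/eval_line_pol.
have [| |g eg] := @van_bubble R (r.+1 - m) a b (iter m (dirD nu) p).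
- by apply: van_iter_dirD; rewrite subnKC.
- by apply: van_iter_dirD; rewrite subnKC.
have [g0|g0] := eqVneq g 0; first by rewrite eg g0 mul0r.
apply: (bubble_orth eg); right; apply: h; rewrite /edge_poly /=.
have hs : (size (pol_line a b (iter m (dirD nu) p)) <= k.+1 - m)%N.
  by apply: size_pol_line; exact: msize_iter_dirD.
move: hs; rewrite eg => /bubble_cofactor_size /(_ g0).
have : (0 < size g)%N by rewrite size_poly_gt0.
by move: (size (polyseq g)) => e h1 h2; lia.
Qed.
End OneEdge.
End EdgeDofs.

(** * Both spaces in terms of jumps *)

Section GridChar.
Context {R : realType} {T : grid R}.
Implicit Types (u : pwpoly T) (v : pwvect T) (p q : poly2 R).

(** [N] and [M] are [rho1 + 1] and [rho2 + 1], so that the index -1, which imposes no condition,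
    becomes the natural number 0. *)
Definition smooth (m N M : nat) u : Prop :=
  [/\ pw_degree m u,
      forall (x : vertex T) (K L : cell T), x \in corners K -> x \in corners L ->
        van M (pos x) (u K - u L) &
      on_edges (fun a b K L => forall t, van N (on_line a b t) (u K - u L))].

(** The jump of the normal component times the length of the edge; leaving out the normalisation
    keeps square roots away from the later arguments. *)
Definition flux_jump (a b : plane R) v K L : poly2 R :=
  (b - a) 0 1 *: (v.1 K - v.1 L) - (b - a) 0 0 *: (v.2 K - v.2 L).

(** The additional normal derivative of the normal component is recorded as a condition on the
    divergence, the form in which [curl] produces it and [div] consumes it. *)
Definition smooth_div (k N M : nat) v : Prop :=
  [/\ pw_degree k v.1 /\ pw_degree k v.2,
      forall (x : vertex T) (K L : cell T), x \in corners K -> x \in corners L ->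
        van M (pos x) (v.1 K - v.1 L) /\ van M (pos x) (v.2 K - v.2 L) &
      on_edges (fun a b K L => forall t,
        [/\ eval_at (flux_jump a b v K L) (on_line a b t) = 0,
            van N (on_line a b t) (v.1 K - v.1 L),
            van N (on_line a b t) (v.2 K - v.2 L) &
            van N (on_line a b t) (div v K - div v L)])].

(** The weights 1 at [x] and -1 at [y] would be an affine dependence. *)
Lemma corners_pos_inj (K : cell T) (x y : vertex T) :
  x \in corners K -> y \in corners K -> pos x = pos y -> x = y.
Proof.
move=> xK yK exy; apply/eqP/negPn/negP => xy.
have := @corners_free _ T K (fun z => (z == x)%:R - (z == y)%:R) _ _ x xK.
rewrite eqxx (negPf xy) subr0 => h.
suff /eqP : (1 : R) = 0 by rewrite oner_eq0.
apply: h.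
- rewrite sumrB.
  rewrite (bigD1 x) //= eqxx big1 ?addr0; last by move=> z /andP[_ /negPf ->].
  rewrite (bigD1 y) //= eqxx big1 ?addr0 ?subrr //; last by move=> z /andP[_ /negPf ->].
- under eq_bigr do rewrite scalerBl.
  rewrite sumrB (bigD1 x) //= eqxx big1 ?addr0; last first.
    by move=> z /andP[_ /negPf ->]; rewrite scale0r.
  rewrite (bigD1 y) //= eqxx big1 ?addr0 ?exy ?subrr //; last first.
  by move=> z /andP[_ /negPf ->]; rewrite scale0r.
Qed.

Lemma tangentE (a b : plane R) i : tangent a b 0 i = (norm2 (b - a))^-1 * (b - a) 0 i.
Proof. by rewrite /tangent; move: (b - a) => d; rewrite mxE. Qed.

Lemma normal_tangent (a b : plane R) : a != b ->
  [/\ 0 < norm2 (b - a),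
      det2 (normal a b) (b - a) != 0,
      det2 (normal a b) (tangent a b) = 1,
      tangent a b 0 0 ^+ 2 + tangent a b 0 1 ^+ 2 = 1
    & normal a b 0 0 = tangent a b 0 1 /\ normal a b 0 1 = - tangent a b 0 0].
Proof.
move=> ab; have n0 : 0 < norm2 (b - a) by rewrite norm2_gt0 // subr_eq0 eq_sym.
have nE : norm2 (b - a) ^+ 2 = (b - a) 0 0 ^+ 2 + (b - a) 0 1 ^+ 2.
  by rewrite sqr_sqrtr // addr_ge0 ?sqr_ge0.
have nz := lt0r_neq0 n0.
have e1 : tangent a b 0 0 ^+ 2 + tangent a b 0 1 ^+ 2 = 1.
  rewrite !tangentE !exprMn -mulrDr -nE exprVn mulVf //.
  by rewrite expf_neq0.
have e2 : normal a b 0 0 = tangent a b 0 1 /\ normal a b 0 1 = - tangent a b 0 0.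
  by rewrite /normal !mxE.
have e4 : det2 (normal a b) (tangent a b) = 1.
  by rewrite /det2 e2.1 e2.2 mulNr opprK -!expr2 addrC.
split=> //; move: e4; rewrite /det2 !tangentE.
rewrite mulrCA [X in _ - X]mulrCA -mulrBr => h; apply/eqP => h0.
by move: h; rewrite h0 mulr0 => /eqP; rewrite eq_sym oner_eq0.
Qed.

(** Unisolvence on each edge, fed with the vertex conditions at its two ends, gives one direction;
    in the other the integrands vanish identically. *)
Lemma Vspace_smooth m N M (rho1 rho2 : int) u : (N <= M)%N -> (N <= m)%N ->
  rho1 = N%:Z - 1 -> rho2 = M%:Z - 1 -> Vspace T m rho1 rho2 u <-> smooth m N M u.
Proof.
move=> NM Nm -> ->; split=> -[hd hv he]; split => //.
- move=> x K L xK xL; apply/van_D => alpha ha.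
  by rewrite /D mderivmB evalB (hv x K L xK xL) ?subrr //; lia.
- move=> x y K L xy xK yK xL yL.
  have ab : pos x != pos y by apply: contra_neq xy => /(corners_pos_inj xK yK).
  have [_ dn _ _ _] := normal_tangent ab.
  apply/(van_line _ _ dn) => n ltnN.
  have vanM z : z \in corners K -> z \in corners L -> van M (pos z) (u K - u L).
    move=> zK zL; apply/van_D => alpha ha.
    by rewrite /D mderivmB evalB (hv z K L zK zL) ?subrr //; lia.
  apply: (@moment_unisolvent _ _ _ _ m n M) => //; [lia|lia|exact: msizeB|exact: vanM|exact: vanM|].
  move=> q hq; rewrite iter_dirDB; apply/(edge_int_diff _ _ _ ab).
  have n0 : (norm2 (pos y - pos x))^-1 != 0.
    by rewrite invr_eq0 gt_eqF // norm2_gt0 // subr_eq0 eq_sym.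
  apply: (mulfI n0); apply: (he x y) => //; lia.
- move=> x K L xK xL alpha ha; apply/eqP; rewrite -subr_eq0 -evalB /D -mderivmB; apply/eqP.
  by move/van_D: (hv x K L xK xL); apply; lia.
- move=> x y K L xy xK yK xL yL n hn q _; congr (_ * _).
  have ab : pos x != pos y by apply: contra_neq xy => /(corners_pos_inj xK yK).
  have [_ dn _ _ _] := normal_tangent ab.
  apply/(edge_int_diff _ _ _ ab); rewrite -iter_dirDB.
  have := he x y K L xy xK yK xL yL => /(van_line _ _ dn)/(_ n) h.
  rewrite (iffLR (eval_line_pol _ _ _)) ?mul0r; last by apply: h; lia.
  by rewrite -(subrr 0) primB subrr horner0.
Qed.

Lemma div_rotate (nu ta : plane R) p q :
  nu 0 0 = ta 0 1 -> nu 0 1 = - ta 0 0 -> ta 0 0 ^+ 2 + ta 0 1 ^+ 2 = 1 ->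
  d1 p + d2 q = dirD nu (nu 0 0 *: p + nu 0 1 *: q) + dirD ta (ta 0 0 *: p + ta 0 1 *: q).
Proof.
rewrite /dirD => -> -> h; rewrite /d1 /d2 !mderivD !mderivZ -!mul_mpolyC.
rewrite -[X in X + _ = _]mul1r -[X in _ + X = _]mul1r -(mpolyC1 2) -h.
rewrite !mpolyCD !mpolyCN ?rmorphXn /=; ring.
Qed.

(** In the frame of normal and tangent, the i-th normal derivative of the divergence is the normal
    derivative of order i + 1 of the normal component plus a tangential derivative of something that
    already vanishes on the edge. So order [N] for the divergence is traded for one more normal
    derivative of the normal component. *)
Lemma edge_smooth_div (a b : plane R) N p q : a != b ->
  let nu := normal a b in let ta := tangent a b in
  (forall t, [/\ eval_at ((b - a) 0 1 *: p - (b - a) 0 0 *: q) (on_line a b t) = 0,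
     van N (on_line a b t) p, van N (on_line a b t) q &
     van N (on_line a b t) (d1 p + d2 q)]) <->
  ((forall i, (i < N.+1)%N -> forall t,
     eval_at (iter i (dirD nu) (nu 0 0 *: p + nu 0 1 *: q)) (on_line a b t) = 0) /\
   (forall i, (i < N)%N -> forall t,
     eval_at (iter i (dirD nu) (ta 0 0 *: p + ta 0 1 *: q)) (on_line a b t) = 0)).
Proof.
move=> ab nu ta; have [/lt0r_neq0 n0 dn e4 h [e1 e2]] := normal_tangent ab.
have taE : ta = (norm2 (b - a))^-1 *: (b - a) by [].
have fluxE : (b - a) 0 1 *: p - (b - a) 0 0 *: q =
    norm2 (b - a) *: (nu 0 0 *: p + nu 0 1 *: q).
  by rewrite /nu e1 e2 !tangentE scalerDr !scalerA mulrN !mulrA mulfV // !mul1r scaleNr.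
have divi i : iter i (dirD nu) (d1 p + d2 q) =
    iter i.+1 (dirD nu) (nu 0 0 *: p + nu 0 1 *: q) +
    dirD ta (iter i (dirD nu) (ta 0 0 *: p + ta 0 1 *: q)).
  by rewrite (div_rotate p q e1 e2 h) iter_dirD_add !iter_dirD_comm.
have tan0 f : (forall t, eval_at f (on_line a b t) = 0) ->
    forall t, eval_at (dirD ta f) (on_line a b t) = 0.
  by move=> hf t; rewrite taE dirDZl evalZ (eval_line_eq0 hf) mulr0.
split=> [hh|[hn ht]].
  have ht : forall i, (i < N)%N -> forall t,
     eval_at (iter i (dirD nu) (ta 0 0 *: p + ta 0 1 *: q)) (on_line a b t) = 0.
    apply/(van_line _ _ dn) => t; have [_ vp vq _] := hh t.
    by apply: vanD; apply: vanZ.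
  split=> // -[_ t|i hi t].
    have [+ _ _ _] := hh t; rewrite fluxE evalZ => /eqP.
    by rewrite mulf_eq0 (negPf n0) => /eqP.
  have hdiv : forall i, (i < N)%N -> forall t,
     eval_at (iter i (dirD nu) (d1 p + d2 q)) (on_line a b t) = 0.
    by apply/(van_line _ _ dn) => s; have [_ _ _] := hh s.
  have := hdiv i hi t; rewrite divi evalD (tan0 _ (ht i hi)) addr0; exact.
have vn t : van N (on_line a b t) (nu 0 0 *: p + nu 0 1 *: q).
  by move: t; apply/(van_line _ _ dn) => i hi; apply: hn; apply: ltnW.
have vt : forall t, van N (on_line a b t) (ta 0 0 *: p + ta 0 1 *: q).
  exact/(van_line _ _ dn).
move=> t; split.
- by rewrite fluxE evalZ (hn 0%N) ?mulr0.
- have -> : p = nu 0 0 *: (nu 0 0 *: p + nu 0 1 *: q) + ta 0 0 *: (ta 0 0 *: p + ta 0 1 *: q).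
    rewrite -[LHS]scale1r -h /nu e1 e2 !scalerDr !scalerA addrACA -!scalerDl.
    rewrite mulrN [ta 0 1 * ta 0 0]mulrC addNr scale0r addr0; congr (_ *: _); rewrite -/ta; ring.
  by apply: vanD; apply: vanZ.
- have -> : q = nu 0 1 *: (nu 0 0 *: p + nu 0 1 *: q) + ta 0 1 *: (ta 0 0 *: p + ta 0 1 *: q).
    rewrite -[LHS]scale1r -h /nu e1 e2 !scalerDr !scalerA addrACA -!scalerDl.
    rewrite mulNr [ta 0 1 * ta 0 0]mulrC addNr scale0r add0r; congr (_ *: _); rewrite -/ta; ring.
  by apply: vanD; apply: vanZ.
- move: t; apply/(van_line _ _ dn) => i hi t.
  by rewrite divi evalD hn // (tan0 _ (ht i hi)) addr0.
Qed.

Lemma Stenberg_smooth_div k N r2 (l : int) (r1 : rat) v :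
  N%:Z = l + 1 -> r1 = l%:~R + 1 / 2 -> (N <= r2.+1)%N ->
  Stenberg T k r1 r2 v <-> smooth_div k N r2.+1 v.
Proof.
move=> hN hr hNr.
(* As r1 + 1/2 = N and r1 - 1/2 = N - 1, the rational bounds give N + 1 orders for the normal
   component and N orders for the tangential one. *)
have le1 (m : nat) : (m%:R <= r1 + 1 / 2) = (m < N.+1)%N.
  have -> : r1 + 1 / 2 = (N%:R : rat) by rewrite hr -[N%:R]/(N%:Z%:~R) hN intrD; field.
  by rewrite ler_nat.
have le2 (m : nat) : (m%:R <= r1 - 1 / 2) = (m < N)%N.
  have -> : r1 - 1 / 2 = l%:~R by rewrite hr; field.
  have -> : l = N%:Z - 1 by lia.
  by rewrite -[m%:R]/(m%:Z%:~R) ler_int; lia.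
have dotB nu K L : dot v nu K - dot v nu L = nu 0 0 *: (v.1 K - v.1 L) + nu 0 1 *: (v.2 K - v.2 L).
  by rewrite !ffunE !scalerBr opprD addrACA.
have divB K L : div v K - div v L = d1 (v.1 K - v.1 L) + d2 (v.2 K - v.2 L).
  by rewrite !ffunE /d1 /d2 !mderivB opprD addrACA.
split=> [[[hd1 hd2] [hv1 hv2] hn ht]|[[hd1 hd2] hv he]].
  have hv x K L : x \in corners K -> x \in corners L ->
      van r2.+1 (pos x) (v.1 K - v.1 L) /\ van r2.+1 (pos x) (v.2 K - v.2 L).
    move=> xK xL; split; apply/van_D => alpha ha; rewrite /D mderivmB evalB.
      by rewrite (hv1 x K L xK xL) ?subrr //; lia.
    by rewrite (hv2 x K L xK xL) ?subrr //; lia.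
  split=> // x y K L xy xK yK xL yL.
  have ab : pos x != pos y by apply: contra_neq xy => /(corners_pos_inj xK yK).
  rewrite /flux_jump divB; apply/(edge_smooth_div _ _ _ ab); split=> i hi.
    apply: (@poly_moment_unisolvent _ _ _ _ k r2) => //.
    - lia.
    - by apply: msizeD; apply: msizeZ; apply: msizeB.
    - by have [] := hv x K L xK xL; move=> *; apply: vanD; apply: vanZ.
    - by have [] := hv y K L yK yL; move=> *; apply: vanD; apply: vanZ.
    - move=> q hq; rewrite -dotB iter_dirDB; apply/(edge_int_diff _ _ _ ab).
      by apply: (hn x y) => //; rewrite le1.
  apply: (@poly_moment_unisolvent _ _ _ _ k r2) => //.
  - lia.
  - by apply: msizeD; apply: msizeZ; apply: msizeB.
  - by have [] := hv x K L xK xL; move=> *; apply: vanD; apply: vanZ.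
  - by have [] := hv y K L yK yL; move=> *; apply: vanD; apply: vanZ.
  - move=> q hq; rewrite -dotB iter_dirDB; apply/(edge_int_diff _ _ _ ab).
    by apply: (ht x y) => //; rewrite le2.
split=> //.
- split=> x K L xK xL alpha ha; apply/eqP; rewrite -subr_eq0 -evalB /D -mderivmB; apply/eqP.
    by have [/van_D h _] := hv x K L xK xL; apply: h; lia.
  by have [_ /van_D h] := hv x K L xK xL; apply: h; lia.
- move=> x y K L xy xK yK xL yL m; rewrite le1 => hm q _.
  have ab : pos x != pos y by apply: contra_neq xy => /(corners_pos_inj xK yK).
  apply/(edge_int_diff _ _ _ ab); rewrite -iter_dirDB dotB.
  have := he x y K L xy xK yK xL yL; rewrite /flux_jump divB.
  move=> /(edge_smooth_div _ _ _ ab) [/(_ m hm) h _].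
  rewrite (iffLR (eval_line_pol _ _ _) h) mul0r.
  by rewrite -(subrr 0) primB subrr horner0.
- move=> x y K L xy xK yK xL yL m; rewrite le2 => hm q _.
  have ab : pos x != pos y by apply: contra_neq xy => /(corners_pos_inj xK yK).
  apply/(edge_int_diff _ _ _ ab); rewrite -iter_dirDB dotB.
  have := he x y K L xy xK yK xL yL; rewrite /flux_jump divB.
  move=> /(edge_smooth_div _ _ _ ab) [_ /(_ m hm) h].
  rewrite (iffLR (eval_line_pol _ _ _) h) mul0r.
  by rewrite -(subrr 0) primB subrr horner0.
Qed.
End GridChar.

(** * Bernstein form on a triangle *)

Section Supports.
Context {R : realType} {n : nat}.
Implicit Types (h g : mpoly n R) (P Q : multinom n -> Prop) (m : multinom n).

Definition supp_in P h : Prop := forall m, mcoeff m h != 0 -> P m.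
Definition homog k : mpoly n R -> Prop := supp_in (fun m => mdeg m = k).

Lemma supp_in0 P : supp_in P 0.
Proof. by move=> m; rewrite mcoeff0 eqxx. Qed.
Lemma supp_inD P h g : supp_in P h -> supp_in P g -> supp_in P (h + g).
Proof.
move=> hh hg m; rewrite mcoeffD; have [->|/hh//] := eqVneq (mcoeff m h) 0.
by rewrite add0r => /hg.
Qed.
Lemma supp_inZ P c h : supp_in P h -> supp_in P (c *: h).
Proof. by move=> hh m; rewrite mcoeffZ mulf_eq0 negb_or => /andP[_ /hh]. Qed.
Lemma supp_inN P h : supp_in P h -> supp_in P (- h).
Proof. by move=> hh m; rewrite mcoeffN oppr_eq0 => /hh. Qed.
Lemma supp_inB P h g : supp_in P h -> supp_in P g -> supp_in P (h - g).
Proof. by move=> hh hg; apply: supp_inD => //; apply: supp_inN. Qed.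
Lemma supp_in_sum P (I : Type) (r : seq I) (F : I -> mpoly n R) :
  (forall i, supp_in P (F i)) -> supp_in P (\sum_(i <- r) F i).
Proof. by move=> hF; apply: big_ind => //; [exact: supp_in0|exact: supp_inD]. Qed.
Lemma supp_inX P m : P m -> supp_in P (mpolyX R m).
Proof.
by move=> Pm m'; rewrite mcoeffX; have [<-|] := eqVneq m m'; rewrite ?eqxx.
Qed.
Lemma supp_inC P c : P (mnm0) -> supp_in P (mpolyC n c).
Proof.
by move=> P0 m; rewrite mcoeffC; have [->|] := eqVneq m mnm0; rewrite ?mulr0 ?eqxx.
Qed.
Lemma supp_inM P Q W h g : supp_in P h -> supp_in Q g ->
  (forall m m', P m -> Q m' -> W (mnm_add m m')) -> supp_in W (h * g).
Proof.
move=> hh hg PQ m; rewrite -mcoeff_msupp => /msuppM_le /allpairsP [[m1 m2] /= [h1 h2 ->]].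
by apply: PQ; [apply: hh|apply: hg]; rewrite -mcoeff_msupp.
Qed.
Lemma supp_in_deriv P Q i h : (forall m, P (mnm_add m (mnm1 i)) -> Q m) ->
  supp_in P h -> supp_in Q (mderiv i h).
Proof.
move=> PQ hh m; rewrite mcoeff_deriv => hm; apply: PQ; apply: hh.
by apply: contraNneq hm => ->; rewrite mul0rn.
Qed.
Lemma supp_in_sub P Q h : (forall m, P m -> Q m) -> supp_in P h -> supp_in Q h.
Proof. by move=> PQ hh m /hh /PQ. Qed.

(** Polynomials have finite support, so a coefficient function is realised relative to the support
    of some [h]; this serves truncation and integration alike. *)
Definition coef_fun (h : mpoly n R) (f : multinom n -> R) : mpoly n R :=
  \sum_(m <- msupp h) f m *: mpolyX R m.

Lemma mcoeff_coef_fun h f m : (m \notin msupp h -> f m = 0) ->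
  mcoeff m (coef_fun h f) = f m.
Proof.
move=> f0; rewrite /coef_fun (big_morph _ (mcoeffD m) (mcoeff0 R m)).
have [mh|mh] := boolP (m \in msupp h); last first.
  rewrite big_seq big1 ?f0 // => m' m'h; rewrite mcoeffZ mcoeffX.
  by case: eqP m'h mh => [->|_ _ _]; rewrite ?mulr0 // => ->.
rewrite (bigD1_seq m) ?msupp_uniq //= mcoeffZ mcoeffX eqxx mulr1 big1 ?addr0 //.
by move=> m' /negPf m'm; rewrite mcoeffZ mcoeffX m'm mulr0.
Qed.

Definition restr (b : pred (multinom n)) h : mpoly n R :=
  coef_fun h (fun m => if b m then mcoeff m h else 0).

Lemma mcoeff_restr b h m : mcoeff m (restr b h) = if b m then mcoeff m h else 0.
Proof.
by rewrite mcoeff_coef_fun // -mcoeff_eq0 => /eqP ->; rewrite if_same.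
Qed.
Lemma supp_in_restr P (b : pred (multinom n)) h : supp_in P h -> supp_in (fun m => P m /\ b m) (restr b h).
Proof. by move=> hh m; rewrite mcoeff_restr; case: (b m); rewrite ?eqxx // => /hh. Qed.
Lemma supp_in_restrC P (b : pred (multinom n)) h :
  supp_in P h -> supp_in (fun m => P m /\ ~~ b m) (h - restr b h).
Proof.
move=> hh m; rewrite mcoeffB mcoeff_restr; case: (b m); rewrite ?subrr ?eqxx //.
by rewrite subr0 => /hh.
Qed.

(** The formal antiderivative in the variable [i] without terms free of it; the product with that
    variable only supplies the shifted support. *)
Definition mint (i : 'I_n) h : mpoly n R :=
  coef_fun (h * mpolyX R (mnm1 i)) (fun m => mcoeff (mnm_sub m (mnm1 i)) h *+ (m i != 0%N) / (m i)%:R).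

Lemma mcoeff_mint i h m :
  mcoeff m (mint i h) = mcoeff (mnm_sub m (mnm1 i)) h *+ (m i != 0%N) / (m i)%:R.
Proof.
apply: mcoeff_coef_fun => hm; case: (boolP (m i == 0%N)) => mi; first by rewrite mul0r.
suff -> : mcoeff (mnm_sub m (mnm1 i)) h = 0 by rewrite mul0rn mul0r.
apply/eqP; apply: contraNT hm => h0.
rewrite mcoeff_msupp; move: mi; rewrite -lep1mP => /submK {1}<-.
by rewrite addmC mcoeffMX.
Qed.

Lemma mderiv_mint i h : mderiv i (mint i h) = h.
Proof.
apply/mpolyP => m; rewrite mcoeff_deriv mcoeff_mint addmK mnmDE mnm1E eqxx addn1 /=.
by rewrite -[LHS]mulr_natr divfK // pnatr_eq0.
Qed.

Lemma mderiv_mint_comm i j h : i != j -> mderiv j (mint i h) = mint i (mderiv j h).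
Proof.
move=> ij; apply/mpolyP => m; rewrite mcoeff_deriv !mcoeff_mint mcoeff_deriv.
have -> : mnm_add m (mnm1 j) i = m i by rewrite mnmDE mnm1E eq_sym (negPf ij) addn0.
case: (boolP (m i == 0%N)) => mi; first by rewrite !mulr0n !mul0r mul0rn.
have -> : mnm_sub (mnm_add m (mnm1 j)) (mnm1 i) = mnm_add (mnm_sub m (mnm1 i)) (mnm1 j).
  apply/mnmP => l; rewrite !(mnmBE, mnmDE, mnm1E).
  have [<-|_] := eqVneq i l; last by rewrite !subn0.
  by rewrite eq_sym (negPf ij) !addn0.
have -> : mnm_sub m (mnm1 i) j = m j by rewrite mnmBE mnm1E (negPf ij) subn0.
by rewrite !mulr1n mulrnAl.
Qed.

Lemma supp_in_mint P Q i h : (forall m, P m -> Q (mnm_add m (mnm1 i))) ->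
  supp_in P h -> supp_in Q (mint i h).
Proof.
move=> PQ hh m; rewrite mcoeff_mint; case: (boolP (m i == 0%N)) => mi.
  by rewrite mul0r eqxx.
rewrite mulf_eq0 negb_or => /andP[/hh /PQ + _].
by rewrite submK // lep1mP.
Qed.
End Supports.

Lemma msize_supp_in (R : realType) n k (p : mpoly n R) :
  (msize p <= k.+1)%N <-> supp_in (fun m => (mdeg m <= k)%N) p.
Proof. by split=> [/msizeP|] h; [exact: h|apply/msizeP]. Qed.

Lemma msize_mint (R : realType) n (i : 'I_n) k (p : mpoly n R) :
  (msize p <= k)%N -> (msize (mint i p) <= k.+1)%N.
Proof.
case: k => [|k].
  rewrite leqn0 msize_poly_eq0 => /eqP ->.
  rewrite (_ : mint i 0 = 0) ?msize0 //; apply/mpolyP => m.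
  by rewrite mcoeff_mint !mcoeff0 mul0rn mul0r.
move=> /msize_supp_in h; apply/msize_supp_in; apply: supp_in_mint h => m.
by rewrite mdegD mdeg1 addn1.
Qed.

Lemma scale_mpolyC (R : nzRingType) n (a b : R) : a *: mpolyC n b = mpolyC n (a * b).
Proof. by rewrite -mul_mpolyC mpolyCM. Qed.

(** * Barycentric coordinates and Bernstein coefficients *)

Section Barycentric.
Context {R : realType}.
Variable x : 'I_3 -> plane R.
Hypothesis xfree : forall w : 'I_3 -> R,
  \sum_i w i = 0 -> \sum_i w i *: x i = 0 -> forall i, w i = 0.
Implicit Types (p q : poly2 R) (y nu : plane R) (h g : mpoly 3 R) (i j c : 'I_3).

(** The rows are homogeneous coordinates of the vertices; the columns of the inverse contain the
    coefficients of the barycentric coordinates. *)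
Definition bary_mx : 'M[R]_3 :=
  \matrix_(i, l) if l == 0 then x i 0 0 else if l == 1 then x i 0 1 else 1.

Lemma bary_mx_unit : bary_mx \in unitmx.
Proof.
rewrite -row_free_unit; apply/inj_row_free => w hw.
have sumE l : \sum_i w 0 i * bary_mx i l = 0.
  by have := congr1 (fun A : 'rV[R]_3 => A 0 l) hw; rewrite !mxE.
have w0 i : w 0 i = 0.
  apply: (xfree (w := fun i => w 0 i)).
    have := sumE (lift ord0 (lift ord0 ord0)); rewrite -[RHS]/0 => {2}<-.
    by apply: eq_bigr => j _; rewrite mxE mulr1.
  apply/rowP => -[[|[|//]] lt]; rewrite summxE mxE.
    rewrite -[RHS](sumE 0); apply: eq_bigr => j _; rewrite !mxE /=.
    by congr (_ * x j _ _); apply: val_inj.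
  rewrite -[RHS](sumE 1); apply: eq_bigr => j _; rewrite !mxE /=.
  by congr (_ * x j _ _); apply: val_inj.
by apply/rowP => i; rewrite w0 mxE.
Qed.

Definition bgrad (i : 'I_3) nu : R := invmx bary_mx 0 i * nu 0 0 + invmx bary_mx 1 i * nu 0 1.
Definition bary (i : 'I_3) : poly2 R :=
  invmx bary_mx 0 i *: mpolyX R (mnm1 0) + invmx bary_mx 1 i *: mpolyX R (mnm1 1)
  + mpolyC 2 (invmx bary_mx (lift ord0 (lift ord0 ord0)) i).

Lemma dirD_bary nu i : dirD nu (bary i) = mpolyC 2 (bgrad i nu).
Proof.
by rewrite /bary !dirD_add !dirDZ !dirDX dirDC addr0 -!mul_mpolyC -!mpolyCM -mpolyCD.
Qed.

Lemma sum3 (V : nmodType) (F : 'I_3 -> V) : \sum_i F i = F 0 + F 1 + F (lift ord0 (lift ord0 ord0)).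
Proof.
rewrite !big_ord_recl big_ord0 addr0 addrA; congr (F _ + F _ + F _); exact: val_inj.
Qed.

Lemma bary_vertex i j : eval_at (bary i) (x j) = (i == j)%:R.
Proof.
have := congr1 (fun A : 'M[R]_3 => A j i) (mulmxV bary_mx_unit).
rewrite !mxE eq_sym => <-; rewrite sum3 !mxE /= !evalD !evalZ !evalX evalC.
by rewrite mul1r ![_ * x j _ _]mulrC.
Qed.

Lemma bgrad_edge i j l : bgrad i (x j - x l) = (i == j)%:R - (i == l)%:R.
Proof.
rewrite -!bary_vertex /bary /bgrad !evalD !evalZ !evalX !evalC !mxE; ring.
Qed.

Lemma sum_invmx l l' : \sum_i invmx bary_mx l i * bary_mx i l' = (l == l')%:R.
Proof.
by have := congr1 (fun A : 'M[R]_3 => A l l') (mulVmx bary_mx_unit); rewrite !mxE.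
Qed.

Lemma sum_bary : \sum_i bary i = 1.
Proof.
rewrite /bary !big_split /= -!scaler_suml -rmorph_sum /=.
have e l : \sum_i invmx bary_mx l i = (l == lift ord0 (lift ord0 ord0))%:R.
  by rewrite -sum_invmx; apply: eq_bigr => i _; rewrite mxE mulr1.
by rewrite !e /= !scale0r !add0r mpolyC1.
Qed.

Lemma sum_bary_pos l : \sum_i x i 0 l *: bary i = mpolyX R (mnm1 l).
Proof.
have e l' : \sum_i x i 0 l * invmx bary_mx l' i = (l' == widen_ord (isT : (2 <= 3)%N) l)%:R.
  rewrite -sum_invmx; apply: eq_bigr => i _; rewrite mulrC; congr (_ * _).
  by case: l => -[|[|//]] lt; rewrite mxE /=; congr (x _ _ _); apply: val_inj.
under eq_bigr do rewrite /bary !scalerDr !scalerA scale_mpolyC.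
rewrite !big_split /= -!scaler_suml -rmorph_sum /= !e.
case: l {e} => -[|[|//]] lt /=.
  rewrite scale1r scale0r mpolyC0 !addr0; congr (mpolyX _ (mnm1 _)); exact: val_inj.
rewrite scale1r scale0r mpolyC0 addr0 add0r; congr (mpolyX _ (mnm1 _)); exact: val_inj.
Qed.

Lemma bary_combination y : y = \sum_i eval_at (bary i) y *: x i.
Proof.
apply/rowP => l; rewrite summxE -evalX -sum_bary_pos eval_sum.
by apply: eq_bigr => i _; rewrite evalZ mxE mulrC.
Qed.
Lemma sum_bary_eval y : \sum_i eval_at (bary i) y = 1.
Proof. by rewrite -eval_sum sum_bary -(mpolyC1 2) evalC. Qed.

(* Bernstein-Bezier form: the homogeneous polynomial h evaluated at the
   barycentric coordinates. *)
Definition bernstein h : poly2 R := comp_mpoly [tuple bary i | i < 3] h.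

Lemma bernsteinD h g : bernstein (h + g) = bernstein h + bernstein g.
Proof. exact: comp_mpolyD. Qed.
Lemma bernsteinB h g : bernstein (h - g) = bernstein h - bernstein g.
Proof. exact: comp_mpolyB. Qed.
Lemma bernsteinZ a h : bernstein (a *: h) = a *: bernstein h.
Proof. exact: comp_mpolyZ. Qed.
Lemma bernsteinM h g : bernstein (h * g) = bernstein h * bernstein g.
Proof. exact: rmorphM. Qed.
Lemma bernsteinC a : bernstein (mpolyC 3 a) = mpolyC 2 a.
Proof. exact: comp_mpolyC. Qed.
Lemma bernsteinXU i : bernstein (mpolyX R (mnm1 i)) = bary i.
Proof. by rewrite /bernstein comp_mpolyXU -tnth_nth tnth_mktuple. Qed.
Lemma bernstein_sum (I : Type) (r : seq I) (P : pred I) (F : I -> mpoly 3 R) :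
  bernstein (\sum_(i <- r | P i) F i) = \sum_(i <- r | P i) bernstein (F i).
Proof. exact: raddf_sum. Qed.

Lemma eval_bernstein h y :
  eval_at (bernstein h) y = meval (fun i => eval_at (bary i) y) h.
Proof.
rewrite /eval_at /bernstein comp_mpoly_meval; apply: meval_eq => i.
by rewrite tnth_mktuple.
Qed.

Lemma dirD_bernstein nu h :
  dirD nu (bernstein h) = \sum_i bgrad i nu *: bernstein (mderiv i h).
Proof.
elim/mpoly_alg_ind: h => [a|i|h g IHh IHg|h g IHh IHg].
- rewrite bernsteinC dirDC big1 // => i _.
  by rewrite mderivC -(mpolyC0 3) bernsteinC mpolyC0 scaler0.
- rewrite bernsteinXU dirD_bary (bigD1 i) //= big1 ?addr0 => [|j ji].
    rewrite mderivX mnm1E eqxx scale1r (_ : mnm_sub _ _ = mnm0).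
      by rewrite mpolyX0 -(mpolyC1 3) bernsteinC -mul_mpolyC mpolyC1 mulr1.
    by apply/mnmP => j; rewrite mnmBE subnn mnm0E.
  rewrite mderivX mnm1E eq_sym (negPf ji) scale0r -(mpolyC0 3) bernsteinC mpolyC0.
  by rewrite scaler0.
- rewrite bernsteinD dirD_add IHh IHg -big_split; apply: eq_bigr => i _ /=.
  by rewrite mderivD bernsteinD scalerDr.
- rewrite bernsteinM dirDM IHh IHg mulr_suml mulr_sumr -big_split.
  apply: eq_bigr => i _ /=.
  by rewrite mderivM bernsteinD !bernsteinM scalerDr -scalerAl -scalerAr.
Qed.

Lemma dirD_bernstein_edge i j h :
  dirD (x i - x j) (bernstein h) = bernstein (mderiv i h - mderiv j h).
Proof.
rewrite dirD_bernstein bernsteinB.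
have [->|ij] := eqVneq i j.
  by rewrite [RHS]subrr big1 // => l _; rewrite bgrad_edge subrr scale0r.
rewrite (bigD1 i) //= (bigD1 j) 1?eq_sym //= big1 ?addr0.
  by rewrite !bgrad_edge !eqxx [j == i]eq_sym (negPf ij) subr0 sub0r scale1r scaleN1r.
by move=> l /andP[/negPf li /negPf lj]; rewrite bgrad_edge li lj subrr scale0r.
Qed.

Lemma supp_in_exp n (f : mpoly n R) k d : supp_in (fun m => mdeg m = k) f ->
  supp_in (fun m => mdeg m = (d * k)%N) (f ^+ d).
Proof.
move=> hf; elim: d => [|d IH].
  by rewrite expr0 -(mpolyC1 n); apply: supp_inC; rewrite mdeg0.
by rewrite exprS; apply: supp_inM hf IH _ => m m' <- e; rewrite mdegD e mulSn.
Qed.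

(** Each plane coordinate is replaced by the linear form expressing it in barycentric coordinates,
    and every monomial is padded to degree [k] with powers of the sum of the variables, which
    becomes 1. *)
Lemma bernstein_surj k p : (msize p <= k.+1)%N ->
  exists2 h, homog k h & bernstein h = p.
Proof.
move=> hp; pose L l : mpoly 3 R := \sum_i x i 0 l *: mpolyX R (mnm1 i).
pose S : mpoly 3 R := \sum_i mpolyX R (mnm1 i).
have BL l : bernstein (L l) = mpolyX R (mnm1 l).
  rewrite -sum_bary_pos bernstein_sum; apply: eq_bigr => i _.
  by rewrite bernsteinZ bernsteinXU.
have BS : bernstein S = 1.
  by rewrite -sum_bary bernstein_sum; apply: eq_bigr => i _; rewrite bernsteinXU.
have hL l : homog 1 (L l).
  by apply: supp_in_sum => i; apply: supp_inZ; apply: supp_inX; rewrite mdeg1.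
have hS : homog 1 S by apply: supp_in_sum => i; apply: supp_inX; rewrite mdeg1.
have BX f d : bernstein (f ^+ d) = bernstein f ^+ d by exact: rmorphXn.
(* On the support of [p] the test is always true; it makes every summand homogeneous without
   reference to the support. *)
exists (\sum_(m <- msupp p) (if (mdeg m <= k)%N then mcoeff m p else 0) *:
   (L 0 ^+ m 0 * L 1 ^+ m 1 * S ^+ (k - mdeg m))).
  apply: supp_in_sum => m; case: ifP => hm; last by rewrite scale0r; exact: supp_in0.
  apply: supp_inZ; rewrite /homog.
  apply: (@supp_inM _ _ (fun m' => mdeg m' = mdeg m) (fun m' => mdeg m' = (k - mdeg m)%N)).
  - refine (supp_inM (supp_in_exp (d := m 0) (hL 0)) (supp_in_exp (d := m 1) (hL 1)) _).
    move=> m1 m2; rewrite !muln1 mdegD => -> ->.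
    by rewrite mdegE !big_ord_recl big_ord0 addn0; congr (m _ + m _)%N; apply: val_inj.
  - by have := supp_in_exp (d := (k - mdeg m)%N) hS; rewrite muln1.
  - by move=> m1 m2 h1 h2; rewrite mdegD h1 h2 subnKC.
rewrite [RHS]mpolyE bernstein_sum big_seq [RHS]big_seq; apply: eq_bigr => m hm.
have -> : (mdeg m <= k)%N by move/msize_mdeg_lt: hm => /leq_trans /(_ hp).
rewrite bernsteinZ !bernsteinM !BX !BL BS expr1n mulr1; congr (_ *: _).
rewrite [RHS]mpolyXE_id !big_ord_recl big_ord0 mulr1.
by congr (_ ^+ m _ * mpolyX _ (mnm1 _) ^+ m _); apply: val_inj.
Qed.

Lemma msize_bernstein k h : supp_in (fun m => (mdeg m <= k)%N) h ->
  (msize (bernstein h) <= k.+1)%N.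
Proof.
move=> hh; apply/msize_supp_in; rewrite /bernstein comp_mpolyE big_seq.
apply: (big_ind (supp_in _)) => [||m]; [exact: supp_in0|exact: supp_inD|].
rewrite mcoeff_msupp => /hh hm; apply: supp_inZ.
have hb i : supp_in (fun m => (mdeg m <= 1)%N) (bary i).
  apply: supp_inD; [apply: supp_inD; apply: supp_inZ; apply: supp_inX|apply: supp_inC].
  - by rewrite mdeg1.
  - by rewrite mdeg1.
  - by rewrite mdeg0.
have he i d : supp_in (fun m => (mdeg m <= d)%N) (bary i ^+ d).
  elim: d => [|d IH]; first by rewrite expr0 -(mpolyC1 2); apply: supp_inC; rewrite mdeg0.
  rewrite exprS; apply: supp_inM (hb i) IH _ => m1 m2 h1 h2.
  by rewrite mdegD; exact: (leq_add h1 h2).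
rewrite !big_ord_recl big_ord0 mulr1 !tnth_mktuple.
move: hm; rewrite mdegE !big_ord_recl big_ord0 addn0 => hm.
pose e1 := m (lift ord0 ord0); pose e2 := m (lift ord0 (lift ord0 ord0)).
apply: (@supp_inM _ _ (fun m' => (mdeg m' <= m ord0)%N) (fun m' => (mdeg m' <= e1 + e2)%N)).
- exact: he.
- apply: supp_inM (he _ _) (he _ _) _ => m1 m2 h1 h2.
  by rewrite mdegD; exact: (leq_add h1 h2).
- by move=> m1 m2 h1 h2; rewrite mdegD; apply: leq_trans hm; exact: (leq_add h1 h2).
Qed.

(** For [J] the complement of a vertex this is the distance of a Bernstein coefficient from that
    vertex, for a singleton [J] the distance from the opposite edge. Both cases are thus treated at
    once. *)
Definition wt (J : {set 'I_3}) (m : multinom 3) : nat := \sum_(i in J) m i.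

Lemma wtD J m m' : wt J (mnm_add m m') = (wt J m + wt J m')%N.
Proof. by rewrite /wt -big_split; apply: eq_bigr => i _; rewrite mnmDE. Qed.
Lemma wt1 J i : wt J (mnm1 i) = (i \in J).
Proof.
rewrite /wt; case: (boolP (i \in J)) => iJ.
  rewrite (bigD1 i) //= mnm1E eqxx big1 // => j /andP[_ ji].
  by rewrite mnm1E eq_sym (negPf ji).
by rewrite big1 // => j jJ; rewrite mnm1E; case: eqP jJ iJ => // -> ->.
Qed.
Lemma wt_edge c m : wt [set c] m = m c.
Proof. by rewrite /wt big_set1. Qed.
Lemma wt_vertex i m : (wt [set~ i] m + m i)%N = mdeg m.
Proof.
rewrite mdegE (bigD1 i) //= addnC; congr (_ + _)%N.
by apply: eq_bigl => j; rewrite !inE.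
Qed.

Definition flat (J : {set 'I_3}) y : Prop := forall i, i \in J -> eval_at (bary i) y = 0.

(** A derivative lowers the weight by at most one, and a monomial of positive weight has a factor
    that vanishes on the flat. *)
Lemma supp_in_van J n h y : supp_in (fun m => (n <= wt J m)%N) h -> flat J y ->
  van n y (bernstein h).
Proof.
move=> + hy; elim: n h => // n IH h hh.
have hD nu : van n y (dirD nu (bernstein h)).
  rewrite dirD_bernstein; apply: van_sum => i _; apply: vanZ; apply: IH.
  apply: supp_in_deriv hh => m; rewrite wtD wt1; case: (i \in J); lia.
split; [|by rewrite dirD_d1|by rewrite dirD_d2].
rewrite eval_bernstein mevalE big_seq big1 // => m; rewrite mcoeff_msupp => /hh hm.
have [i iJ mi] : exists2 i, i \in J & m i != 0%N.
  apply/exists_inP; apply: contraTT hm; rewrite negb_exists => /forallP h0.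
  rewrite /wt big1 // => i iJ; apply/eqP; move: (h0 i); rewrite iJ /=.
  by rewrite negbK.
by rewrite (bigD1 i) //= hy // expr0n (negPf mi) mul0r mulr0.
Qed.

Lemma homog_edge_diff k i j h : homog k h -> homog k.-1 (mderiv i h - mderiv j h).
Proof.
move=> hh; apply: supp_inB; apply: supp_in_deriv hh => m; rewrite mdegD mdeg1 => <-;
  by rewrite addn1.
Qed.

(* The coefficient of beta in (d_i - d_j) h relates the coefficients of h at
   beta + e_i and beta + e_j; with i in J and j outside J this lowers the
   J-weight by one. *)
Lemma van_supp_in (J : {set 'I_3}) j0 : j0 \notin J ->
  (forall k h, homog k h -> (forall y, flat J y -> eval_at (bernstein h) y = 0) ->
     forall m, wt J m = 0%N -> mcoeff m h = 0) ->
  forall n k h, homog k h -> (forall y, flat J y -> van n y (bernstein h)) ->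
  supp_in (fun m => (n <= wt J m)%N) h.
Proof.
move=> j0J base; elim=> // n IH k h hk hv.
have step i : i \in J -> supp_in (fun m => (n <= wt J m)%N) (mderiv i h - mderiv j0 h).
  move=> iJ; apply: (IH k.-1); first exact: homog_edge_diff.
  by move=> y hy; rewrite -dirD_bernstein_edge; apply: van_dirD; apply: hv.
suff hs s : (s <= n)%N -> forall m, wt J m = s -> mcoeff m h = 0.
  by move=> m; apply: contraNT; rewrite -ltnNge ltnS => hm; rewrite (hs (wt J m)).
elim: s => [_|s IHs lt_sn] m hm.
  by apply: (base k h hk _ m hm) => y hy; have [] := hv y hy.
have [i iJ mi] : exists2 i, i \in J & m i != 0%N.
  apply/exists_inP; apply: contra_eqT hm; rewrite negb_exists => /forallP h0.
  rewrite /wt big1 // => i iJ; apply/eqP; move: (h0 i); rewrite iJ /=.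
  by rewrite negbK.
have em : mnm_add (mnm_sub m (mnm1 i)) (mnm1 i) = m by rewrite submK // lep1mP.
set b := mnm_sub m (mnm1 i) in em.
have wb : wt J b = s by move: hm; rewrite -em wtD wt1 iJ addn1 => -[].
have : mcoeff b (mderiv i h - mderiv j0 h) = 0.
  apply/eqP; apply: contraTT lt_sn => /(step i iJ) /=; rewrite wb -leqNgt => ?; lia.
rewrite mcoeffB !mcoeff_deriv em (IHs (ltnW lt_sn) (mnm_add b (mnm1 j0))); last first.
  by rewrite wtD wt1 (negPf j0J) addn0.
by rewrite mul0rn subr0 => /eqP; rewrite mulrn_eq0 => /eqP.
Qed.

Lemma flat_vertex i y : flat [set~ i] y <-> y = x i.
Proof.
split=> [h|-> j]; last by rewrite !inE bary_vertex => /negPf ->.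
rewrite (bary_combination y) (bigD1 i) //= big1 ?addr0; last first.
  by move=> j ji; rewrite h ?inE // scale0r.
have := sum_bary_eval y; rewrite (bigD1 i) //= big1 ?addr0; last first.
  by move=> j ji; rewrite h ?inE.
by move=> ->; rewrite scale1r.
Qed.

Lemma flat_edge c y : flat [set c] y <-> eval_at (bary c) y = 0.
Proof. by split=> [|h i]; [apply; rewrite inE|rewrite inE => /eqP ->]. Qed.

(** At a vertex all barycentric coordinates but one vanish, so the value there is the coefficient of
    a pure power. *)
Lemma eval_vertex k h i : homog k h -> eval_at (bernstein h) (x i) = 0 ->
  forall m, wt [set~ i] m = 0%N -> mcoeff m h = 0.
Proof.
move=> hh + m hm; rewrite eval_bernstein mevalE => h0.
apply/eqP; apply: contra_eqT h0 => hm0.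
have mh : m \in msupp h by rewrite mcoeff_msupp.
rewrite (bigD1_seq m) ?msupp_uniq //= [X in _ + X]big1_seq ?addr0.
  rewrite mulf_neq0 //; apply/prodf_neq0 => j _; rewrite bary_vertex.
  have [->|ji] := eqVneq j i; first by rewrite expr1n oner_neq0.
  have := hm; rewrite /wt (bigD1 j) ?inE //= => /eqP; rewrite addn_eq0 => /andP[/eqP -> _].
  by rewrite expr0 oner_neq0.
move=> m' /andP[m'm m'h].
have : wt [set~ i] m' != 0%N.
  apply: contra m'm => /eqP hm'; apply/eqP/mnmP => j.
  have ij' : m' i = m i.
    have := wt_vertex i m; have := wt_vertex i m'; rewrite hm hm' !add0n => -> ->.
    rewrite (hh m') -?mcoeff_msupp //; by rewrite (hh m).
  have [->//|ji] := eqVneq j i.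
  have := hm; have := hm'; rewrite /wt (bigD1 j) ?inE //= => /eqP.
  rewrite addn_eq0 => /andP[/eqP -> _]; rewrite (bigD1 j) ?inE //= => /eqP.
  by rewrite addn_eq0 => /andP[/eqP -> _].
rewrite /wt sum_nat_eq0 negb_forall => /existsP[j]; rewrite negb_imply !inE => /andP[ji mj].
by rewrite (bigD1 j) //= bary_vertex (negPf ji) expr0n (negPf mj) mul0r mulr0.
Qed.

Lemma other_vertices c : exists a b, [/\ a != b, a != c, b != c & forall i, [|| i == a, i == b | i == c]].
Proof.
exists (c + 1), (c + 1 + 1).
by case: c => -[|[|[|//]]] lt; split => //; case=> -[|[|[|//]]].
Qed.

Lemma edge_flat_line a b c y : a != b -> a != c -> b != c ->
  eval_at (bary c) y = 0 <-> exists t, y = on_line (x a) (x b) t.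
Proof.
move=> ab ac bc; have all3 i : i != c -> i != b -> i = a.
  by move: ab ac bc; case: a => -[|[|[|//]]] ?; case: b => -[|[|[|//]]] ? //;
     case: c => -[|[|[|//]]] ? //; case: i => -[|[|[|//]]] ? // *; apply: val_inj.
have sum_ab (V : nmodType) (F : 'I_3 -> V) : \sum_i F i = F c + (F b + F a).
  rewrite (bigD1 c) //= (bigD1 b) //= (bigD1 a) ?ac ?ab //= big1 ?addr0 //.
  by move=> i /andP[/andP[ic ib]]; rewrite (all3 i ic ib) eqxx.
split=> [h|[t ->]]; last first.
  rewrite /on_line /bary !evalD !evalZ !evalX !evalC !mxE.
  have := bary_vertex c a; have := bary_vertex c b.
  rewrite eq_sym (negPf bc) eq_sym (negPf ac) /bary !evalD !evalZ !evalX !evalC.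
  set A := invmx _ _ _; set B := invmx _ _ _; set C := invmx _ _ _ => hb ha.
  rewrite [LHS](_ : _ = (1 - t) * (A * x a 0 0 + B * x a 0 1 + C) +
    t * (A * x b 0 0 + B * x b 0 1 + C)); last by ring.
  by rewrite ha hb !mulr0 addr0.
exists (eval_at (bary b) y); rewrite {1}(bary_combination y) sum_ab h scale0r add0r addrC.
rewrite /on_line; congr (_ *: _ + _).
by have := sum_bary_eval y; rewrite sum_ab h add0r => <-; ring.
Qed.

Lemma van_supp_vertex n k h i : homog k h -> van n (x i) (bernstein h) ->
  supp_in (fun m => (n <= wt [set~ i] m)%N) h.
Proof.
move=> hk hv; apply: (@van_supp_in _ i _ _ n k) => //; first by rewrite !inE eqxx.
  move=> k' h' hk' h0; apply: eval_vertex => //; first exact: hk'.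
  by apply: h0; apply/flat_vertex.
by move=> y /flat_vertex ->.
Qed.

(** The derivative along the edge compares neighbouring coefficients on it; the induction on the
    exponent of [b] starts at the vertex [a]. *)
Lemma eval_edge c k h : homog k h ->
  (forall y, flat [set c] y -> eval_at (bernstein h) y = 0) ->
  forall m, wt [set c] m = 0%N -> mcoeff m h = 0.
Proof.
move=> hk h0 m; rewrite wt_edge => mc.
have [a [b [ab ac bc all3]]] := other_vertices c.
suff hs s : forall k h, homog k h ->
  (forall y, flat [set c] y -> eval_at (bernstein h) y = 0) ->
  forall m : multinom 3, m c = 0%N -> m b = s -> mcoeff m h = 0 by exact: hs hk h0 _ mc erefl.
elim: s {k h m mc hk h0} => [|s IH] k h hk h0 m mc mb.
  apply: (eval_vertex (i := a) hk).
    by apply: h0; apply/flat_edge; rewrite bary_vertex eq_sym (negPf ac).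
  rewrite /wt big1 // => i; rewrite !inE => ia.
  by move: (all3 i); rewrite (negPf ia) /= => /orP[/eqP ->|/eqP ->].
have em : mnm_add (mnm_sub m (mnm1 b)) (mnm1 b) = m by rewrite submK // lep1mP mb.
set e := mnm_sub m (mnm1 b) in em.
have ec : e c = 0%N by rewrite /e mnmBE mc.
have eb : e b = s by rewrite /e mnmBE mb mnm1E eqxx subn1.
have : mcoeff e (mderiv b h - mderiv a h) = 0.
  apply: (IH k.-1) => //; first exact: homog_edge_diff.
  move=> y /flat_edge; rewrite (edge_flat_line y ab ac bc) => -[t ->].
  rewrite -dirD_bernstein_edge; apply: eval_line_eq0 => {}t; apply: h0.
  by apply/flat_edge/(edge_flat_line _ ab ac bc); exists t.
rewrite mcoeffB !mcoeff_deriv em (IH _ _ hk h0 (mnm_add e (mnm1 a))).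
- by rewrite mul0rn subr0 => /eqP; rewrite mulrn_eq0 => /eqP.
- by rewrite mnmDE ec mnm1E (negPf ac).
- by rewrite mnmDE eb mnm1E (negPf ab) addn0.
Qed.

Lemma van_supp_edge n k h c : homog k h ->
  (forall y, eval_at (bary c) y = 0 -> van n y (bernstein h)) ->
  supp_in (fun m => (n <= m c)%N) h.
Proof.
move=> hk hv; apply: (supp_in_sub _ (@van_supp_in [set c] (c + 1) _ _ n k h hk _)).
- by move=> m; rewrite wt_edge.
- by rewrite !inE; case: c {hv} => -[|[|[|//]]] lt.
- move=> k' h' hk'; exact: eval_edge hk'.
- by move=> y /flat_edge; exact: hv.
Qed.

Lemma supp_van_vertex n h i :
  supp_in (fun m => (n <= wt [set~ i] m)%N) h -> van n (x i) (bernstein h).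
Proof. by move=> hh; apply: supp_in_van hh _; apply/flat_vertex. Qed.

Lemma supp_van_edge n h c y :
  supp_in (fun m => (n <= m c)%N) h -> eval_at (bary c) y = 0 -> van n y (bernstein h).
Proof.
move=> hh hy; apply: (@supp_in_van [set c]); last exact/flat_edge.
by apply: supp_in_sub hh => m; rewrite wt_edge.
Qed.
End Barycentric.

(** * The divergence on one triangle *)

Section LocalProblem.
Context {R : realType}.
Variable x : 'I_3 -> plane R.
Hypothesis xfree : forall w : 'I_3 -> R,
  \sum_i w i = 0 -> \sum_i w i *: x i = 0 -> forall i, w i = 0.
Variables (N M k : nat).
Hypotheses (hNM : (2 * N < M)%N) (hMk : (2 * M <= k)%N).
Implicit Types (p q : poly2 R) (y nu : plane R) (h g : mpoly 3 R) (i j c : 'I_3).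
Implicit Types m : multinom 3.

Local Notation bern := (bernstein x).
Local Notation vanE n c p :=
  (forall y, eval_at (bary x c) y = 0 -> van n y p).

Lemma third_vertex i c : i != c ->
  exists j, [/\ j != i, j != c & forall m, mdeg m = (m i + m j + m c)%N].
Proof.
move=> ic; have [a [b [ab ac bc all3]]] := other_vertices c.
have [j [ji jc all3']] : exists j, [/\ j != i, j != c & forall l, [|| l == i, l == j | l == c]].
  case/or3P: (all3 i) => /eqP ei.
  - by exists b; rewrite ei eq_sym; split.
  - exists a; rewrite ei; split => // l; by rewrite orbCA all3.
  - by rewrite ei eqxx in ic.
exists j; split=> // m; rewrite mdegE (bigD1 i) //= (bigD1 j) //= (bigD1 c) /=.
  rewrite big1 ?addn0 ?addnA // => l /andP[/andP[li lj] lc].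
  by move: (all3' l); rewrite (negPf li) (negPf lj) (negPf lc).
by rewrite eq_sym ic eq_sym jc.
Qed.

Lemma wt_vertex_leq d r i m : mdeg m = d ->
  (r <= wt [set~ i] m)%N = (m i + r <= d)%N.
Proof. by move=> <-; rewrite -(wt_vertex i m) addnC leq_add2r. Qed.

(** The Bernstein exponents of polynomials that vanish to order [M] at the two ends of the edge
    opposite to [c]. *)
Definition dom_edge c m :=
  mdeg m = k /\ forall i, i != c -> (m i + M <= k)%N.

(** The rows [m c <= N] determine the derivatives up to order [N] on the edge. In them, m_j <= k - M
    for the other end j gives m_i >= M - N > N, so the rest of the boundary is out of reach by 2N <
    M; the opposite vertex is far because N + M <= 2M <= k. *)
Lemma truncation_supports c h : supp_in (dom_edge c) h ->
  let h' := restr (fun m => (m c <= N)%N) h in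
  [/\ homog k h', forall i, van M (x i) (bern h'),
      forall i, i != c -> supp_in (fun m => (N.+1 <= m i)%N) h' &
      supp_in (fun m => (N.+1 <= m c)%N) (h' - h)].
Proof.
move=> hh h'; have hh' := supp_in_restr (b := fun m => (m c <= N)%N) hh.
have e i : i != c -> supp_in (fun m => (N.+1 <= m i)%N) h'.
  move=> ic; have [j [ji jc degE]] := third_vertex ic.
  apply: supp_in_sub hh' => m [[dm hm] mc].
  by have := hm j jc; have := degE m; rewrite dm; lia.
split=> //.
- by apply: supp_in_sub hh' => m [[]].
- move=> i; apply: (supp_van_vertex xfree); apply: supp_in_sub hh' => m [[dm hm] mc].
  rewrite (wt_vertex_leq _ _ dm); have [->|ic] := eqVneq i c; last exact: hm.
  by lia.
- rewrite -opprB; apply: supp_inN.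
  apply: supp_in_sub (supp_in_restrC (b := fun m => (m c <= N)%N) hh) => m [_].
  by rewrite -ltnNge.
Qed.

(** [p'] carries the data of [p] on one edge into the triangle without disturbing the vertices and
    the other two edges, so that corrections for the three edges can be added. *)
Definition edge_match c p p' : Prop :=
  [/\ (msize p' <= k.+1)%N, forall i, van M (x i) p',
      forall i, i != c -> vanE N.+1 i p' & vanE N.+1 c (p' - p)].

Lemma edge_match_restr c h : supp_in (dom_edge c) h ->
  edge_match c (bern h) (bern (restr (fun m => (m c <= N)%N) h)).
Proof.
move=> /truncation_supports [hk hv he hd]; split => //.
- by apply: msize_bernstein; apply: supp_in_sub hk => m ->.
- by move=> i ic y; apply: supp_van_edge; exact: he.
- by move=> y; rewrite -bernsteinB; apply: supp_van_edge.
Qed.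

Lemma edge_truncation c p : (msize p <= k.+1)%N ->
  (forall i, i != c -> van M (x i) p) -> exists p', edge_match c p p'.
Proof.
move=> hp hv; have [h hk eh] := bernstein_surj xfree hp.
exists (bern (restr (fun m => (m c <= N)%N) h)); rewrite -eh.
apply: edge_match_restr => m hm; have dm := hk m hm; split => // i ic.
rewrite -(wt_vertex_leq _ _ dm).
by apply: (van_supp_vertex xfree hk) hm; rewrite eh; exact: hv.
Qed.

(** The coefficients governing the jets at the three vertices are disjoint because 2M <= k, so the
    three corner pieces are simply added. *)
Lemma vertex_interpolation (P : 'I_3 -> poly2 R) :
  (forall i, (msize (P i) <= k.+1)%N) ->
  exists2 p, (msize p <= k.+1)%N & forall i, van M (x i) (p - P i).
Proof.
move=> hP; have [H hH] : {H : 'I_3 -> mpoly 3 R &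
    forall i, homog k (H i) /\ bern (H i) = P i}.
  apply: (@choice _ _ (fun i h => homog k h /\ bern h = P i)) => i; have [h] := bernstein_surj xfree (hP i).
  by exists h.
(* The weight at the vertex [i] is [k - m i], so this says that it is less than [M]. *)
pose near i m := (k < m i + M)%N.
have hr i := supp_in_restr (b := near i) (hH i).1.
exists (bern (\sum_i restr (near i) (H i))).
  apply: msize_bernstein; apply: supp_in_sum => i.
  by apply: supp_in_sub (hr i) => m [->].
move=> i; rewrite -(hH i).2 -bernsteinB; apply: (supp_van_vertex xfree).
rewrite (bigD1 i) //= addrAC; apply: supp_inD.
  rewrite -opprB; apply: supp_inN; apply: supp_in_sub (supp_in_restrC (b := near i) (hH i).1).
  by move=> m [dm]; rewrite (wt_vertex_leq _ _ dm) -leqNgt.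
rewrite big_mkcond; apply: supp_in_sum => j; case: ifP => [ji|_]; last exact: supp_in0.
apply: supp_in_sub (hr j) => m [dm]; rewrite (wt_vertex_leq _ _ dm) /near.
have [l [_ _]] := third_vertex ji => /(_ m); rewrite dm; lia.
Qed.

(** A truncated Neumann series for d_c - d_a: integrating [g] in the variable [c] leaves as error
    d_a of the integral, whose order along the edge [c] is one higher. Integration raises the weight
    at the ends of the edge by one and d_a lowers it by at most one, so the series keeps [r + 1]. *)
Lemma formal_antiderivative c a d r n s g : a != c -> homog d g ->
  (forall i, i != c -> supp_in (fun m => (r <= wt [set~ i] m)%N) g) ->
  supp_in (fun m => (s <= m c)%N) g ->
  exists h, [/\ homog d.+1 h,
    forall i, i != c -> supp_in (fun m => (r.+1 <= wt [set~ i] m)%N) h &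
    supp_in (fun m => (s + n <= m c)%N) (mderiv c h - mderiv a h - g)].
Proof.
move=> ac; elim: n s g => [|n IH] s g hd hr hs.
  exists 0; split=> [|i _|]; [exact: supp_in0|exact: supp_in0|].
  by rewrite !mderiv0 subrr sub0r addn0; apply: supp_inN.
pose h1 := mint c g.
have hd1 : homog d.+1 h1 by apply: supp_in_mint hd => m; rewrite mdegD mdeg1 addn1 => ->.
have hr1 i : i != c -> supp_in (fun m => (r.+1 <= wt [set~ i] m)%N) h1.
  move=> ic; apply: supp_in_mint (hr i ic) => m.
  by rewrite wtD wt1 !inE eq_sym ic addn1.
have [|||h2 [hd2 hr2 hs2]] := IH s.+1 (mderiv a h1).
- by apply: supp_in_deriv hd1 => m; rewrite mdegD mdeg1 addn1 => -[].
- by move=> i ic; apply: supp_in_deriv (hr1 i ic) => m; rewrite wtD wt1; lia.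
- by rewrite /h1 mderiv_mint_comm 1?eq_sym //; apply: supp_in_mint
    (supp_in_deriv (P := fun m => (s <= m c)%N) (Q := fun m => (s <= m c)%N) _ hs) => m;
    rewrite mnmDE mnm1E ?eqxx ?(negPf ac) ?addn0 ?addn1.
exists (h1 + h2); split.
- exact: supp_inD.
- by move=> i ic; apply: supp_inD; [exact: hr1|exact: hr2].
- rewrite !mderivD mderiv_mint -addSnnS.
  rewrite (_ : _ - _ - g = mderiv c h2 - mderiv a h2 - mderiv a h1) //.
  by ring.
Qed.

(** The direction [nu] leads from an end of the edge to the opposite vertex, hence across the edge;
    the field [p nu] has divergence [dirD nu p]. *)
Lemma edge_antiderivative c q : (msize q <= k)%N ->
  (forall i, i != c -> van M.-1 (x i) q) ->
  exists nu p, [/\ (msize p <= k.+1)%N, forall i, i != c -> van M (x i) p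
    & vanE N c (dirD nu p - q)].
Proof.
have k0 : (0 < k)%N by lia.
move=> hq hv; have [|g hg eg] := @bernstein_surj R x xfree k.-1 q; first by rewrite prednK.
have [a [_ [_ ac _ _]]] := other_vertices c.
have [||h [hd hr hs]] := @formal_antiderivative c a k.-1 M.-1 N 0 g ac hg.
- by move=> i ic; apply: (van_supp_vertex xfree hg); rewrite eg; exact: hv.
- by [].
rewrite prednK // in hd; rewrite prednK in hr; last by lia.
exists (x c - x a), (bern h); split.
- by apply: msize_bernstein; apply: supp_in_sub hd => m ->.
- by move=> i ic; apply: (supp_van_vertex xfree); exact: hr.
- move=> y; rewrite dirD_bernstein_edge // -eg -bernsteinB.
  exact: supp_van_edge.
Qed.

(** The pairing with the gradient of the barycentric coordinate [c], which is normal to the opposite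
    edge. *)
Definition ndot c p q : poly2 R :=
  invmx (bary_mx x) 0 c *: p + invmx (bary_mx x) 1 c *: q.

(** Exactly what makes the extension by zero satisfy all jump conditions. *)
Definition bubble p q : Prop :=
  [/\ (msize p <= k.+1)%N /\ (msize q <= k.+1)%N,
      forall i, van M (x i) p /\ van M (x i) q &
      forall c y, eval_at (bary x c) y = 0 ->
        [/\ eval_at (ndot c p q) y = 0, van N y p, van N y q
          & van N y (d1 p + d2 q)]].

Lemma bubble0 : bubble 0 0.
Proof.
split; first by rewrite msize0.
- by move=> i; split; exact: van0.
- move=> c y _; rewrite /ndot /d1 /d2 !mderiv0 !scaler0 !addr0 eval0.
  by split=> //; exact: van0.
Qed.

Lemma bubbleD p q p' q' : bubble p q -> bubble p' q' -> bubble (p + p') (q + q').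
Proof.
move=> [[h1 h2] h3 h4] [[h1' h2'] h3' h4']; split.
- by split; apply: msizeD.
- by move=> i; have [] := h3 i; have [] := h3' i; split; apply: vanD.
- move=> c y hy; have [a1 a2 a3 a4] := h4 c y hy; have [b1 b2 b3 b4] := h4' c y hy.
  split; [|exact: vanD|exact: vanD|].
    by rewrite /ndot !scalerDr addrACA evalD a1 b1 addr0.
  by rewrite /d1 /d2 !mderivD addrACA; apply: vanD.
Qed.

Lemma bubbleZ a p q : bubble p q -> bubble (a *: p) (a *: q).
Proof.
move=> [[h1 h2] h3 h4]; split.
- by split; apply: msizeZ.
- by move=> i; have [] := h3 i; split; apply: vanZ.
- move=> c y hy; have [a1 a2 a3 a4] := h4 c y hy.
  split; [|exact: vanZ|exact: vanZ|].
    rewrite (_ : ndot _ _ _ = a *: ndot c p q) ?evalZ ?a1 ?mulr0 //.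
    by rewrite /ndot scalerDr !scalerA ![a * _]mulrC.
  by rewrite /d1 /d2 !mderivZ -scalerDr; apply: vanZ.
Qed.

Definition box m : Prop :=
  [/\ mdeg m = k.-1, forall i, (m i + M.-1 <= k.-1)%N & forall i, (N <= m i)%N].

Definition mfact m : R := \prod_i (m i)`!%:R.

Lemma mfact_neq0 m : mfact m != 0.
Proof. by apply/prodf_neq0 => i _; rewrite pnatr_eq0 -lt0n fact_gt0. Qed.

Lemma mfactS i m : mfact (mnm_add m (mnm1 i)) = (m i).+1%:R * mfact m.
Proof.
rewrite /mfact (bigD1 i) //= [in RHS](bigD1 i) //= mnmDE mnm1E eqxx addn1 factS.
rewrite natrM mulrA; congr (_ * _ * _).
by apply: eq_bigr => j ji; rewrite mnmDE mnm1E eq_sym (negPf ji) addn0.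
Qed.

(** Divided powers: their derivatives have coefficient one, so a move between neighbouring exponents
    carries no weight. *)
Definition nmon m : mpoly 3 R := (mfact m)^-1 *: mpolyX R m.

Lemma mderiv_nmon i m : mderiv i (nmon (mnm_add m (mnm1 i))) = nmon m.
Proof.
rewrite /nmon mderivZ mderivX addmK scalerA mnmDE mnm1E eqxx addn1 mfactS.
by rewrite invfM mulrAC mulVf ?mul1r // pnatr_eq0.
Qed.

Definition hit g : Prop := exists p q, bubble p q /\ d1 p + d2 q = bern g.

Lemma hit0 : hit 0.
Proof.
exists 0, 0; split; first exact: bubble0.
by rewrite /d1 /d2 !mderiv0 addr0 -(mpolyC0 3) bernsteinC mpolyC0.
Qed.
Lemma hitD g h : hit g -> hit h -> hit (g + h).
Proof.
move=> [p [q [b e]]] [p' [q' [b' e']]]; exists (p + p'), (q + q').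
by split; [exact: bubbleD|rewrite bernsteinD -e -e' /d1 /d2 !mderivD addrACA].
Qed.
Lemma hitZ a g : hit g -> hit (a *: g).
Proof.
move=> [p [q [b e]]]; exists (a *: p), (a *: q).
by split; [exact: bubbleZ|rewrite bernsteinZ -e /d1 /d2 !mderivZ scalerDr].
Qed.

Lemma div_scaled nu p : d1 (nu 0 0 *: p) + d2 (nu 0 1 *: p) = dirD nu p.
Proof. by rewrite /dirD /d1 /d2 !mderivZ. Qed.

Lemma ndot_scaled c nu p : ndot c (nu 0 0 *: p) (nu 0 1 *: p) = bgrad x c nu *: p.
Proof. by rewrite /ndot /bgrad !scalerA scalerDl. Qed.

(** The field with direction x_i - x_j and the common successor [al] as Bernstein monomial has this
    divergence. It is tangent to the third edge; on the other two the exponent is at least N + 1, so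
    the normal component vanishes even for N = 0. *)
Lemma hit_step i j m m' : i != j -> box m -> box m' ->
  mnm_add m (mnm1 i) = mnm_add m' (mnm1 j) -> hit (nmon m - nmon m').
Proof.
have k0 : (0 < k)%N by lia.
move=> ij [dm wm em] [dm' wm' em'] emm.
pose al := mnm_add m (mnm1 i).
have al_deg : mdeg al = k by rewrite mdegD mdeg1 dm addn1 prednK.
have alE l : al l = (m l + (i == l))%N by rewrite mnmDE mnm1E.
have alE' l : al l = (m' l + (j == l))%N by rewrite /al emm mnmDE mnm1E.
have al_ge c : (N + ((c == i) || (c == j)) <= al c)%N.
  have := em c; have := em' c; have := alE c; have := alE' c.
  have [->|ci] := eqVneq c i; first by rewrite ?eqxx ?[j == i]eq_sym ?(negPf ij) /=; lia.
  by rewrite ?(eq_sym j); case: (c == j) => /=; lia.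
have al_wt l : (M <= wt [set~ l] al)%N.
  rewrite (wt_vertex_leq _ _ al_deg).
  have := wm l; have := wm' l; have := alE l; have := alE' l.
  case: (eqVneq i l) => [<-|il]; last by lia.
  by rewrite eq_sym (negPf ij); lia.
pose p := bern (nmon al).
have sal P : P al -> supp_in P (nmon al) by move=> ?; apply: supp_inZ; exact: supp_inX.
exists ((x i - x j) 0 0 *: p), ((x i - x j) 0 1 *: p); split; last first.
  by rewrite div_scaled dirD_bernstein_edge // /al mderiv_nmon emm mderiv_nmon.
have szp : (msize p <= k.+1)%N by apply: msize_bernstein; apply: sal; rewrite al_deg.
split.
- by split; apply: msizeZ.
- have vp l : van M (x l) p by apply: (supp_van_vertex xfree); exact: sal.
  by move=> l; split; apply: vanZ.
- move=> c y hy.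
  have vp : van N y p by apply: (supp_van_edge _ hy); apply: sal; have := al_ge c; lia.
  split; [|exact: vanZ|exact: vanZ|].
    rewrite ndot_scaled bgrad_edge // evalZ.
    case: (boolP ((c == i) || (c == j))) => hc; last first.
      by move: hc; rewrite negb_or => /andP[/negPf -> /negPf ->]; rewrite subrr mul0r.
    have : van 1 y p; last by case=> ->; rewrite mulr0.
    by apply: (supp_van_edge _ hy); apply: sal; have := al_ge c; rewrite hc; lia.
  rewrite div_scaled dirD_bernstein_edge //; apply: (supp_van_edge _ hy).
  rewrite {1}/al mderiv_nmon /al emm mderiv_nmon; apply: supp_inB;
    by apply: supp_inZ; apply: supp_inX.
Qed.

(* Two multi-indices of the box with the same total degree are joined inside
   the box by moves beta -> beta + e_i - e_j. *)
Lemma hit_connected m m' : box m -> box m' -> hit (nmon m - nmon m').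
Proof.
have [n] := ubnP (\sum_i (m i - m' i))%N.
elim: n m => // n IH m hn bm bm'.
have [[dm wm em] [dm' wm' em']] := (bm, bm').
have [mm'|mm'] := eqVneq m m'; first by rewrite mm' subrr; exact: hit0.
have le_eq (a b : multinom 3) : mdeg a = mdeg b -> (forall i, (a i <= b i)%N) -> a = b.
  move=> dab lab; have : b = mnm_add (mnm_sub b a) a by rewrite submK //; apply/mnm_lepP.
  move=> e; move: dab; rewrite {1}e mdegD => /eqP; rewrite -[X in X == _]add0n eqn_add2r.
  by rewrite eq_sym mdeg_eq0 => /eqP e0; move: e; rewrite e0 add0m => ->.
have [j hj] : exists j, (m' j < m j)%N.
  apply/existsP; apply: contraNT mm'; rewrite negb_exists => /forallP h.
  by apply/eqP/le_eq => [|i]; [rewrite dm|rewrite leqNgt].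
have [i hi] : exists i, (m i < m' i)%N.
  apply/existsP; apply: contraNT mm'; rewrite negb_exists => /forallP h.
  by apply/eqP/esym/le_eq => [|i]; [rewrite dm|rewrite leqNgt].
have ij : i != j by apply: contraTneq hi => ->; rewrite -leqNgt ltnW.
pose b := mnm_sub (mnm_add m (mnm1 i)) (mnm1 j).
have eb : mnm_add b (mnm1 j) = mnm_add m (mnm1 i).
  by rewrite submK // lep1mP mnmDE addn_eq0 negb_and; case: (m j) hj.
have bE l : (b l + (j == l) = m l + (i == l))%N.
  by have := congr1 (fun a : multinom 3 => a l) eb; rewrite !mnmDE !mnm1E.
have bb : box b.
  split.
  - by move: (congr1 (@mdeg 3) eb); rewrite !mdegD !mdeg1 dm => /addIn.
  - move=> l; move: (bE l) (wm l) (wm' l); case: (eqVneq i l) hi => [<-|_] hi.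
      by case: (j == i) => /=; lia.
    by case: (j == l) => /=; lia.
  - move=> l; move: (bE l) (em l) (em' l); case: (eqVneq j l) hj => [<-|_] hj.
      by case: (i == j) => /=; lia.
    by case: (i == l) => /=; lia.
rewrite -(subrKA (nmon b)); apply: hitD; first exact: (@hit_step i j).
rewrite ltnS in hn; apply: IH => //; apply: leq_trans hn.
rewrite (bigD1 j) //= [X in (_ < X)%N](bigD1 j) //= -addSn; apply: leq_add.
  by have := bE j; rewrite eqxx (negPf ij); lia.
apply: leq_sum => l lj; have := bE l; rewrite [j == l]eq_sym (negPf lj).
by case: (eqVneq i l) hi => [<-|_]; lia.
Qed.

(* Up to a factor, the integral over the triangle of a homogeneous polynomial
   of degree k - 1 in the barycentric coordinates. *)
Definition intg g : R := \sum_(m : bmultinom 3 k) mcoeff m g * mfact m.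

Lemma intg0 : intg 0 = 0.
Proof. by rewrite /intg big1 // => m _; rewrite mcoeff0 mul0r. Qed.
Lemma intgD g h : intg (g + h) = intg g + intg h.
Proof. by rewrite /intg -big_split; apply: eq_bigr => m _; rewrite mcoeffD mulrDl. Qed.
Lemma intgZ a g : intg (a *: g) = a * intg g.
Proof. by rewrite /intg mulr_sumr; apply: eq_bigr => m _; rewrite mcoeffZ mulrA. Qed.
Lemma intgX m : (mdeg m < k)%N -> intg (mpolyX R m) = mfact m.
Proof.
move=> hm; rewrite /intg (bigD1 (BMultinom hm)) //= mcoeffX eqxx mul1r big1 ?addr0 //.
move=> m' hm'; rewrite mcoeffX; case: eqP => [e|_]; last by rewrite mul0r.
by rewrite bmeqP /= e eqxx in hm'.
Qed.
Lemma intg_sum (I : Type) (r : seq I) (F : I -> mpoly 3 R) :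
  intg (\sum_(i <- r) F i) = \sum_(i <- r) intg (F i).
Proof. exact: (big_morph intg intgD intg0). Qed.

Lemma intgE g : homog k.-1 g -> intg g = \sum_(m <- msupp g) mcoeff m g * mfact m.
Proof.
have k0 : (0 < k)%N by lia.
move=> hg; rewrite {1}[g]mpolyE intg_sum big_seq [RHS]big_seq; apply: eq_bigr => m.
by rewrite mcoeff_msupp => /hg hm; rewrite intgZ intgX // hm; lia.
Qed.

(** Mean zero allows one fixed member of the box to be subtracted from every divided power in the
    expansion of [g]. *)
Lemma hit_intg0 g : supp_in box g -> intg g = 0 -> hit g.
Proof.
move=> hg; rewrite intgE; last by apply: supp_in_sub hg => m [].
have [g0|] := eqVneq (msupp g) [::].
  by move=> _; rewrite (msuppnil0 g0); exact: hit0.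
case E : (msupp g) => [//|m0 s] _; rewrite -E => h0.
have bm0 : box m0 by apply: hg; rewrite -mcoeff_msupp E inE eqxx.
have -> : g = \sum_(m <- msupp g) (mcoeff m g * mfact m) *: (nmon m - nmon m0).
  under eq_bigr do rewrite scalerBr.
  rewrite sumrB -scaler_suml h0 scale0r subr0 {1}[g]mpolyE; apply: eq_bigr => m _.
  by rewrite scalerA mulfK // mfact_neq0.
rewrite big_seq; apply: big_ind => [||m mg]; [exact: hit0|exact: hitD|].
by apply: hitZ; apply: hit_connected => //; apply: hg; rewrite -mcoeff_msupp.
Qed.

(** The exponent produced by the derivative restores the factorial, so only whether it is zero
    matters. Applied to d_c h - d_a h this is a discrete divergence theorem: only coefficients with
    exactly one of the two exponents zero survive. *)
Lemma intg_deriv i h : homog k h ->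
  intg (mderiv i h) = \sum_(m <- msupp h) mcoeff m h * mfact m * (m i != 0%N)%:R.
Proof.
have k0 : (0 < k)%N by lia.
move=> hh; have -> : mderiv i h = \sum_(m <- msupp h) mcoeff m h *: mderiv i (mpolyX R m).
  rewrite {1}[h]mpolyE (big_morph (mderiv i) (mderivD i) (mderiv0 _ i)).
  by apply: eq_bigr => m _; rewrite mderivZ.
rewrite intg_sum big_seq [RHS]big_seq; apply: eq_bigr => m.
rewrite mcoeff_msupp => /hh hm; rewrite intgZ mderivX intgZ -!mulrA; congr (_ * _).
case: (eqVneq (m i) 0%N) => [->|mi]; first by rewrite mul0r mulr0.
have em : mnm_add (mnm_sub m (mnm1 i)) (mnm1 i) = m by rewrite submK // lep1mP.
rewrite mulr1 intgX; last by move: hm; rewrite -{1}em mdegD mdeg1; lia.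
rewrite -[in RHS]em mfactS; congr (_%:R * _).
by rewrite -{1}em mnmDE mnm1E eqxx addn1.
Qed.

(** What is left of a right-hand side once its jets at the vertices and along the edges have been
    matched. *)
Definition defect q : Prop :=
  [/\ (msize q <= k)%N, forall i, van M.-1 (x i) q & forall c, vanE N c q].

Lemma defect_box q : defect q -> exists2 g, supp_in box g & bern g = q.
Proof.
have k0 : (0 < k)%N by lia.
move=> [hq hv he].
have [|g hg eg] := @bernstein_surj R x xfree k.-1 q; first by rewrite prednK.
exists g => // m hm; have dm := hg m hm; split => // i.
  rewrite -(wt_vertex_leq _ _ dm).
  by apply: (van_supp_vertex xfree hg) hm; rewrite eg.
by apply: (van_supp_edge xfree hg) hm => y; rewrite eg; exact: he.
Qed.

(** [F] is divergence-free on the whole plane, so it can be cut off at the edge in any triangle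
    containing it. The cut-off in this triangle has a divergence of nonzero mean, which removes the
    only obstruction left by [hit_intg0]. *)
Lemma flux_field c : exists F1 F2 f1 f2,
  [/\ [/\ (msize F1 <= k.+1)%N, (msize F2 <= k.+1)%N,
        forall i, i != c -> van M (x i) F1 /\ van M (x i) F2 & d1 F1 + d2 F2 = 0],
      edge_match c F1 f1, edge_match c F2 f2 &
      forall q, defect q -> exists t p1 p2, bubble p1 p2 /\
        d1 p1 + d2 p2 + t *: (d1 f1 + d2 f2) = q].
Proof.
have [a [b [ab ac bc all3]]] := other_vertices c.
have degE m : mdeg m = (m a + m b + m c)%N.
  rewrite mdegE (bigD1 a) //= (bigD1 b) 1?eq_sym //= (bigD1 c) /=.
    rewrite big1 ?addn0 ?addnA // => l /andP[/andP[la lb] lc].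
    by move: (all3 l); rewrite (negPf la) (negPf lb) (negPf lc).
  by rewrite eq_sym ac eq_sym bc.
pose X i : mpoly 3 R := mpolyX R (mnm1 i).
pose n := (k - M)%N.
(* d_c - d_a annihilates [X a + X c], so the field along x_c - x_a has no divergence. The factor of
   degree [M] gives order [M] at the vertex [a] and leaves order k - M >= M at [b]. *)
pose H := X b ^+ M * (X a + X c) ^+ n.
have HX i d : supp_in (fun m => m = mnm_muln (mnm1 i) d) (X i ^+ d).
  by rewrite /X mpolyXn; apply: supp_inX.
have Hac : supp_in (fun m => m b = 0%N /\ mdeg m = n) ((X a + X c) ^+ n).
  elim: (n) => [|e IH].
    by rewrite expr0 -(mpolyC1 3); apply: supp_inC; rewrite mnm0E mdeg0.
  rewrite exprS; apply: (@supp_inM _ _ (fun m => m b = 0%N /\ mdeg m = 1%N)) IH _.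
    by apply: supp_inD; apply: supp_inX; rewrite mnm1E mdeg1 ?[c == b]eq_sym ?(negPf ab) ?(negPf bc).
  by move=> m1 m2 [h1 h2] [h3 h4]; rewrite mnmDE mdegD h1 h2 h3 h4.
have HH : supp_in (fun m => m b = M /\ mdeg m = k) H.
  apply: supp_inM (HX b M) Hac _ => m1 m2 -> [h1 h2].
  rewrite mnmDE mdegD mulmnE mnm1E eqxx mul1n h1 addn0 mdegMn mdeg1 mul1n h2.
  by split=> //; rewrite /n; lia.
have dHc : mderiv c H - mderiv a H = 0.
  have dX i j : i != j -> mderiv i (X j) = 0.
    by move=> ij; rewrite /X mderivX mnm1E eq_sym (negPf ij) scale0r.
  have dX1 i : mderiv i (X i) = 1.
    rewrite /X mderivX mnm1E eqxx scale1r -mpolyX0; congr mpolyX.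
    by apply/mnmP => j; rewrite mnmBE subnn mnm0E.
  have dXb i d : i != b -> mderiv i (X b ^+ d) = 0.
    move=> ib; elim: d => [|d IH]; first by rewrite expr0 -(mpolyC1 3) mderivC.
    by rewrite exprS mderivM IH dX // mul0r mulr0 addr0.
  have dac d : mderiv c ((X a + X c) ^+ d) = mderiv a ((X a + X c) ^+ d).
    elim: d => [|d IH]; first by rewrite expr0 -(mpolyC1 3) !mderivC.
    rewrite exprS !mderivM IH !mderivD !dX1 (dX c a) 1?eq_sym // (dX a c) //.
    by rewrite add0r addr0.
  by rewrite /H !mderivM !dXb ?[c == b]eq_sym // !mul0r !add0r dac subrr.
have domH : supp_in (dom_edge c) H.
  apply: supp_in_sub HH => m [mb dm]; split => // i ic.
  case/or3P: (all3 i) => /eqP ei; rewrite ei; last 1 first.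
  - by rewrite ei eqxx in ic.
  - by move: dm; rewrite degE mb; lia.
  - by rewrite mb; lia.
pose f := restr (fun m => (m c <= N)%N) H.
have [fk fv fe fd] := truncation_supports domH.
have fm := edge_match_restr domH.
pose nu := x c - x a.
have szZ e p : (msize p <= k.+1)%N -> (msize (e *: p) <= k.+1)%N by exact: msizeZ.
have szH : (msize (bern H) <= k.+1)%N.
  by apply: msize_bernstein; apply: supp_in_sub HH => m [_ ->].
have mZ e : edge_match c (e *: bern H) (e *: bern f).
  case: fm => h1 h2 h3 h4; split; first exact: szZ.
  - by move=> i; exact: vanZ.
  - by move=> i ic y hy; apply: vanZ; exact: h3 hy.
  - by move=> y hy; rewrite -scalerBr; apply: vanZ; exact: h4.
exists (nu 0 0 *: bern H), (nu 0 1 *: bern H), (nu 0 0 *: bern f), (nu 0 1 *: bern f).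
split=> //.
  split; [exact: szZ|exact: szZ| |].
    move=> i ic; have : van M (x i) (bern H); last by split; apply: vanZ.
    apply: (supp_van_vertex xfree); apply: supp_in_sub domH => m [dm hm].
    by rewrite (wt_vertex_leq _ _ dm) hm.
  by rewrite div_scaled dirD_bernstein_edge // dHc -(mpolyC0 3) bernsteinC mpolyC0.
rewrite div_scaled dirD_bernstein_edge // -/f.
pose gF := mderiv c f - mderiv a f.
(* Subtracting the divergence-free [H] exhibits the order of vanishing on the edge [c], where
   [f - H] has only exponents above [N]. *)
have gFE : gF = mderiv c (f - H) - mderiv a (f - H).
  move/eqP: dHc; rewrite subr_eq0 => /eqP dH; rewrite /gF !mderivB dH; ring.
have gFbox : supp_in box gF.
  have gk : homog k.-1 gF by exact: homog_edge_diff.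
  have e : dirD nu (bern f) = bern gF by rewrite dirD_bernstein_edge.
  move=> m hm; have dm := gk m hm; split => // i.
    rewrite -(wt_vertex_leq _ _ dm); apply: (van_supp_vertex xfree gk) hm.
    by rewrite -e; apply: van_dirD; rewrite prednK; [exact: fv|lia].
  have dN h j : supp_in (fun m => (N.+1 <= m i)%N) h -> supp_in (fun m => (N <= m i)%N) (mderiv j h).
    by apply: supp_in_deriv => m'; rewrite mnmDE mnm1E; lia.
  have [ei|ic] := eqVneq i c.
    move: m hm {dm}; rewrite -/(supp_in (fun m => (N <= m i)%N) gF) gFE.
    by apply: supp_inB; apply: dN; rewrite ei.
  by move: m hm {dm}; rewrite -/(supp_in (fun m => (N <= m i)%N) gF) /gF;
    apply: supp_inB; apply: dN; exact: fe.
have k0 : (0 < k)%N by lia.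
(* The only exponent of [H] on the edge [c]; the whole mean of the divergence comes from it. *)
pose m0 := mnm_add (mnm_muln (mnm1 b) M) (mnm_muln (mnm1 a) n).
have m0c : m0 c = 0%N by rewrite mnmDE !mulmnE !mnm1E (negPf ac) (negPf bc).
have H0 m : m c = 0%N -> mcoeff m H = (m0 == m)%:R.
  move=> mc; have [Q eQ] : exists Q, (X a + X c) ^+ n = X a ^+ n + X c * Q.
    elim: (n) => [|d [Q IH]]; first by exists 0; rewrite !expr0 mulr0 addr0.
    exists (X a * Q + X a ^+ d + X c * Q); rewrite !exprS IH; ring.
  rewrite /H eQ mulrDr mcoeffD {1}/X /X !mpolyXn -mpolyXD mcoeffX.
  rewrite -[X in _ + mcoeff m X](_ : X c * (mpolyX R (mnm_muln (mnm1 b) M) * Q) = _); last by rewrite mulrCA.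
  suff -> : mcoeff m (X c * (mpolyX R (mnm_muln (mnm1 b) M) * Q)) = 0 by rewrite addr0.
  apply/eqP; apply: contraT => hm.
  have : supp_in (fun m => (0 < m c)%N) (X c * (mpolyX R (mnm_muln (mnm1 b) M) * Q)).
    apply: (@supp_inM _ _ (fun m => m = mnm1 c) (fun=> True)) => //; first exact: supp_inX.
    by move=> m1 m2 -> _; rewrite mnmDE mnm1E eqxx.
  by move=> /(_ m hm); rewrite mc.
have f0 m : m c = 0%N -> mcoeff m f = (m0 == m)%:R.
  by move=> mc; rewrite mcoeff_restr mc /= H0.
have intgF : intg gF = - mfact m0.
  have -> : intg gF = intg (mderiv c f) - intg (mderiv a f).
    by rewrite /gF intgD -scaleN1r intgZ mulN1r.
  rewrite !intg_deriv // -sumrB (bigD1_seq m0) ?msupp_uniq //=; last first.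
    by rewrite mcoeff_msupp f0 // eqxx oner_neq0.
  have fa m : m \in msupp f -> m a != 0%N.
    by rewrite mcoeff_msupp => /(fe a ac) /=; rewrite -lt0n; apply: leq_trans.
  rewrite m0c eqxx mulr0 sub0r fa ?mcoeff_msupp f0 ?eqxx ?oner_neq0 //.
  rewrite mul1r mulr1 big_seq_cond big1 ?addr0 // => m /andP[hm mm0].
  rewrite (fa m hm) mulr1; case: (eqVneq (m c) 0%N) => [mc|_]; last by rewrite mulr1 subrr.
  by move: hm; rewrite mcoeff_msupp f0 // [m0 == m]eq_sym (negPf mm0) eqxx.
move=> q /defect_box [g gbox <-].
pose t := intg g / intg gF.
have [|| p1 [p2 [bp ep]]] := @hit_intg0 (g - t *: gF).
- by apply: supp_inB => //; apply: supp_inZ.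
- rewrite -scaleN1r intgD !intgZ mulN1r /t divfK ?subrr //.
  by rewrite intgF oppr_eq0 mfact_neq0.
exists t, p1, p2; split => //.
by rewrite ep -bernsteinZ -bernsteinD subrK.
Qed.
End LocalProblem.

(** * Geometry of the grid *)

Section GridGeometry.
Context {R : realType} {T : grid R}.
Implicit Types (K L : cell T) (x y z : vertex T) (i j c : 'I_3) (p q : plane R).

Definition vert K i : vertex T := enum_val (cast_ord (esym (card_corners K)) i).
Definition tri K i : plane R := pos (vert K i).

Lemma vert_in K i : vert K i \in corners K.
Proof. exact: enum_valP. Qed.

Lemma vert_inj K : injective (vert K).
Proof. by move=> i j /enum_val_inj /cast_ord_inj. Qed.

Lemma vertP K x : x \in corners K -> exists i, x = vert K i.
Proof.
move=> xK; exists (cast_ord (card_corners K) (enum_rank_in xK x)).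
by rewrite /vert cast_ordK enum_rankK_in.
Qed.

Lemma sum_corners (V : nmodType) K (F : vertex T -> V) :
  \sum_(x in corners K) F x = \sum_i F (vert K i).
Proof.
rewrite big_enum_val (reindex_onto (cast_ord (esym (card_corners K))) (cast_ord (card_corners K))) /=.
  by apply: eq_bigl => i; rewrite cast_ordKV eqxx.
by move=> i _; rewrite cast_ordK.
Qed.

Lemma tri_free K (w : 'I_3 -> R) :
  \sum_i w i = 0 -> \sum_i w i *: tri K i = 0 -> forall i, w i = 0.
Proof.
pose w' x := \sum_(i | vert K i == x) w i.
have w'E i : w' (vert K i) = w i.
  by rewrite /w' (big_pred1 i) // => j; rewrite (inj_eq (@vert_inj K)).
move=> w0 wx0 i; rewrite -w'E; apply: (corners_free (K := K)); last exact: vert_in.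
- by rewrite sum_corners -[RHS]w0; apply: eq_bigr => j _; rewrite w'E.
- by rewrite sum_corners -[RHS]wx0; apply: eq_bigr => j _; rewrite w'E.
Qed.

Local Notation baryK K := (bary (tri K)).

Lemma bary_affine K (w : 'I_3 -> R) i : \sum_j w j = 1 ->
  eval_at (baryK K i) (\sum_j w j *: tri K j) = w i.
Proof.
move=> w1; set q := \sum_j _.
have := @tri_free K (fun j => eval_at (baryK K j) q - w j) _ _ i.
move=> /(_ _ _)/eqP; rewrite subr_eq0 => h; apply/eqP/h.
- by rewrite sumrB (sum_bary_eval (@tri_free K)) w1 subrr.
- under eq_bigr do rewrite scalerBl.
  by rewrite sumrB -(bary_combination (@tri_free K)) subrr.
Qed.

Lemma eval_bary_line K i p q t :
  eval_at (baryK K i) (on_line p q t) =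
  (1 - t) * eval_at (baryK K i) p + t * eval_at (baryK K i) q.
Proof. rewrite /on_line /bary !evalD !evalZ !evalX !evalC !mxE; ring. Qed.

Lemma hullP K q :
  hull (@pos R T) (corners K) q <-> forall i, 0 <= eval_at (baryK K i) q.
Proof.
split=> [[w [w0 w1 ->]] i|h].
  by rewrite sum_corners bary_affine // -sum_corners.
pose w' x := \sum_(i | vert K i == x) eval_at (baryK K i) q.
have w'E i : w' (vert K i) = eval_at (baryK K i) q.
  by rewrite /w' (big_pred1 i) // => j; rewrite (inj_eq (@vert_inj K)).
exists w'; split.
- by move=> x; apply: sumr_ge0.
- rewrite sum_corners -[RHS](sum_bary_eval (@tri_free K) q).
  by apply: eq_bigr => i _; rewrite w'E.
- rewrite sum_corners [LHS](bary_combination (@tri_free K)).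
  by apply: eq_bigr => i _; rewrite w'E.
Qed.

(** A common point is a convex combination of common vertices, and barycentric coordinates are
    unique. *)
Lemma conforming_bary K L q :
  hull (@pos R T) (corners K) q -> hull (@pos R T) (corners L) q ->
  forall i, vert K i \notin corners L -> eval_at (baryK K i) q = 0.
Proof.
move=> qK qL i iL.
have : (hull (@pos R T) (corners K) `&` hull (@pos R T) (corners L)) q by [].
rewrite conforming => -[w [w0 w1 ->]].
pose w' x := if x \in corners L then w x else 0.
have setIE (V : nmodType) (F : vertex T -> V) : \sum_(x in corners K :&: corners L) F x =
    \sum_(x in corners K) (if x \in corners L then F x else 0).
  by rewrite -big_mkcondr; apply: eq_bigl => x; rewrite finset.in_setI.
rewrite setIE.
have e : \sum_(x in corners K) (if x \in corners L then w x *: pos x else 0) =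
         \sum_j w' (vert K j) *: tri K j.
  rewrite sum_corners; apply: eq_bigr => j _; rewrite /w'.
  by case: ifP => _; rewrite ?scale0r.
rewrite e bary_affine; first by rewrite /w' (negPf iL).
rewrite -sum_corners -[RHS]w1 setIE; exact: eq_bigr.
Qed.

Lemma sum_tri_combination K q : q = \sum_i eval_at (baryK K i) q *: tri K i.
Proof. exact: (bary_combination (@tri_free K)). Qed.

(** The edge opposite to the corner [c]; as a set of vertices it can be compared between
    triangles. *)
Definition eface K c : {set vertex T} := corners K :\ vert K c.

Lemma in_eface K c i : (vert K i \in eface K c) = (i != c).
Proof. by rewrite in_setD1 vert_in andbT (inj_eq (@vert_inj K)). Qed.

Lemma efaceP K c x : x \in eface K c -> exists2 i, i != c & x = vert K i.
Proof.
rewrite in_setD1 => /andP[xc /vertP [i ei]]; exists i => //.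
by apply: contraNneq xc => <-; rewrite ei.
Qed.

Lemma eface_corners K c x : x \in eface K c -> x \in corners K.
Proof. by rewrite in_setD1 => /andP[]. Qed.

Lemma eface_inj K : injective (eface K).
Proof.
move=> c c' e; apply/eqP; have := in_eface K c' c; rewrite -e in_eface eqxx.
by move/esym/negbFE.
Qed.

Lemma edge_index K x y : x != y -> x \in corners K -> y \in corners K ->
  exists i j c, [/\ x = vert K i, y = vert K j, i != j, i != c & j != c] /\
   (eface K c = [set x; y]%SET /\
   forall q, eval_at (baryK K c) q = 0 <-> exists t, q = on_line (pos x) (pos y) t).
Proof.
move=> xy /vertP [i ei] /vertP [j ej].
have ij : i != j by apply: contraNneq xy => e; rewrite ei ej e.
have [c [ci cj degE]] := third_vertex ij.
exists i, j, c; split; first by rewrite ei ej ![_ == c]eq_sym.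
split; last first.
  move=> q; rewrite ei ej; apply: (edge_flat_line (@tri_free K)) => //; by rewrite eq_sym.
apply/finset.setP => z; rewrite in_setD1 !inE; apply/idP/idP.
  move=> /andP[zc /vertP [l el]]; rewrite el ei ej !(inj_eq (@vert_inj K)).
  have lc : l != c by apply: contraNneq zc => <-; rewrite el.
  have := degE (mnm1 l); rewrite mdeg1 !mnm1E (negPf lc) addn0.
  by case: (l == i); case: (l == j).
by move=> /orP[/eqP ->|/eqP ->]; rewrite ?ei ?ej vert_in (inj_eq (@vert_inj K)) eq_sym ?ci ?cj.
Qed.

Lemma eface_ends K c : exists x y, [/\ x != y, eface K c = [set x; y]%SET,
  x \in corners K, y \in corners K &
  forall q, eval_at (baryK K c) q = 0 <-> exists t, q = on_line (pos x) (pos y) t].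
Proof.
have [a [b [ab ac bc _]]] := other_vertices c.
have vab : vert K a != vert K b by rewrite (inj_eq (@vert_inj K)).
have [i [j [c' [[ei ej ij ic jc] [e1 e2]]]]] := edge_index vab (vert_in K a) (vert_in K b).
suff ecc : c' = c by exists (vert K a), (vert K b); rewrite -ecc; split => //; exact: vert_in.
apply/eqP/negPn/negP => cc'.
have : vert K c \in [set vert K a; vert K b]%SET by rewrite -e1 in_eface eq_sym.
by rewrite !inE !(inj_eq (@vert_inj K)) ![c == _]eq_sym (negPf ac) (negPf bc).
Qed.

Lemma eface_bary K L c c' q : eface K c = eface L c' ->
  eval_at (baryK K c) q = 0 <-> eval_at (baryK L c') q = 0.
Proof.
move=> e; have [x [y [xy e1 xK yK ->]]] := eface_ends K c.
have xL : x \in corners L.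
  by apply: (@eface_corners _ c'); rewrite -e e1 !inE eqxx.
have yL : y \in corners L.
  by apply: (@eface_corners _ c'); rewrite -e e1 !inE eqxx orbT.
have [i [j [c2 [_ [e2 h]]]]] := edge_index xy xL yL.
have -> : c' = c2 by apply: (@eface_inj L); rewrite -e e1 e2.
by rewrite h.
Qed.

Lemma eface_sub K L c : eface K c \subset corners L -> exists c', eface L c' = eface K c.
Proof.
move=> /fintype.subsetP h; have [x [y [xy e1 xK yK _]]] := eface_ends K c.
have xL : x \in corners L by apply: h; rewrite e1 !inE eqxx.
have yL : y \in corners L by apply: h; rewrite e1 !inE eqxx orbT.
have [i [j [c2 [_ [e2 _]]]]] := edge_index xy xL yL.
by exists c2; rewrite e1 e2.
Qed.

Lemma eface_eq_cell K L c c' : vert K c \in corners L -> eface K c = eface L c' -> K = L.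
Proof.
move=> cL e; apply: corners_inj; apply/eqP; rewrite eqEcard !card_corners leqnn andbT.
apply/fintype.subsetP => x xK; have [->//|xc] := eqVneq x (vert K c).
have : x \in eface K c by rewrite in_setD1 xc.
by rewrite e in_setD1 => /andP[].
Qed.

Lemma tri_det K i j c : i != j -> i != c -> j != c ->
  det2 (tri K j - tri K i) (tri K c - tri K i) != 0.
Proof.
move=> ij ic jc.
have h a b : bgrad (tri K) a (tri K b - tri K i) = (a == b)%:R - (a == i)%:R.
  exact: (bgrad_edge (@tri_free K)).
have e : bgrad (tri K) j (tri K j - tri K i) * bgrad (tri K) c (tri K c - tri K i) -
   bgrad (tri K) j (tri K c - tri K i) * bgrad (tri K) c (tri K j - tri K i) = 1.
  rewrite !h !eqxx ![_ == i]eq_sym (negPf ij) (negPf ic) (negPf jc) eq_sym (negPf jc).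
  by rewrite !subr0 mulr1 mulr0 subr0.
apply/eqP => d0; move/eqP: e; rewrite /bgrad.
set A := invmx _ _ _; set B := invmx _ _ _; set A' := invmx _ _ _; set B' := invmx _ _ _.
have -> : forall a0 a1 b0 b1 : R, (A * a0 + B * a1) * (A' * b0 + B' * b1) -
  (A * b0 + B * b1) * (A' * a0 + B' * a1) = (A * B' - B * A') * (a0 * b1 - a1 * b0).
  by move=> *; ring.
by rewrite -/(det2 _ _) d0 mulr0 eq_sym oner_eq0.
Qed.

(** If both third vertices were on the same side, a point slightly off the midpoint of the edge
    would lie in both triangles but off their common edge, against conformity. *)
Lemma opposite_sides K L c c' : K != L -> eface K c = eface L c' ->
  eval_at (baryK K c) (tri L c') < 0.
Proof.
move=> KL e; rewrite ltNge; apply/negP; rewrite le_eqVlt => /orP[/eqP h0|h0].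
  have := iffLR (eface_bary (tri L c') e) (esym h0).
  by rewrite (bary_vertex (@tri_free L)) eqxx => /eqP; rewrite oner_eq0.
have [x [y [xy e1 xK yK hl]]] := eface_ends K c.
set z := tri L c' in h0; pose m := on_line (pos x) (pos y) (1 / 2).
pose S := \sum_i `|eval_at (baryK K i) z|.
have S0 : 0 <= S by apply: sumr_ge0.
(* Chosen so that (1 - t) / 2 = t S: the coordinates equal to 1/2 at the midpoint remain nonnegative
   after a step [t] towards [z]. *)
pose t := (1 + 2 * S)^-1.
have t0 : 0 < t by rewrite invr_gt0; lra.
have t1 : t * (1 + 2 * S) = 1 by rewrite mulVf // gt_eqF //; lra.
have tle1 : t <= 1 by rewrite invf_le1; lra.
pose q := on_line m z t.
have mc : eval_at (baryK K c) m = 0 by apply/hl; exists (1 / 2).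
have mc' : eval_at (baryK L c') m = 0 by apply/(eface_bary m e).
have half M' i : x \in corners M' -> y \in corners M' -> vert M' i \in eface K c ->
    eval_at (baryK M' i) m = 1 / 2.
  move=> /vertP [a ea] /vertP [b eb]; rewrite e1 !inE ea eb !(inj_eq (@vert_inj M')).
  rewrite /m eval_bary_line ea eb -![pos _]/(tri _ _) !(bary_vertex (@tri_free M')).
  have ab : a != b by apply: contraNneq xy => ab; rewrite ea eb ab.
  move=> /orP[/eqP ->|/eqP ->]; rewrite eqxx ?(negPf ab) ?[b == a]eq_sym ?(negPf ab) /=; lra.
have xL : x \in corners L.
  by apply: (@eface_corners _ c'); rewrite -e e1 !inE eqxx.
have yL : y \in corners L.
  by apply: (@eface_corners _ c'); rewrite -e e1 !inE eqxx orbT.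
have qL : hull (@pos R T) (corners L) q.
  apply/hullP => i; rewrite eval_bary_line (bary_vertex (@tri_free L)).
  have [->|ic] := eqVneq i c'; first by rewrite mc' mulr0 add0r mulr1 ltW.
  by rewrite half // ?e ?in_eface // mulr0n mulr0 addr0 mulr_ge0 //; lra.
have qK : hull (@pos R T) (corners K) q.
  apply/hullP => i; rewrite eval_bary_line -/z.
  have [->|ic] := eqVneq i c; first by rewrite mc mulr0 add0r mulr_ge0 // ltW.
  rewrite half // ?in_eface //.
  have h1 : - S <= eval_at (baryK K i) z.
    have : `|eval_at (baryK K i) z| <= S.
      by rewrite /S (bigD1 i) //= lerDl sumr_ge0.
    by rewrite ler_norml => /andP[].
  have : t * - S <= t * eval_at (baryK K i) z by rewrite ler_pM2l.
  by move: t1; rewrite mulrN mulrDr mulr1 mulrCA; lra.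
have cL : vert K c \notin corners L.
  by apply: contraNN KL => cL; apply/eqP; exact: eface_eq_cell cL e.
have /eqP := conforming_bary qK qL cL.
by rewrite eval_bary_line mc mulr0 add0r mulf_eq0 !gt_eqF.
Qed.

(* The vertex is the one of largest Euclidean norm; the edges issued from it
   then all enter an open half-plane, and one of extremal slope is exposed. *)
Lemma exposed_edge (A : {set cell T}) : A != finset.set0 ->
  exists2 K, K \in A & exists c, forall L, L \in A -> L != K -> ~~ (eface K c \subset corners L).
Proof.
case/finset.set0Pn => K0 K0A.
pose dotp (p q : plane R) := p 0 0 * q 0 0 + p 0 1 * q 0 1.
pose VA := [pred x : vertex T | [exists K in A, x \in corners K]].
have VA0 : VA (vert K0 0) by apply/exists_inP; exists K0 => //; exact: vert_in.
case: (@Order.TotalTheory.arg_maxP _ _ _ (vert K0 0) VA (fun x => dotp (pos x) (pos x)) VA0).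
move=> v /exists_inP [K1 K1A vK1] vmax.
(* Up to a factor the distance from the line through [v] orthogonal to the vector [pos v]; it is
   positive at the other vertices since [v] has the largest norm. [slope] below is the ratio of the
   two orthogonal coordinates of a direction seen from [v]. *)
pose phi (p : plane R) := dotp (pos v) (pos v) - dotp p (pos v).
have phi_gt0 x : VA x -> pos x != pos v -> 0 < phi (pos x).
  move=> /vmax; rewrite /phi /dotp /= => h xv.
  have : 0 < (pos v 0 0 - pos x 0 0) ^+ 2 + (pos v 0 1 - pos x 0 1) ^+ 2.
    rewrite lt_def addr_ge0 ?sqr_ge0 // andbT paddr_eq0 ?sqr_ge0 // !sqrf_eq0.
    apply: contraNN xv => /andP[]; rewrite !subr_eq0 => /eqP e0 /eqP e1.
    apply/eqP/rowP => -[[|[|//]] lt].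
      by move: e0; rewrite (_ : Ordinal lt = 0) //; exact: val_inj.
    by move: e1; rewrite (_ : Ordinal lt = 1) //; exact: val_inj.
  rewrite !sqrrB; nra.
pose slope (p : plane R) := det2 (pos v) p / phi p.
pose E := [pred x : vertex T | (x != v) && [exists K in A, (v \in corners K) && (x \in corners K)]].
have [x0 x0E] : exists x0, E x0.
  have [i ei] := vertP vK1; exists (vert K1 (i + 1)); apply/andP; split.
    rewrite ei (inj_eq (@vert_inj K1)).
    by case: i {ei} => -[|[|[|//]]].
  by apply/exists_inP; exists K1 => //; rewrite vK1 vert_in.
case: (@Order.TotalTheory.arg_maxP _ _ _ x0 E (fun x => slope (pos x)) x0E).
move=> w /andP[wv /exists_inP [K KA /andP[vK wK]]] wmax.
have vw : v != w by rewrite eq_sym.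
have [i [j [c [[ei ej ij ic jc] [ec hline]]]]] := edge_index vw vK wK.
exists K => //; exists c => L LA LK; apply/negP => hsub.
have [c' ec'] := eface_sub hsub.
have := opposite_sides (c := c) (c' := c') _ (esym ec'); rewrite eq_sym => /(_ LK) hneg.
have vL : v \in corners L by apply: (fintype.subsetP hsub); rewrite ec !inE eqxx.
have wL : w \in corners L by apply: (fintype.subsetP hsub); rewrite ec !inE eqxx orbT.
have inE' M' i' : M' \in A -> v \in corners M' -> vert M' i' != v -> E (vert M' i').
  by move=> M'A vM' h; apply/andP; split => //; apply/exists_inP; exists M'; rewrite ?vM' ?vert_in.
have zv : vert K c != v by rewrite ei (inj_eq (@vert_inj K)) eq_sym.
have zv' : vert L c' != v.
  have := in_eface L c' c'; rewrite eqxx ec' ec !inE => /negbT; rewrite negb_or => /andP[].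
  by [].
have Ez := inE' K c KA vK zv.
have Ez' := inE' L c' LA vL zv'.
have posE M' i' : M' \in A -> v \in corners M' -> vert M' i' != v -> 0 < phi (tri M' i').
  move=> M'A vM' h; apply: phi_gt0; first by apply/exists_inP; exists M' => //; exact: vert_in.
  by apply: contra_neq h => /(corners_pos_inj (vert_in M' i') vM').
(* Times the squared norm of [v], the determinant is a difference of slopes times positive factors;
   so no neighbour of [v] lies beyond the edge from [v] to [w]. *)
have side p : 0 < phi p -> slope p <= slope (pos w) ->
    0 <= det2 (pos w - pos v) (p - pos v).
  move=> hp hs.
  have hw : 0 < phi (pos w).
    by have [l el] := vertP wK; rewrite el; apply: posE => //; rewrite -el.
  have : 0 <= det2 (pos w - pos v) (p - pos v) * dotp (pos v) (pos v).
    have -> : det2 (pos w - pos v) (p - pos v) * dotp (pos v) (pos v) =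
       phi (pos w) * phi p * (slope (pos w) - slope p).
      have ew : slope (pos w) * phi (pos w) = det2 (pos v) (pos w).
        by rewrite /slope divfK ?gt_eqF.
      have ep : slope p * phi p = det2 (pos v) p by rewrite /slope divfK ?gt_eqF.
      transitivity (phi p * (slope (pos w) * phi (pos w)) - phi (pos w) * (slope p * phi p)).
        by rewrite ew ep /phi /dotp /det2 !mxE; ring.
      by move: (slope p) (slope (pos w)) (phi p) (phi (pos w)) => *; ring.
    by rewrite mulr_ge0 ?subr_ge0 // mulr_ge0 // ltW.
  have v0 : 0 < dotp (pos v) (pos v).
    rewrite lt_def /dotp -!expr2 addr_ge0 ?sqr_ge0 // andbT paddr_eq0 ?sqr_ge0 // !sqrf_eq0.
    apply/negP => /andP[/eqP v0 /eqP v1]; move: hp.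
    by rewrite /phi /dotp v0 v1 !mulr0 !addr0 subrr ltxx.
  by rewrite pmulr_lge0.
have s1 := side (tri K c) (posE K c KA vK zv) (wmax _ Ez).
have s2 := side (tri L c') (posE L c' LA vL zv') (wmax _ Ez').
have hdet := tri_det K ij ic jc; rewrite /tri -ei -ej -/(tri K c) in hdet.
have e2 : det2 (pos w - pos v) (tri L c' - pos v) =
    eval_at (baryK K c) (tri L c') * det2 (pos w - pos v) (tri K c - pos v).
  have [c2 [c2i c2j degE]] := third_vertex ij.
  have sum_ij (V : nmodType) (F : 'I_3 -> V) : \sum_i F i = F c + (F i + F j).
    rewrite (bigD1 c) //= (bigD1 i) //= (bigD1 j) /=; last by rewrite jc eq_sym.
    rewrite big1 ?addr0 // => l /andP[/andP[lc li] lj].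
    have := degE (mnm1 l); have := degE (mnm1 c); rewrite !mdeg1 !mnm1E.
    rewrite (negPf li) (negPf lj) ![c == _]eq_sym (negPf ic) (negPf jc).
    by case: eqP => // -> _; case: eqP => // e; rewrite e eqxx in lc.
  have := sum_bary_eval (@tri_free K) (tri L c'); rewrite sum_ij => hs.
  have := sum_tri_combination K (tri L c'); rewrite sum_ij.
  set b0 := eval_at _ _ in hs *; set b1 := eval_at _ _ in hs *; set b2 := eval_at _ _ in hs *.
  rewrite /tri -ei -ej => ->.
  have -> : b1 = 1 - b0 - b2 by lra.
  by rewrite /det2 !mxE; ring.
have : 0 < det2 (pos w - pos v) (tri K c - pos v) by rewrite lt_def hdet.
by move=> hpos; move: s2; rewrite e2 pmulr_lge0 // leNgt hneg.
Qed.
End GridGeometry.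

(** * Surjectivity of the divergence *)

Section DivSurjective.
Context {R : realType} {T : grid R}.
Variables (N M k : nat).
Hypotheses (hNM : (2 * N < M)%N) (hMk : (2 * M <= k)%N).
Implicit Types (K L : cell T) (x y z : vertex T) (i j c : 'I_3) (p q : poly2 R).
Implicit Types (u w : pwpoly T) (v : pwvect T).

Local Notation tf K := (@tri_free R T K).
Local Notation van_eface n K c p :=
  (forall s, eval_at (bary (tri K) c) s = 0 -> van n s p).

Definition divp (f : poly2 R * poly2 R) : poly2 R := d1 f.1 + d2 f.2.

Lemma divE v K : div v K = d1 (v.1 K) + d2 (v.2 K).
Proof. by rewrite ffunE. Qed.

Lemma msize_d1 p n : (msize p <= n.+1)%N -> (msize (d1 p) <= n)%N.
Proof. by rewrite dirD_d1 => /msize_dirD; apply. Qed.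
Lemma msize_d2 p n : (msize p <= n.+1)%N -> (msize (d2 p) <= n)%N.
Proof. by rewrite dirD_d2 => /msize_dirD; apply. Qed.

Lemma msize_bigsum (I : Type) (r : seq I) (F : I -> poly2 R) (n : nat) :
  (forall i : I, (msize (F i) <= n)%N) -> (msize (\sum_(i <- r) F i) <= n)%N.
Proof.
move=> hF; apply: (big_ind (fun p : poly2 R => (msize p <= n)%N)) => //.
  by rewrite msize0.
by move=> p q; exact: msizeD.
Qed.

Lemma van_div n s p q : van n.+1 s p -> van n.+1 s q -> van n s (d1 p + d2 q).
Proof. by move=> [_ hp _] [_ _ hq]; exact: vanD. Qed.

Definition jump_ok (a b : plane R) (f : poly2 R * poly2 R) : Prop :=
  forall t, [/\ eval_at ((b - a) 0 1 *: f.1 - (b - a) 0 0 *: f.2) (on_line a b t) = 0,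
    van N (on_line a b t) f.1, van N (on_line a b t) f.2 &
    van N (on_line a b t) (divp f)].

Lemma jump_okD a b f g : jump_ok a b f -> jump_ok a b g ->
  jump_ok a b (f.1 + g.1, f.2 + g.2).
Proof.
move=> hf hg t; have [f1 f2 f3 f4] := hf t; have [g1 g2 g3 g4] := hg t.
split=> /=; [|exact: vanD|exact: vanD|].
  by rewrite !scalerDr opprD addrACA evalD f1 g1 addr0.
by rewrite /divp /= /d1 /d2 !mderivD addrACA; exact: vanD.
Qed.
Lemma jump_okZ a b e f : jump_ok a b f -> jump_ok a b (e *: f.1, e *: f.2).
Proof.
move=> hf t; have [f1 f2 f3 f4] := hf t; split=> /=; [|exact: vanZ|exact: vanZ|].
  by rewrite !scalerA ![_ * e]mulrC -!scalerA -scalerBr evalZ f1 mulr0.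
by rewrite /divp /= /d1 /d2 !mderivZ -scalerDr; exact: vanZ.
Qed.
Lemma jump_ok_van a b f : (forall t, van N.+1 (on_line a b t) f.1) ->
  (forall t, van N.+1 (on_line a b t) f.2) -> jump_ok a b f.
Proof.
move=> h1 h2 t; split; [|exact: vanS|exact: vanS|exact: van_div].
by case: (h1 t) (h2 t) => e1 _ _ [e2 _ _]; rewrite evalB !evalZ e1 e2 !mulr0 subrr.
Qed.

Lemma smooth_div_jump v : smooth_div k N M v <->
  [/\ pw_degree k v.1 /\ pw_degree k v.2,
      forall x K L, x \in corners K -> x \in corners L ->
        van M (pos x) (v.1 K - v.1 L) /\ van M (pos x) (v.2 K - v.2 L) &
      on_edges (fun a b K L => jump_ok a b (v.1 K - v.1 L, v.2 K - v.2 L))].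
Proof.
have divB K L : div v K - div v L = divp (v.1 K - v.1 L, v.2 K - v.2 L).
  by rewrite !divE /divp /d1 /d2 !mderivB opprD addrACA.
split=> -[hd hv he]; split=> // x y K L xy xK yK xL yL t.
  by have := he x y K L xy xK yK xL yL t; rewrite /flux_jump divB.
by have := he x y K L xy xK yK xL yL t; rewrite /flux_jump divB.
Qed.

Definition addv v v' : pwvect T := ([ffun K => v.1 K + v'.1 K], [ffun K => v.2 K + v'.2 K]).

Lemma div_addv v v' K : div (addv v v') K = div v K + div v' K.
Proof. by rewrite !divE !ffunE /d1 /d2 !mderivD addrACA. Qed.

Lemma smooth_div_add v v' : smooth_div k N M v -> smooth_div k N M v' ->
  smooth_div k N M (addv v v').
Proof.
move=> /smooth_div_jump [[h1 h2] h3 h4] /smooth_div_jump [[g1 g2] g3 g4].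
apply/smooth_div_jump; split.
- by split=> K; rewrite ffunE; apply: msizeD.
- move=> x K L xK xL; have [a1 a2] := h3 x K L xK xL; have [b1 b2] := g3 x K L xK xL.
  by split; rewrite !ffunE opprD addrACA; exact: vanD.
- move=> x y K L xy xK yK xL yL.
  have := jump_okD (h4 x y K L xy xK yK xL yL) (g4 x y K L xy xK yK xL yL).
  by rewrite /= !ffunE ![_ - _ + (_ - _)]addrACA -!opprD.
Qed.

(** The admissible corrections: adding one leaves the residual a defect on every triangle. *)
Definition inner v : Prop := smooth_div k N M v /\
  forall K, defect (tri K) N M k (div v K).

Lemma defectD K p q : defect (tri K) N M k p -> defect (tri K) N M k q ->
  defect (tri K) N M k (p + q).
Proof.
move=> [h1 h2 h3] [g1 g2 g3]; split; first exact: msizeD.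
- by move=> i; exact: vanD.
- by move=> c s hs; apply: vanD; [exact: h3 hs|exact: g3 hs].
Qed.
Lemma defectN K p : defect (tri K) N M k p -> defect (tri K) N M k (- p).
Proof.
move=> [h1 h2 h3]; split; first by rewrite msizeN.
- by move=> i; exact: vanN.
- by move=> c s hs; apply: vanN; exact: h3 hs.
Qed.

Lemma inner_add v v' : inner v -> inner v' -> inner (addv v v').
Proof.
move=> [h1 h2] [g1 g2]; split; first exact: smooth_div_add.
by move=> K; rewrite div_addv; exact: defectD.
Qed.

Definition zerov : pwvect T := ([ffun=> 0], [ffun=> 0]).

Lemma defect0 K : defect (tri K) N M k 0.
Proof. by split; [rewrite msize0|move=> i; exact: van0|move=> c s _; exact: van0]. Qed.

Lemma jump_ok0 a b : jump_ok a b (0, 0).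
Proof. by apply: jump_ok_van => t; exact: van0. Qed.

Lemma div_zerov K : div zerov K = 0.
Proof. by rewrite divE !ffunE /d1 /d2 !mderiv0 addr0. Qed.

Lemma inner0 : inner zerov.
Proof.
split; last by move=> K; rewrite div_zerov; exact: defect0.
apply/smooth_div_jump; split.
- by split=> K; rewrite ffunE msize0.
- by move=> x K L _ _; rewrite !ffunE subrr; split; exact: van0.
- by move=> x y K L *; rewrite !ffunE !subrr; exact: jump_ok0.
Qed.

Definition single K (f : poly2 R * poly2 R) : pwvect T :=
  ([ffun L => if L == K then f.1 else 0], [ffun L => if L == K then f.2 else 0]).

Lemma div_single K f L : div (single K f) L = if L == K then divp f else 0.
Proof.
by rewrite divE !ffunE; case: ifP => // _; rewrite /d1 /d2 !mderiv0 addr0.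
Qed.

(** The gradient of a barycentric coordinate is orthogonal to the opposite edge, so the edge vector
    turned by a right angle is a multiple of it, the factor being a determinant. *)
Lemma ndot_jump K x y c p q t : x != y -> x \in corners K -> y \in corners K ->
  eface K c = [set x; y]%SET ->
  eval_at (ndot (tri K) c p q) (on_line (pos x) (pos y) t) = 0 ->
  eval_at ((pos y - pos x) 0 1 *: p - (pos y - pos x) 0 0 *: q)
    (on_line (pos x) (pos y) t) = 0.
Proof.
move=> xy xK yK ec; have [i [j [c' [[ei ej ij ic jc] [ec' _]]]]] := edge_index xy xK yK.
have {ec'} ecc : c = c' by apply: (@eface_inj _ _ K); rewrite ec ec'.
rewrite -{c'}ecc in ic jc; set s := on_line _ _ _.
have h1 := bgrad_edge (tf K) c j i; have h2 := bgrad_edge (tf K) c c i.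
rewrite ![c == _]eq_sym (negPf ic) (negPf jc) subrr in h1.
rewrite eqxx [c == i]eq_sym (negPf ic) subr0 in h2.
rewrite /tri -ei -ej in h1; rewrite /tri -ei -/(tri K c) in h2.
rewrite /ndot evalD evalB !evalZ => h0.
set A := invmx _ _ _ in h0 h1 h2; set B := invmx _ _ _ in h0 h1 h2.
move: h1 h2; rewrite /bgrad -/A -/B.
set dx := pos y - pos x; set e := _ - _ => h1 h2.
have e1 : dx 0 1 = det2 e dx * A.
  rewrite -[LHS]mul1r -[X in X * _ = _]h2 /det2; apply/eqP; rewrite -subr_eq0.
  rewrite (_ : _ - _ = (A * dx 0 0 + B * dx 0 1) * e 0 1); last by ring.
  by rewrite h1 mul0r.
have e2 : dx 0 0 = - (det2 e dx * B).
  rewrite -[LHS]mul1r -[X in X * _ = _]h2 /det2; apply/eqP; rewrite -subr_eq0.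
  rewrite (_ : _ - _ = (A * dx 0 0 + B * dx 0 1) * e 0 0); last by ring.
  by rewrite h1 mul0r.
rewrite e1 e2 mulNr opprK -!mulrA -mulrDr h0; exact: mulr0.
Qed.

Lemma inner_bubble K p q : bubble (tri K) N M k p q -> inner (single K (p, q)).
Proof.
move=> [[hp hq] hv he]; split; last first.
  move=> L; rewrite div_single; case: eqP => [->|_]; last exact: defect0.
  split; last by move=> c s hs; have [] := he c s hs.
  - by rewrite /divp /=; apply: msizeD; [apply: msize_d1|apply: msize_d2].
  - by move=> i; have [] := hv i; move: hNM; case: (M) => //= m _; exact: van_div.
apply/smooth_div_jump; split.
- by split=> L; rewrite ffunE; case: ifP => //= _; rewrite msize0.
- have vK x L : x \in corners L -> van M (pos x) (if L == K then p else 0) /\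
      van M (pos x) (if L == K then q else 0).
    case: eqP => [-> /vertP [i ->]|_ _]; first exact: hv.
    by split; exact: van0.
  move=> x L L' xL xL'; rewrite !ffunE /=.
  by have [? ?] := vK x L xL; have [? ?] := vK x L' xL'; split; exact: vanB.
- have vK x y L : x != y -> x \in corners L -> y \in corners L ->
      jump_ok (pos x) (pos y) (if L == K then p else 0, if L == K then q else 0).
    move=> xy; case: eqP => [-> xK yK|_ _ _]; last exact: jump_ok0.
    have [i [j [c [_ [ec hl]]]]] := edge_index xy xK yK => t.
    have [|e1 e2 e3 e4] := he c (on_line (pos x) (pos y) t); first by apply/hl; exists t.
    by split=> //=; exact: (ndot_jump xy xK yK ec).
  move=> x y L L' xy xL yL xL' yL'; rewrite !ffunE /=.
  have := jump_okD (vK x y L xy xL yL) (jump_okZ (-1) (vK x y L' xy xL' yL')).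
  by rewrite /= !scaleN1r.
Qed.

Lemma edge_match_jump K c F f : edge_match (tri K) N M k c F f ->
  van_eface N.+1 K c (f - F).
Proof. by case. Qed.

Definition flux_cell K0 c0 (F1 F2 : poly2 R) L (g : poly2 R * poly2 R) : Prop :=
  (exists c, [/\ eface L c = eface K0 c0, edge_match (tri L) N M k c F1 g.1
     & edge_match (tri L) N M k c F2 g.2]) \/
  (~~ (eface K0 c0 \subset corners L) /\ g = (0, 0)).

(** On the chosen edge all pieces agree to order [N + 1] with the same divergence-free field, on
    every other edge they vanish to that order. *)
Lemma inner_flux K0 c0 F1 F2 (G : cell T -> poly2 R * poly2 R) : d1 F1 + d2 F2 = 0 ->
  (forall L, flux_cell K0 c0 F1 F2 L (G L)) ->
  inner ([ffun L => (G L).1], [ffun L => (G L).2]).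
Proof.
move=> dF hG.
have M0 : (0 < M)%N by lia.
have gV L x : x \in corners L -> van M (pos x) (G L).1 /\ van M (pos x) (G L).2.
  move=> /vertP [i ->]; have [[c [_ [_ h1 _ _] [_ h2 _ _]]]|[_ ->]] := hG L.
    by split; [exact: h1|exact: h2].
  by split; exact: van0.
have gD L : (msize (G L).1 <= k.+1)%N /\ (msize (G L).2 <= k.+1)%N.
  have [[c [_ [h1 _ _ _] [h2 _ _ _]]]|[_ ->]] := hG L => //.
  by rewrite msize0.
split; last first.
  move=> L; rewrite divE !ffunE; have [? ?] := gD L; split.
  - by apply: msizeD; [apply: msize_d1|apply: msize_d2].
  - move=> i; have [] := gV L (vert L i) (vert_in L i).
    by move: M0; case: (M) => //= m _; exact: van_div.
  - move=> c s hs; have [[c' [_ [_ _ h1 h1'] [_ _ h2 h2']]]|[_ ->]] := hG L; last first.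
      by rewrite /d1 /d2 !mderiv0 addr0; exact: van0.
    have [ecc|cc'] := eqVneq c c'; last by apply: van_div; [exact: (h1 c)|exact: (h2 c)].
    rewrite ecc in hs; have := van_div (h1' s hs) (h2' s hs).
    by rewrite /d1 /d2 !mderivB addrACA -opprD -/(d1 _) -/(d2 _) dF subr0.
apply/smooth_div_jump; split.
- by split=> L; rewrite ffunE; have [] := gD L.
- move=> x L L' xL xL'; rewrite !ffunE.
  by have [? ?] := gV L x xL; have [? ?] := gV L' x xL'; split; exact: vanB.
- move=> x y L L' xy xL yL xL' yL'; rewrite !ffunE.
  have [exy|exy] := eqVneq ([set x; y]%SET) (eface K0 c0).
    have gF L1 : x \in corners L1 -> y \in corners L1 -> forall t,
        van N.+1 (on_line (pos x) (pos y) t) ((G L1).1 - F1) /\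
        van N.+1 (on_line (pos x) (pos y) t) ((G L1).2 - F2).
      move=> xL1 yL1 t; have [[c [ec h1 h2]]|[/negP h _]] := hG L1; last first.
        by case: h; rewrite -exy; apply/fintype.subsetP => z; rewrite !inE => /orP[] /eqP ->.
      have [i [j [c' [_ [ec' hl]]]]] := edge_index xy xL1 yL1.
      have ecc : c = c' by apply: (@eface_inj _ _ L1); rewrite ec ec'.
      have hs : eval_at (bary (tri L1) c) (on_line (pos x) (pos y) t) = 0.
        by rewrite ecc; apply/hl; exists t.
      by split; [exact: (edge_match_jump h1)|exact: (edge_match_jump h2)].
    apply: jump_ok_van => t /=; have [a1 a2] := gF L xL yL t; have [b1 b2] := gF L' xL' yL' t.
      by apply: van_trans a1 (van_sym b1).
    by apply: van_trans a2 (van_sym b2).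
  have gF L1 : x \in corners L1 -> y \in corners L1 -> forall t,
      van N.+1 (on_line (pos x) (pos y) t) (G L1).1 /\
      van N.+1 (on_line (pos x) (pos y) t) (G L1).2.
    move=> xL1 yL1 t; have [[c [ec [_ _ h1 _] [_ _ h2 _]]]|[_ ->]] := hG L1; last first.
      by split; exact: van0.
    have [i [j [c' [_ [ec' hl]]]]] := edge_index xy xL1 yL1.
    have ecc : c' != c by apply: contraNneq exy => e; rewrite -ec' e ec.
    have hs : eval_at (bary (tri L1) c') (on_line (pos x) (pos y) t) = 0.
      by apply/hl; exists t.
    by split; [exact: (h1 c')|exact: (h2 c')].
  apply: jump_ok_van => t; have [? ?] := gF L xL yL t; have [? ?] := gF L' xL' yL' t;
    exact: vanB.
Qed.

(** The equation is claimed only on [A]. The flux that repairs the mean on [K] crosses an edge that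
    no other member of [A] contains, so it disturbs only triangles outside [A] or leaves the domain,
    where no boundary condition stops it. *)
Lemma defect_peel (n : nat) (A : {set cell T}) (q : cell T -> poly2 R) :
  (#|A| <= n)%N -> (forall K, defect (tri K) N M k (q K)) ->
  exists2 v, inner v & forall K, K \in A -> div v K = q K.
Proof.
elim: n A => [|n IH] A hA hq.
  exists zerov; first exact: inner0.
  by move=> K KA; move: hA; rewrite leqn0 cards_eq0 => /eqP A0; rewrite A0 inE in KA.
have [A0|A0] := eqVneq A finset.set0.
  by exists zerov; [exact: inner0|move=> K; rewrite A0 inE].
have [K KA [c hc]] := exposed_edge A0.
have [|v iv hv] := IH (A :\ K) _ hq; first by move: hA; rewrite (cardsD1 K A) KA.
have [F1 [F2 [f1 [f2 [[hF1 hF2 hFv dF] m1 m2 hfin]]]]] := flux_field (tf K) hNM hMk c.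
have [|t [p1 [p2 [bp ep]]]] := hfin (q K - div v K).
  by apply: defectD => //; apply: defectN; exact: iv.2.
(* Cut-offs are chosen in all triangles that contain the edge; on [K] it has to be the pair whose
   mean is known to be nonzero. *)
have [G hG] : {G : cell T -> poly2 R * poly2 R & forall L,
    flux_cell K c F1 F2 L (G L) /\ (L = K -> G L = (f1, f2))}.
  apply: (@choice _ _ (fun L g => flux_cell K c F1 F2 L g /\ (L = K -> g = (f1, f2)))) => L.
  have [->|LK] := eqVneq L K.
    by exists (f1, f2); split => //; left; exists c.
  case: (boolP (eface K c \subset corners L)) => hsub; last first.
    by exists (0, 0); split; [right|move=> e; rewrite e eqxx in LK].
  have [c' ec'] := eface_sub hsub.
  have hin i : i != c' -> exists2 j, j != c & vert L i = vert K j.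
    by move=> ic'; apply: efaceP; rewrite -ec' in_eface.
  have [|g1 hg1] := edge_truncation (tf L) hNM hMk (c := c') hF1.
    by move=> i /hin [j jc e]; rewrite /tri e; have [] := hFv j jc.
  have [|g2 hg2] := edge_truncation (tf L) hNM hMk (c := c') hF2.
    by move=> i /hin [j jc e]; rewrite /tri e; have [] := hFv j jc.
  by exists (g1, g2); split; [left; exists c'|move=> e; rewrite e eqxx in LK].
have hGt L : flux_cell K c (t *: F1) (t *: F2) L (t *: (G L).1, t *: (G L).2).
  have mZ e p p' : edge_match (tri L) N M k e p p' -> edge_match (tri L) N M k e (t *: p) (t *: p').
    case=> h1 h2 h3 h4; split; first exact: msizeZ.
    - by move=> i; exact: vanZ.
    - by move=> i ie s hs; apply: vanZ; exact: h3 hs.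
    - by move=> s hs; rewrite -scalerBr; apply: vanZ; exact: h4.
  have [[[c' [ec' h1 h2]]|[h ->]] _] := hG L.
    by left; exists c'; split=> //; exact: mZ.
  by right; rewrite !scaler0.
have dFt : d1 (t *: F1) + d2 (t *: F2) = 0.
  by rewrite /d1 /d2 !mderivZ -scalerDr -/(d1 _) -/(d2 _) dF scaler0.
have iG := inner_flux dFt hGt; have ib := inner_bubble bp.
exists (addv v (addv ([ffun L => t *: (G L).1], [ffun L => t *: (G L).2]) (single K (p1, p2)))).
  apply: inner_add => //; apply: inner_add => //.
move=> L LA; rewrite !div_addv div_single.
have -> : div ([ffun L => t *: (G L).1], [ffun L => t *: (G L).2]) L = t *: divp (G L).
  by rewrite divE !ffunE /divp /d1 /d2 !mderivZ scalerDr.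
have [LK|LK] := eqVneq L K.
  have [_ ->] := hG L; last by []; rewrite LK [t *: _ + _]addrC /divp /= ep.
  by rewrite addrC subrK.
have [[[c' [ec' _ _]]|[_ ->]] _] := hG L.
  have /negP [] := hc L LA LK; apply/fintype.subsetP => z; rewrite -ec'; exact: eface_corners.
have -> : divp (0, 0) = 0 by rewrite /divp /= /d1 /d2 !mderiv0 addr0.
rewrite scaler0 !addr0; apply: hv.
by rewrite in_setD1 LK.
Qed.

Lemma div_approx w : smooth k.-1 N M.-1 w -> exists2 v, smooth_div k N M v &
  forall K, defect (tri K) N M k (w K - div v K).
Proof.
move=> [hd hv he].
have k0 : (0 < k)%N by lia.
have M0 : (0 < M)%N by lia.
have wk K : (msize (w K) <= k)%N by have := hd K; rewrite prednK.
(* The field [(Z x, 0)] has the jet of [w] at [x] as divergence, for every triangle at [x] whichever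
   one is picked, because these jets agree. *)
pose Z x := if [pick K | x \in corners K] is Some K then mint 0 (w K) else 0.
have Zsz x : (msize (Z x) <= k.+1)%N.
  by rewrite /Z; case: pickP => [K _|_]; [exact: msize_mint|rewrite msize0].
have Zw x K : x \in corners K -> van M.-1 (pos x) (w K - d1 (Z x)).
  rewrite /Z; case: pickP => [L xL|h] xK; last by rewrite h in xK.
  by rewrite /d1 mderiv_mint; exact: hv.
have [v0 hv0] : {v0 : cell T -> poly2 R * poly2 R & forall K,
   [/\ (msize (v0 K).1 <= k.+1)%N, (msize (v0 K).2 <= k.+1)%N,
     forall i, van M (tri K i) ((v0 K).1 - Z (vert K i)) & forall i, van M (tri K i) (v0 K).2]}.
  apply: (@choice _ _ (fun K (f : poly2 R * poly2 R) =>
   [/\ (msize f.1 <= k.+1)%N, (msize f.2 <= k.+1)%N,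
     forall i, van M (tri K i) (f.1 - Z (vert K i)) & forall i, van M (tri K i) f.2])) => K.
  have [p hp hpv] := vertex_interpolation (tf K) hNM hMk (P := fun i => Z (vert K i)) (fun i => Zsz _).
  by exists (p, 0); split => //= [|i]; [rewrite msize0|exact: van0].
(* Indexing by the vertex set of the edge gives one common polynomial field to all triangles that
   contain it. *)
pose edge_field (S : {set vertex T}) (D : poly2 R * poly2 R) :=
  [/\ (msize D.1 <= k.+1)%N, (msize D.2 <= k.+1)%N,
    forall x, x \in S -> van M (pos x) (D.1 - Z x) /\ van M (pos x) D.2 &
    forall L c, eface L c = S -> van_eface N L c (w L - divp D)].
have [D hD] : {D : {set vertex T} -> poly2 R * poly2 R &
    forall S, (exists K c, eface K c = S) -> edge_field S (D S)}.
  apply: (@choice _ _ (fun S D => (exists K c, eface K c = S) -> edge_field S D)) => S.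
  case: (pselect (exists K c, eface K c = S)) => [[K [c eS]]|h]; last by exists (0, 0).
  have [h1 h2 h3 h4] := hv0 K.
  have [||nu [p [hp pv pe]]] := edge_antiderivative (tf K) hNM hMk (c := c) (q := w K - divp (v0 K)).
  - by apply: msizeB => //; apply: msizeD; [apply: msize_d1|apply: msize_d2].
  - move=> i ic; apply: (van_trans (q := d1 (Z (vert K i)))); first exact/Zw/vert_in.
    rewrite /divp opprD addrA; apply: vanB.
      apply: van_sym; rewrite /d1 -mderivB -/(d1 _) dirD_d1; apply: van_dirD.
      by rewrite prednK.
    by rewrite dirD_d2; apply: van_dirD; rewrite prednK.
  exists ((v0 K).1 + nu 0 0 *: p, (v0 K).2 + nu 0 1 *: p) => _; split=> /=.
  - by apply: msizeD => //; exact: msizeZ.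
  - by apply: msizeD => //; exact: msizeZ.
  - move=> x; rewrite -eS => /efaceP [i ic ->]; split.
      by rewrite addrAC; apply: vanD; [exact: h3|apply: vanZ; exact: pv].
    by apply: vanD; [exact: h4|apply: vanZ; exact: pv].
  - move=> L c' ec' s hs.
    have hs' : eval_at (bary (tri K) c) s = 0 by apply/(eface_bary s (L := L) (c' := c')); rewrite ?ec'.
    have e : divp ((v0 K).1 + nu 0 0 *: p, (v0 K).2 + nu 0 1 *: p) = divp (v0 K) + dirD nu p.
      by rewrite /divp /= /d1 /d2 !mderivD addrACA -!/(d1 _) -!/(d2 _) div_scaled.
    apply: (van_trans (q := w K)).
      have [x [y [xy exy xL yL hl]]] := eface_ends L c'.
      have [t ->] := iffLR (hl s) hs; apply: he => //.
        by apply: (@eface_corners _ _ _ c); rewrite eS -ec' exy !inE eqxx.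
      by apply: (@eface_corners _ _ _ c); rewrite eS -ec' exy !inE eqxx orbT.
    by rewrite e opprD addrA; apply: van_sym; exact: pe.
have hDe K c := hD (eface K c) (ex_intro _ K (ex_intro _ c erefl)).
(* The difference between the common field of the edge and the local interpolant, carried into the
   triangle. *)
have [g hg] : {g : cell T * 'I_3 -> poly2 R * poly2 R & forall Kc,
    edge_match (tri Kc.1) N M k Kc.2 ((D (eface Kc.1 Kc.2)).1 - (v0 Kc.1).1) (g Kc).1 /\
    edge_match (tri Kc.1) N M k Kc.2 ((D (eface Kc.1 Kc.2)).2 - (v0 Kc.1).2) (g Kc).2}.
  apply: (@choice _ _ (fun Kc (g : poly2 R * poly2 R) =>
    edge_match (tri Kc.1) N M k Kc.2 ((D (eface Kc.1 Kc.2)).1 - (v0 Kc.1).1) g.1 /\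
    edge_match (tri Kc.1) N M k Kc.2 ((D (eface Kc.1 Kc.2)).2 - (v0 Kc.1).2) g.2)).
  move=> [K c] /=; have [h1 h2 h3 h4] := hv0 K; have [e1 e2 e3 e4] := hDe K c.
  have [||g1 hg1] := edge_truncation (tf K) hNM hMk (c := c) (p := (D (eface K c)).1 - (v0 K).1).
  - exact: msizeB.
  - move=> i ic; have [|a1 _] := e3 (vert K i); first by rewrite in_eface.
    by apply: van_trans a1 (van_sym (h3 i)).
  have [||g2 hg2] := edge_truncation (tf K) hNM hMk (c := c) (p := (D (eface K c)).2 - (v0 K).2).
  - exact: msizeB.
  - move=> i ic; have [|_ a2] := e3 (vert K i); first by rewrite in_eface.
    exact: vanB.
  by exists (g1, g2).
pose v : pwvect T := ([ffun K => (v0 K).1 + \sum_c (g (K, c)).1],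
                      [ffun K => (v0 K).2 + \sum_c (g (K, c)).2]).
have vD K : (msize (v.1 K) <= k.+1)%N /\ (msize (v.2 K) <= k.+1)%N.
  have [h1 h2 _ _] := hv0 K; rewrite !ffunE; split; apply: msizeD => //.
    by apply: msize_bigsum => c; have [[]] := hg (K, c).
  by apply: msize_bigsum => c; have [_ []] := hg (K, c).
have vV K x : x \in corners K -> van M (pos x) (v.1 K - Z x) /\ van M (pos x) (v.2 K).
  move=> /vertP [i ->]; have [_ _ h3 h4] := hv0 K; rewrite !ffunE; split.
    rewrite addrAC; apply: vanD; first exact: h3.
    by apply: van_sum => c _; have [[_ + _ _] _] := hg (K, c); exact.
  apply: vanD; first exact: h4.
  by apply: van_sum => c _; have [_ [_ + _ _]] := hg (K, c); exact.
(* Of the three edge corrections only the one belonging to [c] is felt on that edge, where it turns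
   [v0] into the common field. *)
have vE K c : van_eface N.+1 K c (v.1 K - (D (eface K c)).1) /\
              van_eface N.+1 K c (v.2 K - (D (eface K c)).2).
  have e1 : \sum_c' (g (K, c')).1 = (g (K, c)).1 + \sum_(c' | c' != c) (g (K, c')).1.
    by rewrite (bigD1 c).
  have e2 : \sum_c' (g (K, c')).2 = (g (K, c)).2 + \sum_(c' | c' != c) (g (K, c')).2.
    by rewrite (bigD1 c).
  rewrite !ffunE e1 e2; split=> s hs.
    rewrite [X in van _ _ X](_ : _ = (g (K, c)).1 - ((D (eface K c)).1 - (v0 K).1) +
      \sum_(c' | c' != c) (g (K, c')).1); last by ring.
    apply: vanD; first by have [[_ _ _ +] _] := hg (K, c); apply.
    apply: van_sum => c' cc'; have [[_ _ + _] _] := hg (K, c').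
    by apply; [rewrite eq_sym|exact: hs].
  rewrite [X in van _ _ X](_ : _ = (g (K, c)).2 - ((D (eface K c)).2 - (v0 K).2) +
    \sum_(c' | c' != c) (g (K, c')).2); last by ring.
  apply: vanD; first by have [_ [_ _ _ +]] := hg (K, c); apply.
  apply: van_sum => c' cc'; have [_ [_ _ + _]] := hg (K, c').
  by apply; [rewrite eq_sym|exact: hs].
exists v.
  apply/smooth_div_jump; split.
  - by split=> K; have [] := vD K.
  - move=> x K L xK xL; have [a1 a2] := vV K x xK; have [b1 b2] := vV L x xL.
    by split; [exact: van_trans a1 (van_sym b1)|exact: vanB].
  - move=> x y K L xy xK yK xL yL.
    have [_ [_ [c [_ [ec hl]]]]] := edge_index xy xK yK.
    have [_ [_ [c' [_ [ec' hl']]]]] := edge_index xy xL yL.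
    have [a1 a2] := vE K c; have [b1 b2] := vE L c'; rewrite ec in a1 a2; rewrite ec' in b1 b2.
    have hs t : eval_at (bary (tri K) c) (on_line (pos x) (pos y) t) = 0 by apply/hl; exists t.
    have hs' t : eval_at (bary (tri L) c') (on_line (pos x) (pos y) t) = 0 by apply/hl'; exists t.
    apply: jump_ok_van => t /=.
      exact: van_trans (a1 _ (hs t)) (van_sym (b1 _ (hs' t))).
    exact: van_trans (a2 _ (hs t)) (van_sym (b2 _ (hs' t))).
move=> K; have [d1v d2v] := vD K; split.
- by apply: msizeB => //; rewrite divE; apply: msizeD; [apply: msize_d1|apply: msize_d2].
- move=> i; have [a1 a2] := vV K (vert K i) (vert_in K i).
  apply: (van_trans (q := d1 (Z (vert K i)))); first exact/Zw/vert_in.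
  rewrite divE opprD addrA; apply: vanB.
    apply: van_sym; rewrite /d1 -mderivB -/(d1 _) dirD_d1; apply: van_dirD.
    by rewrite prednK.
  by rewrite dirD_d2; apply: van_dirD; rewrite prednK.
- move=> c s hs; have [a1 a2] := vE K c; have [_ _ _ e4] := hDe K c.
  apply: (van_trans (q := divp (D (eface K c)))); first exact: e4 erefl _ hs.
  apply: van_sym; rewrite divE /divp opprD addrACA /d1 /d2 -!mderivB.
  exact: van_div (a1 s hs) (a2 s hs).
Qed.

Lemma div_surjective w : smooth k.-1 N M.-1 w ->
  exists2 v, smooth_div k N M v & div v = w.
Proof.
move=> /div_approx [v hv hdef].
have [v' [sv' _] hv'] := defect_peel (A := [set: cell T]%SET) (leqnn _) hdef.
exists (addv v v'); first exact: smooth_div_add.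
by apply/ffunP => K; rewrite div_addv hv' ?inE // addrC subrK.
Qed.
End DivSurjective.

(** * Paths and sectors in the plane *)

Section UnitInterval.
Context {R : realType}.
Implicit Types (a b s t e d : R).

(** Cousin's lemma: a property of subintervals that holds for all small ones around each point and
    can be glued holds for the whole interval. The supremum of the good end points can be passed
    unless it is [b]. *)
Lemma cousin a b (P : R -> R -> Prop) : a <= b ->
  (forall t, a <= t <= b -> exists2 e, 0 < e & forall t0 t1,
     a <= t0 <= t -> t <= t1 <= b -> t - e < t0 -> t1 < t + e -> P t0 t1) ->
  (forall t0 t1 t2, a <= t0 <= t1 -> t1 <= t2 <= b -> P t0 t1 -> P t1 t2 -> P t0 t2) ->
  P a b.
Proof.
move=> ab hloc hglue.
pose S : set R := [set t | a <= t <= b /\ P a t].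
have Sa : S a.
  have [|e e0 h] := hloc a; first by rewrite lexx.
  by split; [rewrite lexx|apply: h; rewrite ?lexx //; lra].
have hS : has_sup S.
  by split; [exists a|exists b => t [/andP[]]].
pose c := sup S.
have ac : a <= c by apply: (ub_le_sup hS.2).
have cb : c <= b by apply: sup_le_ub; [exists a|move=> t [/andP[]]].
have [|e e0 h] := hloc c; first by rewrite ac.
have [s [/andP[as_ sb] Ps] cs] := sup_adherent e0 hS.
have sc : s <= c by apply: (ub_le_sup hS.2); split; rewrite ?as_.
have ext t1 : c <= t1 -> t1 <= b -> t1 < c + e -> P a t1.
  move=> ct tb te; apply: (hglue a s t1) => //; rewrite ?lexx ?as_ //.
    by rewrite tb (le_trans sc).
  by apply: h => //; rewrite ?as_ ?ct.
have [<-|cb'] := eqVneq c b; first by apply: ext => //; lra.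
have {cb'}cb' : c < b by rewrite lt_neqAle cb'.
pose t1 := Num.min b (c + e / 2).
have c1 : c < t1 by rewrite lt_min cb'; lra.
have t1b : t1 <= b by rewrite ge_min lexx.
have t1e : t1 < c + e by rewrite gt_min; apply/orP; right; lra.
have : t1 <= c.
  by apply: (ub_le_sup hS.2); split; [rewrite t1b (le_trans ac) // ltW|apply: ext => //; exact: ltW].
by rewrite leNgt c1.
Qed.

Lemma locally_constant (V : Type) a b (F : R -> V) : a <= b ->
  (forall t, a <= t <= b -> exists2 e, 0 < e &
     forall s, a <= s <= b -> `|s - t| < e -> F s = F t) -> F a = F b.
Proof.
move=> ab h; apply: (cousin (P := fun s t => F s = F t)) => // [t htab|? ? ? _ _ -> //].
have [e e0 he] := h t htab; exists e => // t0 t1 /andP[h1 h2] /andP[h3 h4] h5 h6.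
have /andP[h7 h8] := htab.
transitivity (F t).
  by apply: he; [rewrite h1 (le_trans h2)|rewrite ler0_norm ?subr_le0 //; lra].
by apply/esym/he; [rewrite h4 (le_trans _ h3)|rewrite ger0_norm ?subr_ge0 //; lra].
Qed.

(** With [Q] a bound on distances this is continuity, with [Q] an equality of increments it says
    that a path follows a branch; concatenation and reversal are then proved for both at once. *)
Definition near_rel (V : Type) (Q : V -> V -> Prop) (g : R -> V) : Prop :=
  forall t, 0 <= t <= 1 -> exists2 d, 0 < d &
  forall s, 0 <= s <= 1 -> `|s - t| < d -> Q (g t) (g s).

Definition concat (V : Type) (g1 g2 : R -> V) : R -> V :=
  fun t => if t <= 1 / 2 then g1 (2 * t) else g2 (2 * t - 1).

Lemma near_concat (V : Type) (Q : V -> V -> Prop) (g1 g2 : R -> V) :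
  g1 1 = g2 0 -> near_rel Q g1 -> near_rel Q g2 -> near_rel Q (concat g1 g2).
Proof.
move=> e h1 h2 t /andP[t0 t1]; rewrite /concat.
have [ht|ht|ht] := ltgtP t (1 / 2).
- have [|d d0 hd] := h1 (2 * t); first by apply/andP; split; lra.
  exists (Num.min (d / 2) (1 / 2 - t)); first by rewrite lt_min; apply/andP; split; lra.
  move=> s /andP[s0 s1]; rewrite lt_min !ltr_norml => /andP[/andP[a1 a2] /andP[a3 a4]].
  have -> : (s <= 1 / 2) = true by apply/idP; lra.
  by apply: hd; [apply/andP; split; lra|rewrite ltr_norml; apply/andP; split; lra].
- have [|d d0 hd] := h2 (2 * t - 1); first by apply/andP; split; lra.
  exists (Num.min (d / 2) (t - 1 / 2)); first by rewrite lt_min; apply/andP; split; lra.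
  move=> s /andP[s0 s1]; rewrite lt_min !ltr_norml => /andP[/andP[a1 a2] /andP[a3 a4]].
  have -> : (s <= 1 / 2) = false by apply/negbTE; rewrite -ltNge; lra.
  by apply: hd; [apply/andP; split; lra|rewrite ltr_norml; apply/andP; split; lra].
- have [|d d0 hd] := h1 (2 * t); first by apply/andP; split; lra.
  have [|d' d'0 hd'] := h2 (2 * t - 1); first by apply/andP; split; lra.
  exists (Num.min (d / 2) (d' / 2)); first by rewrite lt_min; apply/andP; split; lra.
  move=> s /andP[s0 s1]; rewrite lt_min !ltr_norml => /andP[/andP[a1 a2] /andP[a3 a4]].
  have [hs|hs] := leP s (1 / 2).
    by apply: hd; [apply/andP; split; lra|rewrite ltr_norml; apply/andP; split; lra].
  have -> : 2 * t = 1 by lra.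
  rewrite e (_ : 0 = 2 * t - 1); last by lra.
  by apply: hd'; [apply/andP; split; lra|rewrite ltr_norml; apply/andP; split; lra].
Qed.

Lemma concat0 (V : Type) (g1 g2 : R -> V) : concat g1 g2 0 = g1 0.
Proof. by rewrite /concat mulr0 divr_ge0. Qed.
Lemma concat1 (V : Type) (g1 g2 : R -> V) : concat g1 g2 1 = g2 1.
Proof.
rewrite /concat [_ <= _](_ : _ = false); last by apply/negbTE; rewrite -ltNge; lra.
by congr g2; lra.
Qed.
Lemma concat_forall (V : Type) (Q : V -> Prop) (g1 g2 : R -> V) :
  (forall t, 0 <= t <= 1 -> Q (g1 t)) -> (forall t, 0 <= t <= 1 -> Q (g2 t)) ->
  forall t, 0 <= t <= 1 -> Q (concat g1 g2 t).
Proof.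
move=> h1 h2 t /andP[t0 t1]; rewrite /concat; case: leP => ht.
  by apply: h1; apply/andP; split; lra.
by apply: h2; apply/andP; split; lra.
Qed.

Lemma near_rev (V : Type) (Q : V -> V -> Prop) (g : R -> V) :
  near_rel Q g -> near_rel Q (fun t => g (1 - t)).
Proof.
move=> h t /andP[t0 t1]; have [|d d0 hd] := h (1 - t); first by apply/andP; split; lra.
exists d => // s /andP[s0 s1] hs; apply: hd; first by apply/andP; split; lra.
by rewrite (_ : 1 - s - (1 - t) = t - s) 1?distrC //; ring.
Qed.
End UnitInterval.

(** * Balls, connectedness and sectors in the plane *)

Section PlaneTopology.
Context {R : realType}.
Implicit Types (x y z : plane R) (s t e d : R).

Lemma entry_le_norm z i : `|z 0 i| <= `|z|.
Proof.
rewrite /Num.norm /= mx_normrE.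
exact: (le_bigmax _ (fun ij => `|z ij.1 ij.2|) (0, i)).
Qed.

Lemma on_line_diff x y s t : on_line x y s - on_line x y t = (s - t) *: (y - x).
Proof.
apply/rowP => i; rewrite !mxE; ring.
Qed.

Lemma on_line_norm x y s t : `|on_line x y s - on_line x y t| = `|s - t| * `|y - x|.
Proof. by rewrite on_line_diff normrZ. Qed.

Lemma open_ball (A : set (plane R)) x : open A -> A x ->
  exists2 e, 0 < e & forall y, `|y - x| < e -> A y.
Proof.
move=> oA Ax; have /nbhs_ballP [e e0 h] : nbhs x A by exact: open_nbhs_nbhs.
by exists e => // y hy; apply: h; rewrite -ball_normE /ball_ /= distrC.
Qed.

Lemma interior_ball (A : set (plane R)) x e : 0 < e ->
  (forall y, `|y - x| < e -> A y) -> interior A x.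
Proof.
move=> e0 h; apply/nbhs_ballP; exists e => //= y; rewrite -ball_normE /ball_ /= => hy.
by apply: h; rewrite distrC.
Qed.

Lemma not_closure_ball (A : set (plane R)) x : ~ closure A x ->
  exists2 e, 0 < e & forall y, `|y - x| < e -> ~ closure A y.
Proof.
move=> nx; apply: (open_ball (A := ~` closure A)) => //.
by rewrite openC; exact: closed_closure.
Qed.

Lemma within_path (g : R -> plane R) : {within `[0, 1], continuous g} <->
  forall e, 0 < e -> near_rel (fun y z => `|z - y| < e) g.
Proof.
split=> [/subspace_continuousP hc e e0 t ht|h].
  have t01 : `[0, 1]%classic t by rewrite /= in_itv.
  have /cvgrPdist_lt /(_ e e0) := hc t t01.
  rewrite near_withinE => /nbhs_ballP [d d0 hd].
  exists d => // s hs hst; rewrite distrC; apply: hd => /=; last by rewrite in_itv.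
  by rewrite -ball_normE /ball_ /= distrC.
apply/subspace_continuousP => t; rewrite /= in_itv /= => ht.
apply/cvgrPdist_lt => e e0; have [d d0 hd] := h e e0 t ht.
rewrite near_withinE; apply/nbhs_ballP; exists d => //= s.
rewrite -ball_normE /ball_ /= => hst; rewrite in_itv /= => hs.
by rewrite distrC; apply: hd => //; rewrite distrC.
Qed.

Lemma within_square (H : R * R -> plane R) :
  {within `[0, 1] `*` `[0, 1], continuous H} ->
  forall s t, 0 <= s <= 1 -> 0 <= t <= 1 -> forall e, 0 < e -> exists2 d, 0 < d &
  forall s' t', 0 <= s' <= 1 -> 0 <= t' <= 1 -> `|s' - s| < d -> `|t' - t| < d ->
  `|H (s', t') - H (s, t)| < e.
Proof.
move=> /subspace_continuousP hc s t hs ht e e0.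
have st01 : (`[0, 1] `*` `[0, 1])%classic (s, t) by split; rewrite /= in_itv.
have /cvgrPdist_lt /(_ e e0) := hc (s, t) st01.
rewrite near_withinE => /nbhs_ballP [d d0 hd].
exists d => // s' t' hs' ht' h1 h2; rewrite distrC; apply: hd.
  by split; rewrite -ball_normE /ball_ /= distrC.
by split; rewrite /= in_itv.
Qed.

Lemma fin_eps (I : finType) (Q : I -> plane R -> Prop) :
  (forall i, exists2 e, 0 < e & forall z, `|z| < e -> Q i z) ->
  exists2 e, 0 < e & forall z, `|z| < e -> forall i, Q i z.
Proof.
move=> h; suff : exists2 e, 0 < e & forall z, `|z| < e -> forall i, i \in enum I -> Q i z.
  by move=> [e e0 he]; exists e => // z hz i; apply: he => //; rewrite mem_enum.
elim: (enum I) => [|i s [e e0 he]]; first by exists 1.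
have [d d0 hd] := h i; exists (Num.min e d); first by rewrite lt_min e0.
move=> z; rewrite lt_min => /andP[h1 h2] j; rewrite inE => /orP[/eqP ->|]; first exact: hd.
exact: he.
Qed.

Lemma segment_avoid x a b : (forall t, 0 <= t <= 1 -> x <> on_line a b t) ->
  exists2 e, 0 < e & forall z, `|z| < e -> forall t, 0 <= t <= 1 -> x + z <> on_line a b t.
Proof.
move=> h; pose A := [set on_line a b t | t in `[0, 1]].
have cl : closed A.
  apply: compact_closed; first exact: norm_hausdorff.
  apply: continuous_compact; last exact: segment_compact.
  apply: continuous_subspaceT => t.
  by apply: cvgD; apply: cvgZr_tmp; [apply: cvgB; [exact: cvg_cst|exact: cvg_id]|exact: cvg_id].
have [||e e0 he] := @open_ball (~` A) x; first by rewrite openC.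
  by move=> [t]; rewrite /= in_itv => ht e; apply: (h t ht).
exists e => // z hz t ht ez; apply: (he (x + z)); first by rewrite addrC addKr.
by exists t; rewrite /= ?in_itv.
Qed.

(** No locally constant function on [D] separates the two points. This form of connectedness applies
    directly to the function that has to be shown constant. *)
Definition inseparable (D : plane R -> Prop) y z : Prop :=
  forall h : plane R -> R,
  (forall p, D p -> exists2 d, 0 < d & forall q, D q -> `|q - p| < d -> h q = h p) ->
  h y = h z.

Lemma inseparable_trans D x y z :
  inseparable D x y -> inseparable D y z -> inseparable D x z.
Proof. by move=> h1 h2 h hh; rewrite (h1 h hh) (h2 h hh). Qed.
Lemma inseparable_sym D x y : inseparable D x y -> inseparable D y x.
Proof. by move=> h1 h hh; rewrite (h1 h hh). Qed.
Lemma inseparable_segment D y z : (forall t, 0 <= t <= 1 -> D (on_line y z t)) ->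
  inseparable D y z.
Proof.
move=> hD h hh; rewrite -(on_line0 y z) -[in RHS](on_line1 y z).
apply: (locally_constant (F := fun t => h (on_line y z t))) => // t ht.
have [d d0 hd] := hh _ (hD t ht).
exists (d / (1 + `|z - y|)).
  by rewrite divr_gt0 // ltr_wpDr.
move=> s hs hst; apply: hd; first exact: hD.
have n0 : 0 < 1 + `|z - y| by rewrite ltr_wpDr.
rewrite on_line_norm; move: hst; rewrite ltr_pdivlMr // => hst.
by apply: le_lt_trans hst; rewrite ler_wpM2l // lerDr.
Qed.

Lemma det2_line x a b t : det2 x (on_line a b t) = (1 - t) * det2 x a + t * det2 x b.
Proof. rewrite /det2 !mxE; ring. Qed.
Lemma det2C x y : det2 x y = - det2 y x.
Proof. rewrite /det2; ring. Qed.

Lemma convex_pos a b t : 0 <= t <= 1 -> 0 < a -> 0 < b -> 0 < (1 - t) * a + t * b.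
Proof.
case/andP; rewrite le_eqVlt => /orP[/eqP <- _ a0 _|t0 t1 a0 b0].
  by rewrite subr0 mul1r mul0r addr0.
by rewrite ltr_wpDl ?mulr_gt0 // mulr_ge0 ?subr_ge0 // ltW.
Qed.

Lemma ball_line a b e t : 0 <= t <= 1 -> `|a| < e -> `|b| < e -> `|on_line a b t| < e.
Proof.
move=> ht ha hb; apply: (le_lt_trans (ler_normD _ _)); rewrite !normrZ.
case/andP: (ht) => t0 t1; rewrite !ger0_norm ?subr_ge0 //.
rewrite -subr_gt0 (_ : _ - _ = (1 - t) * (e - `|a|) + t * (e - `|b|)); last by ring.
by apply: convex_pos; rewrite // subr_gt0.
Qed.

(** If [det2 a b > 0], one sector is an intersection of two half-planes, hence convex; the other is
    the union of the complementary half-planes, both of which contain -(a + b), so its points are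
    joined through a small multiple of this vector. Opposite rays cut out two half-planes. *)
Lemma two_sectors (a b : plane R) e : 0 < e -> a != 0 -> b != 0 ->
  (forall c, 0 < c -> b <> c *: a) ->
  exists S1 S2 : plane R -> Prop,
  [/\ forall z, (exists2 t, 0 <= t & z = t *: a \/ z = t *: b) \/ S1 z \/ S2 z,
      forall z, S1 z \/ S2 z -> ~ (exists2 t, 0 <= t & z = t *: a \/ z = t *: b),
      forall y z, `|y| < e /\ S1 y -> `|z| < e /\ S1 z ->
        inseparable (fun p => `|p| < e /\ S1 p) y z &
      forall y z, `|y| < e /\ S2 y -> `|z| < e /\ S2 z ->
        inseparable (fun p => `|p| < e /\ S2 p) y z].
Proof.
move=> e0 + + hab.
have detZ (t : R) (y z : plane R) : det2 y (t *: z) = t * det2 y z by rewrite /det2 !mxE; ring.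
have det_self (y : plane R) : det2 y y = 0 by rewrite /det2; ring.
have half (y : plane R) (sg : R) p q :
    `|p| < e /\ 0 < sg * det2 y p -> `|q| < e /\ 0 < sg * det2 y q ->
    forall t, 0 <= t <= 1 -> `|on_line p q t| < e /\ 0 < sg * det2 y (on_line p q t).
  move=> [p1 p2] [q1 q2] t ht; split; first exact: ball_line.
  rewrite det2_line mulrDr ![sg * _]mulrCA; exact: convex_pos.
have parallel (y z : plane R) : y != 0 -> det2 y z = 0 -> exists t, z = t *: y.
  move=> y0 d0; have [y00|y00] := eqVneq (y 0 0) 0.
    have y01 : y 0 1 != 0.
      apply: contra_neq y0 => y01; apply/rowP => -[[|[|//]] lt]; rewrite mxE.
        by rewrite -[RHS]y00; congr (y _ _); exact: val_inj.
      by rewrite -[RHS]y01; congr (y _ _); exact: val_inj.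
    exists (z 0 1 / y 0 1); have z00 : z 0 0 = 0.
      move: d0; rewrite /det2 y00 mul0r sub0r => /eqP; rewrite oppr_eq0 mulf_eq0 (negPf y01).
      by move=> /eqP.
    apply/rowP => -[[|[|//]] lt]; rewrite mxE.
      rewrite (_ : Ordinal lt = 0); last exact: val_inj.
      by rewrite z00 y00 mulr0.
    rewrite (_ : Ordinal lt = 1); last exact: val_inj.
    by rewrite divfK.
  exists (z 0 0 / y 0 0); apply/rowP => -[[|[|//]] lt]; rewrite mxE.
    rewrite (_ : Ordinal lt = 0); last exact: val_inj.
    by rewrite divfK.
  rewrite (_ : Ordinal lt = 1); last exact: val_inj.
  by move: d0; rewrite /det2 => /eqP; rewrite subr_eq0 => /eqP h; rewrite mulrAC -[X in _ = X * _]mulrC -h mulrAC mulfV // mul1r.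
wlog hdet : a b hab / 0 <= det2 a b.
  move=> W a0 b0; have [h|h] := lerP 0 (det2 a b); first exact: W.
  have [||//|//|S1 [S2 [h1 h2 h3 h4]]] := W b a.
  - move=> c c0 ea; apply: (hab c^-1); first by rewrite invr_gt0.
    by rewrite ea scalerA mulVf ?scale1r // gt_eqF.
  - by rewrite det2C oppr_ge0 ltW.
  exists S1, S2; split => // z.
    by have [[t t0 [->|->]]|] := h1 z; [left; exists t; [|right]|left; exists t; [|left]|right].
  by move=> /h2 hz [t t0 ht]; apply: hz; exists t => //; case: ht; [right|left].
move=> a0 b0; move: hdet; rewrite le_eqVlt => /orP[/eqP /esym d0|dpos].
  have [c eb] := parallel a b a0 d0.
  have c0 : c < 0.
    rewrite ltNge; apply/negP; rewrite le_eqVlt => /orP[/eqP c0|c0]; last exact: (hab c).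
    by move: b0; rewrite eb -c0 scale0r eqxx.
  exists (fun z => 0 < 1 * det2 a z), (fun z => 0 < -1 * det2 a z); split.
  - move=> z; have [h|h|h] := ltgtP (det2 a z) 0.
    + by right; right; rewrite mulN1r oppr_gt0.
    + by right; left; rewrite mul1r.
    + left; have [t et] := parallel a z a0 h.
      have [t0|t0] := lerP 0 t; first by exists t => //; left.
      exists (t / c); first by rewrite ltW // nmulr_lgt0 // invr_lt0.
      by right; rewrite eb scalerA divfK // lt_eqF.
  - move=> z hz [t _ [ez|ez]]; move: hz; rewrite ez ?eb !detZ det_self !mulr0 => -[]; by rewrite ltxx.
  - by move=> y z hy hz; apply: inseparable_segment; exact: half hy hz.
  - by move=> y z hy hz; apply: inseparable_segment; exact: half hy hz.
have cramer (z : plane R) : z = (det2 z b / det2 a b) *: a + (det2 a z / det2 a b) *: b.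
  by apply/rowP => i; rewrite !mxE; case: i => -[|[|//]] lt;
    [rewrite (_ : Ordinal lt = 0); last exact: val_inj|rewrite (_ : Ordinal lt = 1); last exact: val_inj];
    rewrite /det2; field; rewrite -/(det2 a b) gt_eqF.
pose S2 z := 0 < -1 * det2 a z \/ 0 < 1 * det2 b z.
exists (fun z => 0 < 1 * det2 a z /\ 0 < -1 * det2 b z), S2; split.
- move=> z; rewrite /S2 !mulN1r !mul1r !oppr_gt0.
  have [h|h|h] := ltgtP (det2 a z) 0; first by right; right; left.
    have [h'|h'|h'] := ltgtP (det2 b z) 0; [by right; left|by right; right; right|].
    left; exists (det2 a z / det2 a b); first by rewrite divr_ge0 ?ltW.
    by right; rewrite {1}(cramer z) det2C h' oppr0 mul0r scale0r add0r.
  have [h'|h'] := lerP (det2 b z) 0; last by right; right; right.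
  have h0 : 0 <= det2 z b by rewrite det2C oppr_ge0.
  left; exists (det2 z b / det2 a b); first by rewrite divr_ge0 // ltW.
  by left; rewrite {1}(cramer z) h mul0r scale0r addr0.
- move=> z hz [t t0 ht]; move: hz; rewrite /S2 !mulN1r !mul1r.
  case: ht => ->; rewrite !detZ ?det_self ?[det2 b a]det2C ?mulr0 ?mulrN ?opprK ?oppr0 ?ltxx.
    by move=> [[]//|[//|]]; rewrite oppr_gt0 ltNge mulr_ge0 // ltW.
  by move=> [[_]//|[|//]]; rewrite oppr_gt0 ltNge mulr_ge0 // ltW.
- move=> y z [y1 [y2 y3]] [z1 [z2 z3]]; apply: inseparable_segment => t ht.
  have [h1 h2] := half a 1 y z (conj y1 y2) (conj z1 z2) t ht; split=> //; split=> //.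
  by have [] := half b (-1) y z (conj y1 y3) (conj z1 z3) t ht.
- pose m := - ((e / (2 * (1 + `|a + b|))) *: (a + b)).
  have n0 : 0 < 1 + `|a + b| by rewrite ltr_wpDr.
  have r0 : 0 < e / (2 * (1 + `|a + b|)) by rewrite divr_gt0 // mulr_gt0.
  have me : `|m| < e.
    rewrite normrN normrZ gtr0_norm // mulrAC ltr_pdivrMr ?mulr_gt0 //.
    by rewrite ltr_pM2l //; lra.
  have m1 : 0 < -1 * det2 a m.
    have -> : -1 * det2 a m = e / (2 * (1 + `|a + b|)) * det2 a b by rewrite /m /det2 !mxE; ring.
    exact: mulr_gt0.
  have m2 : 0 < 1 * det2 b m.
    have -> : 1 * det2 b m = e / (2 * (1 + `|a + b|)) * det2 a b by rewrite /m /det2 !mxE; ring.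
    exact: mulr_gt0.
  have tom y : `|y| < e /\ S2 y -> inseparable (fun p => `|p| < e /\ S2 p) y m.
    move=> [ye [ya|yb]]; apply: inseparable_segment => t ht.
      by have [h1 h2] := half a (-1) y m (conj ye ya) (conj me m1) t ht; split => //; left.
    by have [h1 h2] := half b 1 y m (conj ye yb) (conj me m2) t ht; split => //; right.
  by move=> y z /tom hy /tom hz; apply: inseparable_trans hy (inseparable_sym hz).
Qed.
End PlaneTopology.

(** * Analytic continuation on the grid *)

Section GridTopology.
Context {R : realType} {T : grid R}.
Implicit Types (K L : cell T) (x y z : plane R) (s t e d : R).

Definition inK K : set (plane R) := hull (@pos R T) (corners K).

Lemma inKP K y : inK K y <-> forall i, 0 <= eval_at (bary (tri K) i) y.
Proof. exact: hullP. Qed.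

Lemma bary_continuous K i y e : 0 < e -> exists2 d, 0 < d &
  forall z, `|z| < d -> `|eval_at (bary (tri K) i) (y + z) - eval_at (bary (tri K) i) y| < e.
Proof.
move=> e0; set A := invmx (bary_mx (tri K)) 0 i; set B := invmx (bary_mx (tri K)) 1 i.
have n0 : 0 < `|A| + `|B| + 1 by rewrite ltr_wpDl // addr_ge0.
exists (e / (`|A| + `|B| + 1)); first exact: divr_gt0.
move=> z; rewrite ltr_pdivlMr // => hz.
have -> : eval_at (bary (tri K) i) (y + z) - eval_at (bary (tri K) i) y = A * z 0 0 + B * z 0 1.
  by rewrite /bary !evalD !evalZ !evalX !evalC !mxE -/A -/B; ring.
apply: le_lt_trans hz; apply: (le_trans (ler_normD _ _)); rewrite !normrM.
have h0 := entry_le_norm z 0; have h1 := entry_le_norm z 1.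
have := ler_wpM2l (normr_ge0 A) h0; have := ler_wpM2l (normr_ge0 B) h1.
by have := normr_ge0 z; lra.
Qed.

(** The finitely many triangles that miss [x] are closed and stay at a positive distance from it. *)
Lemma star_local x : exists2 e, 0 < e &
  forall y, `|y - x| < e -> forall K, inK K y -> inK K x.
Proof.
have [K|e e0 h] := @fin_eps R (cell T) (fun K z => inK K (x + z) -> inK K x).
  case: (pselect (inK K x)) => [hx|/inKP hx]; first by exists 1.
  have [i hi] : exists i, eval_at (bary (tri K) i) x < 0.
    apply: contrapT => hn; apply: hx => i; rewrite leNgt; apply/negP => hi.
    by apply: hn; exists i.
  have [|d d0 hd] := @bary_continuous K i x (- eval_at (bary (tri K) i) x); first by rewrite oppr_gt0.
  exists d => // z /hd hz /inKP /(_ i) h; exfalso.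
  by move: hz; rewrite ltr_norml => /andP[_]; lra.
exists e => // y hy K hK; apply: (h (y - x)) => //.
by rewrite addrC subrK.
Qed.

Lemma inK_pos K (v : vertex T) : v \in corners K -> inK K (pos v).
Proof.
move=> /vertP [i ->]; apply/inKP => j.
by rewrite -/(tri K i) (bary_vertex (@tri_free R T K)) ler0n.
Qed.

Definition center K : plane R := \sum_i 3^-1 *: tri K i.

Lemma bary_center K i : eval_at (bary (tri K) i) (center K) = 3^-1.
Proof.
by rewrite /center bary_affine // sumr_const card_ord -[LHS]mulr_natr mulVf.
Qed.

Lemma bary_to_center K y t i : inK K y -> 0 <= t < 1 ->
  0 < eval_at (bary (tri K) i) (on_line (center K) y t).
Proof.
move=> /inKP /(_ i) h /andP[t0 t1]; rewrite eval_bary_line bary_center.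
by rewrite ltr_pwDl ?mulr_ge0 // mulr_gt0 // subr_gt0.
Qed.

Lemma inK_segment K y z t : inK K y -> inK K z -> 0 <= t <= 1 -> inK K (on_line y z t).
Proof.
move=> /inKP hy /inKP hz /andP[t0 t1]; apply/inKP => i; rewrite eval_bary_line.
by rewrite addr_ge0 // mulr_ge0 // subr_ge0.
Qed.

Lemma inK_center K : inK K (center K).
Proof. by apply/inKP => i; rewrite bary_center invr_ge0. Qed.

Lemma inK_meet K L y : inK K y -> inK L y -> exists v, (v \in corners K) && (v \in corners L).
Proof.
move=> yK yL; have : (hull (@pos R T) (corners K) `&` hull (@pos R T) (corners L)) y by [].
rewrite conforming => -[w [_ w1 _]].
have [/eqP e|/finset.set0Pn [v]] := eqVneq (corners K :&: corners L) finset.set0.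
  by move: w1; rewrite (eqP e) big_set0 => /eqP; rewrite eq_sym oner_eq0.
by rewrite finset.in_setI => h; exists v.
Qed.

(** * Lifting of paths and homotopies; monodromy *)

Section Lifts.
Variable u : pwpoly T.
Hypothesis ujump : forall K L y z, inK K y -> inK L y -> inK K z -> inK L z ->
  eval_at (u K) y - eval_at (u L) y = eval_at (u K) z - eval_at (u L) z.

Definition cell_at y : option (cell T) := [pick K | `[< inK K y >]].

(** The increment of the branch of [u] that is continued from [x]; near [x] the choice of the
    triangle is immaterial since jumps of [u] are constant on intersections. *)
Definition incr x y : R :=
  if cell_at y is Some K then eval_at (u K) y - eval_at (u K) x else 0.

Lemma incrE x y K : inK K y -> (forall L, inK L y -> inK L x) ->
  incr x y = eval_at (u K) y - eval_at (u K) x.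
Proof.
rewrite /incr /cell_at => hK sub; case: pickP => [L /asboolP hL|/(_ K) /asboolPn //].
have := ujump hK hL (sub K hK) (sub L hL); lra.
Qed.

(** [u] is read as a function that is determined up to a constant on each triangle, and [F] is a
    branch of it along [H]. Only increments enter, so lifts can be shifted by constants. *)
Definition lift (H : R -> R -> plane R) (sa sb ta tb : R) (F : R -> R -> R) : Prop :=
  forall s t, sa <= s <= sb -> ta <= t <= tb -> exists2 d, 0 < d &
  forall s' t', sa <= s' <= sb -> ta <= t' <= tb -> `|s' - s| < d -> `|t' - t| < d ->
  forall K, inK K (H s' t') ->
  F s' t' - F s t = eval_at (u K) (H s' t') - eval_at (u K) (H s t).

Definition cts (H : R -> R -> plane R) : Prop :=
  forall s t, 0 <= s <= 1 -> 0 <= t <= 1 -> forall e, 0 < e -> exists2 d, 0 < d &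
  forall s' t', 0 <= s' <= 1 -> 0 <= t' <= 1 -> `|s' - s| < d -> `|t' - t| < d ->
  `|H s' t' - H s t| < e.

Lemma lift_swap H sa sb ta tb F : lift H sa sb ta tb F ->
  lift (fun s t => H t s) ta tb sa sb (fun s t => F t s).
Proof.
by move=> h s t hs ht; have [d d0 hd] := h t s ht hs; exists d => // s' t' *; exact: hd.
Qed.

Lemma lift_local H s t : cts H -> 0 <= s <= 1 -> 0 <= t <= 1 ->
  exists2 e, 0 < e & forall sa sb ta tb, 0 <= sa <= s -> s <= sb <= 1 ->
  0 <= ta <= t -> t <= tb <= 1 -> s - e < sa -> sb < s + e -> t - e < ta -> tb < t + e ->
  exists F, lift H sa sb ta tb F.
Proof.
move=> hc hs ht; have [r r0 hr] := star_local (H s t).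
have [d d0 hd] := hc s t hs ht r r0.
exists d => // sa sb ta tb /andP[sa0 sas] /andP[ssb sb1] /andP[ta0 tat] /andP[ttb tb1] a1 a2 a3 a4.
have near s' t' : sa <= s' <= sb -> ta <= t' <= tb ->
    forall K, inK K (H s' t') -> inK K (H s t).
  move=> /andP[b1 b2] /andP[b3 b4]; apply: hr; apply: hd.
  - by rewrite (le_trans sa0) // (le_trans b2).
  - by rewrite (le_trans ta0) // (le_trans b4).
  - by rewrite ltr_norml; apply/andP; split; lra.
  - by rewrite ltr_norml; apply/andP; split; lra.
exists (fun s' t' => incr (H s t) (H s' t')) => s1 t1 hs1 ht1.
have hs1' : 0 <= s1 <= 1 by case/andP: hs1 => *; rewrite (le_trans sa0) // (le_trans _ sb1).
have ht1' : 0 <= t1 <= 1 by case/andP: ht1 => *; rewrite (le_trans ta0) // (le_trans _ tb1).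
have [r1 r10 hr1] := star_local (H s1 t1).
have [d1 d10 hd1] := hc s1 t1 hs1' ht1' r1 r10.
exists d1 => // s' t' hs' ht' e1 e2 K hK.
have hK1 : inK K (H s1 t1).
  apply: (hr1 (H s' t')) => //; apply: hd1 => //.
    by case/andP: hs' => *; rewrite (le_trans sa0) // (le_trans _ sb1).
  by case/andP: ht' => *; rewrite (le_trans ta0) // (le_trans _ tb1).
rewrite (incrE hK (near _ _ hs' ht')) (incrE hK1 (near _ _ hs1 ht1)); lra.
Qed.

Variable Omega : set (plane R).
Hypothesis cover : forall y, Omega y -> exists K, inK K y.

Definition inO (H : R -> R -> plane R) : Prop :=
  forall s t, 0 <= s <= 1 -> 0 <= t <= 1 -> Omega (H s t).

(** On the common side both lifts have the increments of [u], so their difference is locally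
    constant, hence constant, and can be added to the second one. *)
Lemma lift_glue H sa sb ta tm tb F1 F2 : inO H ->
  0 <= sa -> sa <= sb -> sb <= 1 -> 0 <= ta -> ta <= tm -> tm <= tb -> tb <= 1 ->
  lift H sa sb ta tm F1 -> lift H sa sb tm tb F2 -> exists F, lift H sa sb ta tb F.
Proof.
move=> HO sa0 sab sb1 ta0 tam tmb tb1 h1 h2.
pose c s := F1 s tm - F2 s tm.
have cc s : sa <= s <= sb -> c s = c sa.
  move=> /andP[s0 s1]; apply/esym.
  apply: (locally_constant (F := c)) => // s' /andP[s'0 s's].
  have hs' : sa <= s' <= sb by rewrite s'0 (le_trans s's).
  have [|d d0 hd] := h1 s' tm hs'; first by rewrite tam lexx.
  have [|d' d'0 hd'] := h2 s' tm hs'; first by rewrite lexx.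
  exists (Num.min d d'); first by rewrite lt_min d0.
  move=> s2 /andP[s20 s2s]; rewrite lt_min => /andP[e1 e2].
  have hs2 : sa <= s2 <= sb by rewrite s20 (le_trans s2s).
  have s2I : 0 <= s2 <= 1.
    by apply/andP; split; [exact: le_trans s20|exact: le_trans s2s (le_trans s1 sb1)].
  have tmI : 0 <= tm <= 1.
    by apply/andP; split; [exact: le_trans tam|exact: le_trans tmb _].
  have [K hK] := cover (HO s2 tm s2I tmI).
  have := hd s2 tm hs2 _ e1 _ K hK; have := hd' s2 tm hs2 _ e2 _ K hK.
  rewrite subrr normr0 tam tmb !lexx => /(_ isT d'0) a1 /(_ isT d0) a2.
  by rewrite /c; lra.
exists (fun s t => if t <= tm then F1 s t else F2 s t + c s) => s t hs /andP[ta_t t_tb].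
have [ht|ht|ht] := ltgtP t tm.
- have [|d d0 hd] := h1 s t hs; first by rewrite ta_t ltW.
  exists (Num.min d (tm - t)); first by rewrite lt_min d0 subr_gt0.
  move=> s' t' hs' /andP[b1 b2] e1; rewrite !lt_min in e1 *.
  case/andP: e1 => e1 _ /andP[e2 e3] K hK.
  have t'm : t' <= tm by move: e3; rewrite ltr_norml => /andP[*]; lra.
  by rewrite t'm; apply: hd; rewrite ?b1.
- have [|d d0 hd] := h2 s t hs; first by rewrite t_tb ltW.
  exists (Num.min d (t - tm)); first by rewrite lt_min d0 subr_gt0.
  move=> s' t' hs' /andP[b1 b2] e1; rewrite !lt_min in e1 *.
  case/andP: e1 => e1 _ /andP[e2 e3] K hK.
  have t'm : tm < t' by move: e3; rewrite ltr_norml => /andP[*]; lra.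
  rewrite leNgt t'm /= (cc s hs) (cc s' hs').
  by have := hd s' t' hs' _ e1 e2 K hK; rewrite b2 ltW // => /(_ isT) <-; lra.
- rewrite ht in ta_t t_tb *.
  have [|d d0 hd] := h1 s tm hs; first by rewrite tam lexx.
  have [|d' d'0 hd'] := h2 s tm hs; first by rewrite tmb lexx.
  exists (Num.min d d'); first by rewrite lt_min d0.
  move=> s' t' hs' /andP[b1 b2]; rewrite !lt_min => /andP[e1 e2] /andP[e3 e4] K hK.
  have [t'm|t'm] := leP t' tm; first by apply: hd; rewrite ?b1.
  rewrite (cc s' hs') -(cc s hs) /c.
  by have := hd' s' t' hs' _ e2 e4 K hK; rewrite b2 ltW // => /(_ isT) <-; lra.
Qed.

(** Cousin's lemma in each parameter: small squares are glued to a strip along each line of constant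
    [s], and the strips to the square after exchanging the parameters. *)
Lemma lift_square H : cts H -> inO H -> exists F, lift H 0 1 0 1 F.
Proof.
move=> hc HO.
apply: (cousin (P := fun s0 s1 => exists F, lift H s0 s1 0 1 F)) => //; last first.
  move=> s0 s1 s2 /andP[a1 a2] /andP[a3 a4] [F1 h1] [F2 h2].
  have [||||||||||F hF] := @lift_glue (fun s t => H t s) 0 1 s0 s1 s2 (fun s t => F1 t s) (fun s t => F2 t s) => //.
  - by move=> s t hs ht; exact: HO.
  - exact: lift_swap.
  - exact: lift_swap.
  by exists (fun s t => F t s); exact: (lift_swap hF).
move=> s hs.
suff [e e0 he] : exists2 e, 0 < e & forall sa sb, 0 <= sa <= s -> s <= sb <= 1 ->
    s - e < sa -> sb < s + e -> exists F, lift H sa sb 0 1 F.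
  by exists e => // t0 t1 *; exact: he.
(* The width [e] of the strip is part of the property, so that gluing can take the minimum of two
   widths. *)
apply: (cousin (P := fun t0 t1 => exists2 e, 0 < e & forall sa sb, 0 <= sa <= s -> s <= sb <= 1 ->
    s - e < sa -> sb < s + e -> exists F, lift H sa sb t0 t1 F)) => //.
  move=> t ht; have [e e0 he] := lift_local hc hs ht.
  by exists e => // t0 t1 b1 b2 b3 b4; exists e => // sa sb b5 b6 b7 b8; exact: he.
move=> t0 t1 t2 /andP[b1 b2] /andP[b3 b4] [e e0 he] [e' e'0 he'].
exists (Num.min e e'); first by rewrite lt_min e0.
move=> sa sb b5 b6 b7 b8.
have m1 : Num.min e e' <= e by rewrite ge_min lexx.
have m2 : Num.min e e' <= e' by rewrite ge_min lexx orbT.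
have [||F1 h1] := he sa sb b5 b6; [lra|lra|].
have [||F2 h2] := he' sa sb b5 b6; [lra|lra|].
case/andP: b5 b6 => b51 b52 /andP[b61 b62].
by apply: (lift_glue HO _ _ _ _ _ _ _ h1 h2) => //; apply: le_trans b61.
Qed.

(** A path in the covering of the domain by branches of [u]: a moving point together with the
    continued value. *)
Definition branch (g : R -> plane R * R) : Prop :=
  [/\ forall e, 0 < e -> near_rel (fun p q => `|q.1 - p.1| < e) g,
      forall t, 0 <= t <= 1 -> Omega (g t).1 &
      near_rel (fun p q => forall K, inK K q.1 ->
        q.2 - p.2 = eval_at (u K) q.1 - eval_at (u K) p.1) g].

Definition joined (p q : plane R * R) : Prop :=
  exists g, [/\ branch g, g 0 = p & g 1 = q].

Lemma joined_trans p q r : joined p q -> joined q r -> joined p r.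
Proof.
move=> [g1 [[c1 o1 l1] e1 e1']] [g2 [[c2 o2 l2] e2 e2']].
have e : g1 1 = g2 0 by rewrite e1' e2.
exists (concat g1 g2); split; [|by rewrite concat0|by rewrite concat1].
split; [|exact: (@concat_forall _ _ (fun p => Omega p.1))|exact: near_concat].
by move=> d d0; apply: near_concat => //; [exact: c1|exact: c2].
Qed.

Lemma joined_sym p q : joined p q -> joined q p.
Proof.
move=> [g [[c o l] e1 e2]]; exists (fun t => g (1 - t)); split.
- split; [by move=> d d0; apply: near_rev; exact: c| |exact: near_rev].
  by move=> t /andP[t0 t1]; apply: o; apply/andP; split; lra.
- by rewrite subr0.
- by rewrite subrr.
Qed.

(** Adding a constant to the value is a deck transformation of the covering. *)
Lemma joined_shift a p q : joined p q -> joined (p.1, p.2 + a) (q.1, q.2 + a).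
Proof.
move=> [g [[c o l] e1 e2]]; exists (fun t => ((g t).1, (g t).2 + a)).
split; [|by rewrite e1|by rewrite e2].
split; [exact: c|exact: o|] => t ht; have [d d0 hd] := l t ht.
by exists d => // s hs hst K hK /=; rewrite -(hd s hs hst K hK); ring.
Qed.

Hypothesis openO : open Omega.

Lemma joined_near y : Omega y -> exists2 d, 0 < d & forall z, `|z - y| < d ->
  Omega z /\ forall K a, inK K z -> joined (y, a) (z, a + (eval_at (u K) z - eval_at (u K) y)).
Proof.
move=> Oy; have [d d0 hd] := open_ball openO Oy; have [r r0 hr] := star_local y.
exists (Num.min d r); first by rewrite lt_min d0.
move=> z; rewrite lt_min => /andP[zd zr]; split; first exact: hd.
move=> K a hK; pose g t := on_line y z t.
have gy t : 0 <= t <= 1 -> `|g t - y| <= `|z - y|.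
  move=> /andP[t0 t1]; have -> : g t - y = on_line y z t - on_line y z 0 by rewrite on_line0.
  rewrite on_line_norm subr0 ger0_norm //.
  by rewrite ler_piMl.
have gO t : 0 <= t <= 1 -> Omega (g t) by move=> ht; apply: hd; exact: le_lt_trans (gy t ht) zd.
have gK t : 0 <= t <= 1 -> forall L, inK L (g t) -> inK L y.
  by move=> ht; apply: hr; exact: le_lt_trans (gy t ht) zr.
have gc e : 0 < e -> near_rel (fun p q => `|q - p| < e) g.
  move=> e0 t ht; have n0 : 0 < 1 + `|z - y| by rewrite ltr_wpDr.
  exists (e / (1 + `|z - y|)); first exact: divr_gt0.
  move=> s hs; rewrite ltr_pdivlMr // => hst; rewrite on_line_norm.
  by apply: le_lt_trans hst; rewrite ler_wpM2l // lerDr.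
have z1 : g 1 = z by rewrite /g on_line1.
have I0 : 0 <= (0 : R) <= 1 by rewrite lexx ler01.
have I1 : 0 <= (1 : R) <= 1 by rewrite lexx ler01.
exists (fun t => (g t, a + incr y (g t))); split.
- split; [exact: gc|exact: gO|].
  move=> t ht; have [r1 r10 hr1] := star_local (g t).
  have [d1 d10 hd1] := gc r1 r10 t ht.
  exists d1 => // s hs hst L hL /=.
  have hLt : inK L (g t) by apply: (hr1 (g s)) => //; exact: hd1.
  rewrite (incrE hL (gK s hs)) (incrE hLt (gK t ht)); ring.
- have [L hL] := cover Oy; rewrite /g on_line0 (incrE hL) // subrr addr0; by [].
- by rewrite z1 (@incrE y z K) //; rewrite -z1; exact: gK.
Qed.

Lemma path_branch g a : path_in Omega g -> exists b, joined (g 0, a) (g 1, b).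
Proof.
move=> [/within_path hc hO].
(* A path is lifted as a homotopy that does not depend on its first parameter. *)
have [||F hF] := @lift_square (fun _ t => g t).
- move=> s t hs ht e e0; have [d d0 hd] := hc e e0 t ht.
  by exists d => // s' t' _ ht' _; exact: hd.
- by move=> s t _ ht; exact: hO.
exists (a + (F 0 1 - F 0 0)); exists (fun t => (g t, a + (F 0 t - F 0 0))).
split; [|by rewrite subrr addr0|by []].
split=> // t ht; have I0 : 0 <= (0 : R) <= 1 by rewrite lexx ler01.
have [d d0 hd] := hF 0 t I0 ht; exists d => // s hs hst K hK /=.
rewrite -(hd 0 s I0 hs _ hst K hK) ?subrr ?normr0 //; ring.
Qed.

(** Monodromy: the lift of the contracting homotopy is constant on the three sides of the square
    where the homotopy rests at [p], so it takes equal values at the ends of the fourth side, along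
    which it differs from the given branch by a constant. *)
Lemma loop_branch p a b : simply_connected Omega -> joined (p, a) (p, b) -> a = b.
Proof.
move=> [_ hloop] [g [[c o l] e0 e1]].
have g0 : (g 0).1 = p by rewrite e0.
have g1 : (g 1).1 = p by rewrite e1.
have pg : path_in Omega (fun t => (g t).1) by split=> //; apply/within_path.
have [|H [cH OH H0 H1 Hb]] := hloop (fun t => (g t).1) pg; first by rewrite g0 g1.
have [||F hF] := @lift_square (fun s t => H (s, t)).
- exact: within_square.
- by move=> s t hs ht; exact: OH.
have I0 : 0 <= (0 : R) <= 1 by rewrite lexx ler01.
have I1 : 0 <= (1 : R) <= 1 by rewrite lexx ler01.
have Op : Omega p by rewrite -g0; exact: o.
have [K0 hK0] := cover Op.
have b1 : F 0 0 = F 1 0.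
  apply: (locally_constant (F := fun s => F s 0)) => // s hs.
  have [d d0 hd] := hF s 0 hs I0; exists d => // s' hs' hss.
  have [e _] := Hb s hs; have [e' _] := Hb s' hs'.
  have := hd s' 0 hs' I0 hss _ K0; rewrite e e' g0 subrr normr0 subrr => /(_ d0 hK0) /eqP.
  by rewrite subr_eq0 => /eqP.
have b2 : F 1 0 = F 1 1.
  apply: (locally_constant (F := fun t => F 1 t)) => // t ht.
  have [d d0 hd] := hF 1 t I1 ht; exists d => // t' ht' htt.
  have := hd 1 t' I1 ht' _ htt K0; rewrite !H1 // g0 subrr normr0 subrr => /(_ d0 hK0) /eqP.
  by rewrite subr_eq0 => /eqP.
have b3 : F 0 1 = F 1 1.
  apply: (locally_constant (F := fun s => F s 1)) => // s hs.
  have [d d0 hd] := hF s 1 hs I1; exists d => // s' hs' hss.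
  have [_ e] := Hb s hs; have [_ e'] := Hb s' hs'.
  have := hd s' 1 hs' I1 hss _ K0; rewrite e e' g0 subrr normr0 subrr => /(_ d0 hK0) /eqP.
  by rewrite subr_eq0 => /eqP.
have : F 0 0 - (g 0).2 = F 0 1 - (g 1).2.
  apply: (locally_constant (F := fun t => F 0 t - (g t).2)) => // t ht.
  have [d d0 hd] := hF 0 t I0 ht; have [d' d'0 hd'] := l t ht.
  exists (Num.min d d'); first by rewrite lt_min d0.
  move=> s hs; rewrite lt_min => /andP[h1 h2].
  have [K hK] := cover (o s hs).
  have := hd' s hs h2 K hK; have := hd 0 s I0 hs _ h1 K.
  by rewrite subrr normr0 !H0 // => /(_ d0 hK); lra.
by rewrite e0 e1 /=; lra.
Qed.

(* Analytic continuation of u along paths gives one function on Omega; it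
   differs from u by a constant on every triangle. *)
Lemma global_branch : simply_connected Omega -> (exists x, Omega x) ->
  (forall K y, (forall i, 0 < eval_at (bary (tri K) i) y) -> Omega y) ->
  exists c : cell T -> R, forall K L y, inK K y -> inK L y -> Omega y ->
    eval_at (u K) y + c K = eval_at (u L) y + c L.
Proof.
move=> sc [x0 Ox0] hint.
have [G hG] : {G : plane R -> R & forall y, Omega y -> joined (x0, 0) (y, G y)}.
  apply: (@choice _ _ (fun y b => Omega y -> joined (x0, 0) (y, b))) => y.
  case: (pselect (Omega y)) => [Oy|nOy]; last by exists 0.
  have [g [pg <- <-]] := sc.1 x0 y Ox0 Oy.
  by have [b hb] := path_branch 0 pg; exists b.
have Guniq y b : Omega y -> joined (x0, 0) (y, b) -> b = G y.
  move=> Oy hb; have h1 := joined_shift (b - G y) (joined_sym (hG y Oy)).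
  rewrite /= addrC subrK add0r in h1.
  have := loop_branch sc (joined_trans hb h1); lra.
have Gloc y : Omega y -> exists2 d, 0 < d & forall z, `|z - y| < d ->
    Omega z /\ forall K, inK K z -> G z - G y = eval_at (u K) z - eval_at (u K) y.
  move=> Oy; have [d d0 hd] := joined_near Oy; exists d => // z /hd [Oz hz]; split=> // K hK.
  rewrite -(Guniq z _ Oz (joined_trans (hG y Oy) (hz K (G y) hK))); ring.
exists (fun K => G (center K) - eval_at (u K) (center K)).
suff hc K y : inK K y -> Omega y ->
    eval_at (u K) y + (G (center K) - eval_at (u K) (center K)) = G y.
  by move=> K L y hK hL Oy; rewrite !hc.
move=> hK Oy; pose g t := on_line (center K) y t.
have gO t : 0 <= t <= 1 -> Omega (g t).
  move=> /andP[t0]; rewrite le_eqVlt => /orP[/eqP ->|t1]; first by rewrite /g on_line1.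
  by apply: (hint K) => i; apply: bary_to_center => //; rewrite t0.
suff : G (g 0) - eval_at (u K) (g 0) = G (g 1) - eval_at (u K) (g 1).
  by rewrite /g on_line0 on_line1; lra.
apply: (locally_constant (F := fun t => G (g t) - eval_at (u K) (g t))) => // t ht.
have [d d0 hd] := Gloc _ (gO t ht).
have n0 : 0 < 1 + `|y - center K| by rewrite ltr_wpDr.
exists (d / (1 + `|y - center K|)); first exact: divr_gt0.
move=> s hs; rewrite ltr_pdivlMr // => hst.
have [|_ h] := hd (g s).
  by rewrite on_line_norm; apply: le_lt_trans hst; rewrite ler_wpM2l // lerDr.
have := h K (inK_segment (inK_center K) hK hs); lra.
Qed.
End Lifts.
End GridTopology.

(** * The boundary of the domain *)

Section Frontier.
Context {R : realType}.
Implicit Types (x y z : plane R) (s t e d : R).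

Lemma on_lineE x y t : on_line x y t = x + t *: (y - x).
Proof. by apply/rowP => i; rewrite !mxE; ring. Qed.

Section Polygon.
Variables (n : nat) (p : 'I_n -> plane R).
Let q j t := on_line (p j) (p (ordS j)) t.

(** The sides are finitely many compact segments, so those that miss [x] stay away from it. *)
Lemma polygon_sides_near x : exists2 e, 0 < e & forall z, `|z| < e -> forall j t,
  0 <= t <= 1 -> x + z = q j t -> exists2 s, 0 <= s <= 1 & x = q j s.
Proof.
apply: (@fin_eps R 'I_n (fun j z => forall t, 0 <= t <= 1 -> x + z = q j t ->
  exists2 s, 0 <= s <= 1 & x = q j s)) => j.
case: (pselect (exists2 s, 0 <= s <= 1 & x = q j s)) => [h|hn]; first by exists 1.
have [|e e0 he] := @segment_avoid R x (p j) (p (ordS j)).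
  by move=> t ht ex; apply: hn; exists t.
by exists e => // z hz t ht ez; exfalso; apply: (he z hz t ht).
Qed.

Lemma polygon_away x : ~ polygon p x ->
  exists2 e, 0 < e & forall z, `|z| < e -> ~ polygon p (x + z).
Proof.
move=> hx; have [e e0 he] := polygon_sides_near x.
exists e => // z hz [j [t [ht ez]]]; have [s hs ex] := he z hz j t ht ez.
by apply: hx; exists j, s.
Qed.

(** The condition on [c] prevents the two rays from coinciding; opposite rays, as at an inner point
    of a side, are allowed. *)
Definition rays_near (F : plane R -> Prop) x (a b : plane R) e : Prop :=
  [/\ 0 < e, a != 0, b != 0, (forall c, 0 < c -> b <> c *: a) & forall z, `|z| < e ->
    (F (x + z) <-> exists2 t, 0 <= t & z = t *: a \/ z = t *: b)].

(** By injectivity an inner point of a side lies on no other side, and a vertex only on the two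
    sides that meet there. *)
Lemma polygon_rays x : simple_closed p -> polygon p x ->
  exists a b e, rays_near (polygon p) x a b e.
Proof.
move=> [n0 inj] px.
have inj' i j s t : 0 <= s < 1 -> 0 <= t < 1 -> q i s = q j t -> i = j /\ s = t by exact: inj.
have q0 j : q j 0 = p j by rewrite /q on_line0.
have q1 j : q j 1 = p (ordS j) by rewrite /q on_line1.
have I0 : 0 <= (0 : R) < 1 by rewrite lexx ltr01.
have Dn0 j : p (ordS j) - p j != 0.
  rewrite subr_eq0; apply/eqP => e.
  have [||_ /eqP] := @inj' j j 0 2^-1 I0; last by rewrite eq_sym gt_eqF // invr_gt0.
    by apply/andP; split; lra.
  by rewrite /q e !on_lineE subrr !scaler0.
have {px} [j0 [s0 [hs0 ex]]] : exists j0 s0, 0 <= s0 < 1 /\ x = q j0 s0.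
  case: px => j [t [/andP[t0]]]; rewrite le_eqVlt => /orP[/eqP -> ->|t1 ->].
    by exists (ordS j), 0; rewrite -/(q j 1) q0 q1.
  by exists j, t; rewrite t0 t1.
have [e e0 he] := polygon_sides_near x.
have side z j t : `|z| < e -> 0 <= t <= 1 -> x + z = q j t -> j = j0 \/ (ordS j = j0 /\ s0 = 0).
  move=> hz ht ez; have [s /andP[s0' s1]] := he z hz j t ht ez; rewrite ex.
  move: s1; rewrite le_eqVlt => /orP[/eqP ->|s1].
    by rewrite q1 -q0 => /inj' [//|//|<- ->]; right.
  by move/inj' => [//||-> _]; [rewrite s0'|left].
have small (a z : plane R) t r : a != 0 -> 0 < r -> 0 <= t -> `|t *: a| < `|a| * r -> t < r.
  move=> a0 r0 t0; rewrite normrZ ger0_norm // mulrC ltr_pM2l //.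
  by rewrite normr_gt0.
case/andP: (hs0); rewrite le_eqVlt => /orP[/eqP s00 _|spos s1]; last first.
  have [r r0 [rs rs']] : exists2 r, 0 < r & r <= s0 /\ r <= 1 - s0.
    exists (Num.min s0 (1 - s0)); first by rewrite lt_min spos subr_gt0.
    by rewrite !ge_min !lexx orbT.
  set a := p (ordS j0) - p j0; have a0 : a != 0 by exact: Dn0.
  exists a, (- a), (Num.min e (`|a| * r)); split=> //; rewrite ?oppr_eq0 //.
  - by rewrite lt_min e0 mulr_gt0 // normr_gt0.
  - move=> c c0 ec; have : (1 + c) *: a == 0 by rewrite scalerDl scale1r -ec subrr.
    by rewrite scaler_eq0 (negPf a0) orbF gt_eqF // addr_gt0.
  - move=> z; rewrite lt_min => /andP[ze zr]; split.
      move=> [j [t [ht ez]]]; have [ej|[_ /eqP]] := side z j t ze ht ez; last by rewrite gt_eqF.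
      have ez' : z = (t - s0) *: a.
        rewrite -[z](addKr x) ez ej ex /q !on_lineE -/a.
        by apply/rowP => i; rewrite !mxE; ring.
      have [h|h] := lerP s0 t; first by exists (t - s0); rewrite ?subr_ge0 //; left.
      exists (s0 - t); first by rewrite subr_ge0 ltW.
      by right; rewrite ez' scalerN -scaleNr opprB.
    move=> [t t0 [ez|ez]].
      have tr : t < r by apply: (small a z) => //; rewrite -ez.
      exists j0, (s0 + t); split; first by apply/andP; split; lra.
      by rewrite ez ex /q !on_lineE -/a scalerDl addrA.
    have tr : t < r by apply: (small a z) => //; rewrite -normrN -scalerN -ez.
    exists j0, (s0 - t); split; first by apply/andP; split; lra.
    by rewrite ez ex /q !on_lineE -/a scalerBl scalerN addrA.
have ex' : x = p j0 by rewrite ex -s00 q0.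
pose jm := ord_pred j0; have ejm : ordS jm = j0 by rewrite ord_predK.
set a := p (ordS j0) - p j0; have a0 : a != 0 by exact: Dn0.
have b0 : p jm - p j0 != 0 by rewrite -oppr_eq0 opprB -{1}ejm Dn0.
set b := p jm - p j0 in b0 *.
have qb t : q jm t = x + (1 - t) *: b.
  by rewrite /q on_lineE ejm ex' /b; apply/rowP => i; rewrite !mxE; ring.
have qa t : q j0 t = x + t *: a by rewrite /q on_lineE ex'.
exists a, b, (Num.min e (Num.min `|a| `|b|)); split=> //.
- by rewrite !lt_min e0 !normr_gt0 a0.
(* If the two sides at the vertex had the same direction, the parameters [1 - t] and [t * c] would
   give the same point; the choice t + t c = 1/2 keeps both in the open unit interval. *)
- move=> c c0 ec; pose t := (2 * (1 + c))^-1.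
  have c1 : 0 < 2 * (1 + c) by rewrite mulr_gt0 // addr_gt0.
  have tE : 2 * t + 2 * (t * c) = 1.
    by rewrite /t; field; rewrite gt_eqF // addr_gt0.
  have t0 : 0 < t by rewrite invr_gt0.
  have tc0 : 0 < t * c by rewrite mulr_gt0.
  have [|||_ h] := @inj' jm j0 (1 - t) (t * c).
  + by apply/andP; split; lra.
  + by apply/andP; split; lra.
  + by rewrite qa qb ec scalerA; congr (_ + _ *: _); ring.
  by lra.
- move=> z; rewrite !lt_min => /and3P[ze za zb]; split.
    move=> [j [t [ht ez]]]; case/andP: (ht) => t0 t1.
    have [ej|[ej _]] := side z j t ze ht ez.
      by exists t => //; left; apply: (@addrI _ x); rewrite ez ej -/(q j0 t) qa.
    exists (1 - t); rewrite ?subr_ge0 //; right; apply: (@addrI _ x).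
    have ej' : j = jm by rewrite /jm -ej ordSK.
    by rewrite ez ej' -/(q jm t) qb.
  move=> [t t0 [ez|ez]].
    have tr : t < 1 by apply: (small a z) => //; rewrite mulr1 -ez.
    by exists j0, t; rewrite t0 ltW // -/(q j0 t) qa ez.
  have tr : t < 1 by apply: (small b z) => //; rewrite mulr1 -ez.
  exists jm, (1 - t); split; first by apply/andP; split; lra.
  by rewrite -/(q jm (1 - t)) qb ez subKr.
Qed.
End Polygon.

Variable Omega : set (plane R).
Hypothesis hOmega : polygonal_domain Omega.

Lemma domain_open : open Omega. Proof. by case: hOmega. Qed.
Lemma domain_regular : interior (closure Omega) = Omega.
Proof. by case: hOmega => _ _ _ _ []. Qed.

Lemma domain_interior : interior Omega = Omega.
Proof. by move/interior_id: domain_open. Qed.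

Lemma frontier_rays x : closure Omega x -> ~ Omega x ->
  exists a b e, rays_near (closure Omega `\` Omega) x a b e.
Proof.
case: hOmega => _ _ _ _ [_ [m [n [p [sc disj]]]]].
rewrite domain_interior => fr cx nx.
have : (closure Omega `\` Omega) x by split.
rewrite fr => -[i _ xi].
have [a [b [e [e0 a0 b0 ab he]]]] := polygon_rays (sc i) xi.
have [j|d d0 hd] := @fin_eps R 'I_m (fun j z => j != i -> ~ polygon (p j) (x + z)).
  have [->|ji] := eqVneq j i; first by exists 1.
  have [|d d0 hd] := @polygon_away _ (p j) x.
    by move=> xj; have : (polygon (p j) `&` polygon (p i)) x; [split|rewrite disj].
  by exists d => // z hz _; exact: hd.
exists a, b, (Num.min e d); split=> //; first by rewrite lt_min e0.
move=> z; rewrite lt_min => /andP[ze zd]; rewrite -(he z ze); split=> [[j _ hj]|hi].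
  by have [<-//|ji] := eqVneq j i; have := hd z zd j ji.
by exists i.
Qed.

(* Of the two sectors cut out by the boundary at x exactly one lies in Omega,
   since Omega is the interior of its closure. *)
Lemma frontier_inseparable x r : 0 < r -> closure Omega x -> exists e, [/\ 0 < e, e <= r &
  forall y z, Omega y -> Omega z -> `|y - x| < e -> `|z - x| < e ->
  inseparable (fun p => Omega p /\ `|p - x| < e) y z].
Proof.
move=> r0 cx; case: (pselect (Omega x)) => [Ox|nx].
  have [d d0 hd] := open_ball domain_open Ox.
  exists (Num.min d r); split; [by rewrite lt_min d0|by rewrite ge_min lexx orbT|].
  move=> y z Oy Oz hy hz; apply: inseparable_segment => t ht.
  have h : `|on_line y z t - x| < Num.min d r.
    rewrite (_ : on_line y z t - x = on_line (y - x) (z - x) t); first exact: ball_line.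
    by apply/rowP => i; rewrite !mxE; ring.
  by split=> //; apply: hd; move: h; rewrite lt_min => /andP[].
have [a [b [e1 [e10 a0 b0 ab he1]]]] := frontier_rays cx nx.
pose e := Num.min e1 r.
have e0 : 0 < e by rewrite lt_min e10.
have ee1 z : `|z| < e -> `|z| < e1 by rewrite lt_min => /andP[].
exists e; split=> //; first by rewrite ge_min lexx orbT.
have [S1 [S2 [hcov hdis c1 c2]]] := two_sectors e0 a0 b0 ab.
(* Membership in the domain is locally constant off the frontier, so a sector lies in the domain
   entirely or not at all. *)
have sector (S : plane R -> Prop) : (forall z, S z -> S1 z \/ S2 z) ->
    (forall y z, `|y| < e /\ S y -> `|z| < e /\ S z ->
        inseparable (fun p => `|p| < e /\ S p) y z) ->
    forall y z, `|y| < e /\ S y -> `|z| < e /\ S z -> Omega (x + y) -> Omega (x + z).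
  move=> sub ins y z hy hz Oy.
  pose h p : R := if `[< Omega (x + p) >] then 1 else 0.
  have : h y = h z.
    apply: (ins y z hy hz) => w [we Sw].
    have nf : ~ (closure Omega `\` Omega) (x + w).
      by move=> /(he1 w (ee1 w we)); apply: hdis; exact: sub.
    case: (pselect (Omega (x + w))) => [Ow|nOw].
      have [d d0 hd] := open_ball domain_open Ow; exists d => // v _ hv.
      rewrite /h !asboolT //; apply: hd.
      by rewrite opprD addrACA subrr add0r.
    have [|d d0 hd] := @not_closure_ball R Omega (x + w); first by move=> cw; apply: nf; split.
    exists d => // v _ hv; rewrite /h !asboolF // => Ov.
    apply: (hd (x + v)); last exact: subset_closure.
    by rewrite opprD addrACA subrr add0r.
  rewrite /h asboolT //; case: asboolP => // _ /eqP; by rewrite oner_eq0.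
have Sx w : Omega w -> `|w - x| < e -> S1 (w - x) \/ S2 (w - x).
  move=> Ow hw; have [h|//] := hcov (w - x); exfalso.
  have : (closure Omega `\` Omega) (x + (w - x)) by apply/(he1 _ (ee1 _ hw)).
  by rewrite addrC subrK => -[].
have Ox w : Omega w -> Omega (x + (w - x)) by rewrite addrC subrK.
(* If both sectors met the domain, a ball around [x] would lie in its closure, and [x] in the
   interior of the closure. *)
have nboth y z : `|y| < e /\ S1 y -> `|z| < e /\ S2 z -> Omega (x + y) -> Omega (x + z) -> False.
  move=> hy hz Oy Oz; apply: nx; rewrite -domain_regular.
  apply: (interior_ball e0) => w hw.
  have -> : w = x + (w - x) by rewrite addrC subrK.
  have [h|[h|h]] := hcov (w - x).
  - by have [] : (closure Omega `\` Omega) (x + (w - x)) by apply/(he1 _ (ee1 _ hw)).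
  - apply: subset_closure; apply: (sector S1 _ c1 y) => //; by left.
  - apply: subset_closure; apply: (sector S2 _ c2 z) => //; by right.
have back (S : plane R -> Prop) : (forall y z, `|y| < e /\ S y -> `|z| < e /\ S z ->
        inseparable (fun p => `|p| < e /\ S p) y z) ->
    (forall z, S z -> S1 z \/ S2 z) ->
    forall y z, Omega y -> Omega z -> `|y - x| < e -> `|z - x| < e -> S (y - x) -> S (z - x) ->
    inseparable (fun p => Omega p /\ `|p - x| < e) y z.
  move=> ins sub y z Oy Oz hy hz Sy Sz h hh.
  have ext w : w = x + (w - x) by rewrite addrC subrK.
  rewrite (ext y) (ext z).
  apply: (ins (y - x) (z - x) (conj hy Sy) (conj hz Sz) (fun p => h (x + p))) => w [we Sw].
  have OD w' : `|w'| < e -> S w' -> Omega (x + w') /\ `|x + w' - x| < e.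
    move=> h1 h2; split; last by rewrite addrAC subrr add0r.
    exact: (sector S sub ins (y - x) w' (conj hy Sy) (conj h1 h2) (Ox y Oy)).
  have [d d0 hd] := hh (x + w) (OD w we Sw).
  exists d => // w' [w'e Sw'] hw; apply: hd; first exact: OD.
  by rewrite opprD addrACA subrr add0r.
move=> y z Oy Oz hy hz.
have [Sy|Sy] := Sx y Oy hy; have [Sz|Sz] := Sx z Oz hz.
- by apply: (back S1 c1 _ y z) => // w; left.
- by exfalso; apply: (nboth (y - x) (z - x)) => //; exact: Ox.
- by exfalso; apply: (nboth (z - x) (y - x)) => //; exact: Ox.
- by apply: (back S2 c2 _ y z) => // w; right.
Qed.
End Frontier.

(** * Continuous potentials on a triangulated domain *)

Section DomainGrid.
Context {R : realType} {T : grid R} {Omega : set (plane R)}.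
Hypothesis hOmega : polygonal_domain Omega.
Hypothesis hT : grid_of Omega T.
Implicit Types (K L M : cell T) (x y z : plane R) (v : vertex T) (s t e d : R).

Lemma inK_closure K y : inK K y -> closure Omega y.
Proof. by rewrite hT => hK; exists K. Qed.

Lemma closure_cover y : closure Omega y -> exists K, inK K y.
Proof. by rewrite hT => -[K _ hK]; exists K. Qed.

Lemma domain_cover y : Omega y -> exists K, inK K y.
Proof. by move=> Oy; apply: closure_cover; exact: subset_closure. Qed.

Lemma domain_cell : exists K : cell T, True.
Proof.
by case: hOmega => -[x Ox] _ _ _ _; have [K _] := domain_cover Ox; exists K.
Qed.

Lemma cell_interior K y : (forall i, 0 < eval_at (bary (tri K) i) y) -> Omega y.
Proof.
move=> hy; rewrite -(domain_regular hOmega).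
have [i|e e0 he] := @fin_eps R 'I_3 (fun i z => 0 < eval_at (bary (tri K) i) (y + z)).
  have [d d0 hd] := @bary_continuous R T K i y _ (hy i).
  by exists d => // z /hd; rewrite ltr_norml => /andP[]; lra.
apply: (interior_ball e0) => z hz; apply: (@inK_closure K); apply/inKP => i.
by apply: ltW; have := he (z - y) hz i; rewrite addrC subrK.
Qed.

Section Branches.
Variable u : pwpoly T.
Hypothesis ujump : forall K L y z, inK K y -> inK L y -> inK K z -> inK L z ->
  eval_at (u K) y - eval_at (u L) y = eval_at (u K) z - eval_at (u L) z.

(** To a nearby point of the domain is assigned the value at [x] of the shifted piece of a triangle
    containing that point. This is locally constant, so by [frontier_inseparable] points of [K] and
    of [L] yield the same value. *)
Lemma vertex_branch (c : cell T -> R) K L v :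
  (forall K L y, inK K y -> inK L y -> Omega y ->
     eval_at (u K) y + c K = eval_at (u L) y + c L) ->
  v \in corners K -> v \in corners L ->
  eval_at (u K) (pos v) + c K = eval_at (u L) (pos v) + c L.
Proof.
move=> hc vK vL; set x := pos v.
have [r r0 hr] := @star_local R T x.
have [e [e0 er he]] := frontier_inseparable hOmega r0 (inK_closure (inK_pos vK)).
pose h y := if @cell_at R T y is Some M then eval_at (u M) x + c M else 0.
have hE M y : inK M y -> Omega y -> `|y - x| < e -> h y = eval_at (u M) x + c M.
  move=> yM Oy ye; rewrite /h /cell_at; case: pickP => [N /asboolP yN|/(_ M) /asboolPn //].
  have yr : `|y - x| < r by exact: lt_le_trans er.
  have := ujump yM yN (hr y yr M yM) (hr y yr N yN); have := hc M N y yM yN Oy; lra.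
(* The point lies on the segment from the vertex to the center, hence in the open triangle; [t] is
   small enough for the radius [e]. *)
have approach M : v \in corners M -> exists y, [/\ inK M y, Omega y & `|y - x| < e].
  move=> vM; pose t := Num.min 2^-1 (e / (2 * (1 + `|x - center M|))).
  have n0 : 0 < 1 + `|x - center M| by rewrite ltr_wpDr.
  have t0 : 0 < t by rewrite lt_min invr_gt0 ltr0n divr_gt0 // mulr_gt0.
  have t1 : t < 1 by rewrite gt_min; apply/orP; left; lra.
  have hI : 0 <= 1 - t < 1 by apply/andP; split; lra.
  exists (on_line (center M) x (1 - t)); split.
  - by apply: inK_segment; [exact: inK_center|exact: inK_pos|apply/andP; split; lra].
  - by apply: (@cell_interior M) => i; apply: bary_to_center => //; exact: inK_pos.
  - rewrite -{2}(on_line1 (center M) x) on_line_norm ler0_norm; last by lra.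
    have h1 : t <= e / (2 * (1 + `|x - center M|)) by rewrite ge_min lexx orbT.
    move: h1; rewrite ler_pdivlMr ?mulr_gt0 // => h1.
    have := mulr_ge0 (ltW t0) (normr_ge0 (x - center M)); lra.
have [yK [h1 h2 h3]] := approach K vK; have [yL [l1 l2 l3]] := approach L vL.
rewrite -(hE K yK) // -(hE L yL) //.
apply: (he yK yL h2 l2 h3 l3 h) => p [Op pe].
have [d d0 hd] := @star_local R T p.
exists d => // q [Oq qe] qp; have [M qM] := domain_cover Oq.
by rewrite (hE M q) // (hE M p) //; exact: (hd q).
Qed.

Lemma continuous_branch : simply_connected Omega ->
  exists c : cell T -> R, forall K L v, v \in corners K -> v \in corners L ->
  eval_at (u K) (pos v) + c K = eval_at (u L) (pos v) + c L.
Proof.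
move=> sc; case: (hOmega) => O0 oO _ _ _.
have [c hc] := global_branch ujump domain_cover oO sc O0 cell_interior.
by exists c => K L v; exact: vertex_branch.
Qed.
End Branches.

(** Two triangles with a common point have a common vertex by conformity, so the value is locally
    constant along any path in the domain. *)
Lemma vertex_connected (c : cell T -> R) : simply_connected Omega ->
  (forall K L v, v \in corners K -> v \in corners L -> c K = c L) -> forall K L, c K = c L.
Proof.
move=> [pc _] hc K L.
have ci M : Omega (center M).
  by apply: (@cell_interior M) => i; rewrite bary_center invr_gt0.
have [g [[/within_path gc gO] g0 g1]] := pc _ _ (ci K) (ci L).
pose h y := if @cell_at R T y is Some M then c M else 0.
have hE M y : inK M y -> h y = c M.
  move=> yM; rewrite /h /cell_at; case: pickP => [N /asboolP yN|/(_ M) /asboolPn //].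
  by have [v /andP[vM vN]] := inK_meet yM yN; exact: (hc N M v).
rewrite -(hE K _ (inK_center K)) -(hE L _ (inK_center L)) -g0 -g1.
apply: (locally_constant (F := fun t => h (g t))) => // t ht.
have [e e0 he] := @star_local R T (g t); have [d d0 hd] := gc e e0 t ht.
exists d => // s hs hst; have [M hM] := domain_cover (gO s hs).
by rewrite (hE M _ hM) (hE M) //; apply: (he (g s)) => //; exact: hd.
Qed.
End DomainGrid.

(** * Potentials *)

Section Potential.
Context {R : realType}.
Implicit Types (p q : poly2 R) (a b : plane R) (s t : R).

Lemma mint0 (i : 'I_2) : mint i (0 : poly2 R) = 0.
Proof. by apply/mpolyP => m; rewrite mcoeff_mint !mcoeff0 mul0rn mul0r. Qed.

(** Integration of [p] in the second variable is corrected by an integral in the first, whose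
    integrand is free of the second variable because the divergence vanishes. *)
Lemma closed_potential k p q : (msize p <= k)%N -> (msize q <= k)%N -> d1 p + d2 q = 0 ->
  exists f, [/\ (msize f <= k.+1)%N, d2 f = p & - d1 f = q].
Proof.
move=> hp hq hpq; have hm := @msize_mint R 2 1 k p hp.
exists (mint 1 p - mint 0 (q + d1 (mint 1 p))); split.
- by apply: msizeB => //; apply: msize_mint; apply: msizeD => //; exact: msize_d1.
- rewrite /d2 mderivB mderiv_mint mderiv_mint_comm // mderivD /d1 mderiv_comm mderiv_mint.
  by rewrite addrC -/(d1 p) -/(d2 q) [_ + d1 p]addrC hpq mint0 oppr0 add0r.
- by rewrite /d1 mderivB mderiv_mint opprB addrK.
Qed.

Lemma eval_line_const a b p :
  (forall t, eval_at (dirD (b - a) p) (on_line a b t) = 0) ->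
  forall s t, eval_at p (on_line a b s) = eval_at p (on_line a b t).
Proof.
move=> h s t; rewrite -!horner_pol_line.
have q0 : (pol_line a b p)^`() = 0.
  by rewrite deriv_pol_line; apply: poly_eq0_horner => x; rewrite horner_pol_line.
suff -> : pol_line a b p = ((pol_line a b p)`_0)%:P by rewrite !hornerC.
apply/polyP => -[|i]; rewrite coefC //=.
have := congr1 (fun f : {poly R} => f`_i) q0.
rewrite coef_deriv coef0 => /eqP; rewrite -mulr_natr mulf_eq0 pnatr_eq0 orbF.
by move/eqP.
Qed.

Lemma gradient0_const p : d1 p = 0 -> d2 p = 0 -> p = mpolyC 2 (mcoeff mnm0 p).
Proof.
move=> h1 h2; apply/mpolyP => m; rewrite mcoeffC.
have [->|m0] := eqVneq m mnm0; first by rewrite mulr1.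
rewrite mulr0; have [i mi] : exists i, m i != 0%N.
  apply: contrapT => hn; case/negP: m0; apply/eqP/mnmP => i; rewrite mnm0E.
  by apply/eqP/negPn/negP => mi; apply: hn; exists i.
have di : mderiv i p = 0.
  by case: i mi => -[|[|//]] lt _; [rewrite -h1|rewrite -h2]; congr (mderiv _ p); exact: val_inj.
have := congr1 (fun f : poly2 R => mcoeff (mnm_sub m (mnm1 i)) f) di.
rewrite mcoeff_deriv mcoeff0 submK; last first.
  by apply/mnm_lepP => j; rewrite mnm1E; case: eqP => // <-; rewrite lt0n.
by move=> /eqP; rewrite -mulr_natr mulf_eq0 pnatr_eq0 orbF => /eqP.
Qed.
End Potential.

(** * The maps of the sequence and their kernels *)

Section Sequence.
Context {R : realType} {T : grid R}.
Implicit Types (u : pwpoly T) (v : pwvect T) (K L : cell T).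

Lemma curlE u K : ((curl u).1 K = d2 (u K)) * ((curl u).2 K = - d1 (u K)).
Proof. by rewrite !ffunE. Qed.

Lemma d1B (p q : poly2 R) : d1 (p - q) = d1 p - d1 q. Proof. exact: mderivB. Qed.
Lemma d2B (p q : poly2 R) : d2 (p - q) = d2 p - d2 q. Proof. exact: mderivB. Qed.

Lemma div_curl u : div (curl u) = 0.
Proof.
by apply/ffunP => K; rewrite divE !curlE ffunE /d1 /d2 mderivN mderiv_comm subrr.
Qed.

Lemma curl_const c : curl (pwconst c) = (0, 0) :> pwvect T.
Proof.
by congr (_, _); apply/ffunP => K; rewrite !ffunE /d1 /d2 mderivC ?oppr0.
Qed.

(** The normal component of a curl is the tangential derivative of the potential; without a flux
    jump the jump of the potential is therefore constant along the edge. *)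
Lemma flux_curl u (a b : plane R) K L : flux_jump a b (curl u) K L = dirD (b - a) (u K - u L).
Proof.
rewrite /flux_jump !curlE -opprB -opprD opprB scalerN opprK.
by rewrite /dirD d1B d2B addrC.
Qed.

Lemma smooth_const m N M c : smooth m N M (pwconst c : pwpoly T).
Proof.
split=> [K|x K L _ _|x y K L _ _ _ _ _ t]; rewrite !ffunE; last 2 first.
- by rewrite subrr; exact: van0.
- by rewrite subrr; exact: van0.
by rewrite msizeC (leq_trans (leq_b1 _)).
Qed.

Lemma smooth_curl k N M u : smooth k.+1 N.+1 M.+1 u -> smooth_div k N M (curl u).
Proof.
move=> [hd hv he]; split.
- split=> K; rewrite curlE; first exact: msize_d2.
  by rewrite msizeN; exact: msize_d1.
- move=> x K L xK xL; have [_ h1 h2] := hv x K L xK xL.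
  split; first by rewrite !curlE -d2B.
  by rewrite !curlE -opprD -d1B; exact: vanN.
- move=> x y K L xy xK yK xL yL t; have h := he x y K L xy xK yK xL yL.
  have [_ h1 h2] := h t; split.
  + by rewrite flux_curl; apply: eval_line_eq0 => s; have [] := h s.
  + by rewrite !curlE -d2B.
  + by rewrite !curlE -opprD -d1B; exact: vanN.
  + by rewrite div_curl !ffunE subrr; exact: van0.
Qed.

Lemma smooth_divergence k N M v : (0 < k)%N -> (0 < M)%N ->
  smooth_div k N M v -> smooth k.-1 N M.-1 (div v).
Proof.
move=> k0 M0 [[hd1 hd2] hv he].
have dvB K L : div v K - div v L = d1 (v.1 K - v.1 L) + d2 (v.2 K - v.2 L).
  by rewrite !divE d1B d2B opprD addrACA.
split.
- by move=> K; rewrite divE prednK //; apply: msizeD; [exact: msize_d1|exact: msize_d2].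
- move=> x K L xK xL; have [h1 h2] := hv x K L xK xL.
  by rewrite dvB; apply: van_div; rewrite prednK.
- by move=> x y K L xy xK yK xL yL t; have [] := he x y K L xy xK yK xL yL t.
Qed.

(** By conformity the intersection is empty, a vertex, an edge or the whole triangle, and only the
    edge makes use of the flux condition. *)
Lemma jump_constant u k N M K L (y z : plane R) : smooth_div k N M (curl u) ->
  inK K y -> inK L y -> inK K z -> inK L z ->
  eval_at (u K) y - eval_at (u L) y = eval_at (u K) z - eval_at (u L) z.
Proof.
move=> [_ _ he] Ky Ly Kz Lz; have [->|KL] := eqVneq K L; first by rewrite !subrr.
have inter (p : plane R) : inK K p -> inK L p -> hull (@pos R T) (corners K :&: corners L) p.
  by move=> Kp Lp; rewrite -conforming.
set A := corners K :&: corners L in inter.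
have [A0|A1|A2|A3] : [\/ #|A| = 0, #|A| = 1, #|A| = 2 | #|A| = 3]%N.
  have : (#|A| <= 3)%N by rewrite -(card_corners K) subset_leq_card // finset.subsetIl.
  by case: #|A| => [|[|[|[|//]]]] _; [apply: Or41|apply: Or42|apply: Or43|apply: Or44].
- have [w [_ w1 _]] := inter y Ky Ly.
  by move: w1; rewrite (cards0_eq A0) big_set0 => /esym/eqP; rewrite oner_eq0.
- have /cards1P [x ex] : #|A| == 1%N by rewrite A1.
  have one (p : plane R) : inK K p -> inK L p -> p = pos x.
    move=> Kp Lp; have [w [_ w1 ->]] := inter p Kp Lp.
    by move: w1; rewrite ex !big_set1 => ->; rewrite scale1r.
  by rewrite (one y) // (one z).
- have /cards2P [x [x' [xx' ex]]] : #|A| == 2%N by rewrite A2.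
  have two (p : plane R) : inK K p -> inK L p -> exists t, p = on_line (pos x) (pos x') t.
    move=> Kp Lp; have [w [_ w1 ->]] := inter p Kp Lp; exists (w x').
    move: w1; rewrite ex !big_setU1 ?inE //= !big_set1 /on_line => <-.
    by rewrite addrK.
  have [s ->] := two y Ky Ly; have [t ->] := two z Kz Lz.
  have [xA x'A] : x \in A /\ x' \in A by rewrite ex !inE !eqxx orbT.
  move: xA x'A; rewrite !finset.in_setI => /andP[xK xL] /andP[x'K x'L].
  rewrite -!evalB; apply: eval_line_const => r; rewrite -flux_curl.
  by have [] := he x x' K L xx' xK x'K xL x'L r.
- case/eqP: KL; apply: corners_inj.
  have e1 : A = corners K by apply/eqP; rewrite eqEcard finset.subsetIl card_corners A3.
  by rewrite -e1; apply/eqP; rewrite eqEcard finset.subsetIr card_corners A3.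
Qed.

Variable Omega : set (plane R).
Hypothesis hOmega : polygonal_domain Omega.
Hypothesis hT : grid_of Omega T.
Hypothesis sc : simply_connected Omega.

Lemma kernel_curl m N M u : smooth m N M.+1 u -> curl u = (0, 0) -> exists c, pwconst c = u.
Proof.
move=> [_ hv _] cu; have uC K : u K = mpolyC 2 (mcoeff mnm0 (u K)).
  apply: gradient0_const.
    have := congr1 (fun w : pwvect T => w.2 K) cu; rewrite curlE ffunE => /eqP.
    by rewrite oppr_eq0 => /eqP.
  by have := congr1 (fun w : pwvect T => w.1 K) cu; rewrite curlE ffunE.
have [K0 _] := domain_cell hOmega hT.
exists (mcoeff mnm0 (u K0)); apply/ffunP => K; rewrite ffunE [RHS]uC; congr mpolyC.
apply: (vertex_connected (c := fun K => mcoeff mnm0 (u K)) hOmega hT sc) => L L' x xL xL'.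
have uE M' y : eval_at (u M') y = mcoeff mnm0 (u M') by rewrite {1}uC evalC.
have [h _ _] := hv x L L' xL xL'; move: h.
by rewrite evalB !uE => /eqP; rewrite subr_eq0 => /eqP.
Qed.

Lemma kernel_div k N M v : smooth_div k N M v -> div v = 0 ->
  exists2 u, smooth k.+1 N.+1 M.+1 u & curl u = v.
Proof.
move=> hs dv; have [[hd1 hd2] hv he] := hs.
have [f hf] : {f : cell T -> poly2 R & forall K,
    [/\ (msize (f K) <= k.+2)%N, d2 (f K) = v.1 K & - d1 (f K) = v.2 K]}.
  apply: (@choice _ _ (fun K g => [/\ (msize g <= k.+2)%N, d2 g = v.1 K & - d1 g = v.2 K])) => K.
  by apply: closed_potential => //; rewrite -divE dv ffunE.
have cf : curl [ffun K => f K] = v.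
  rewrite [RHS]surjective_pairing; congr (_, _); apply/ffunP => K; rewrite !ffunE;
  by have [] := hf K.
have [|c hc] := continuous_branch (u := [ffun K => f K]) hOmega hT _ sc.
  by move=> K L y z; apply: (@jump_constant _ k N M); rewrite cf.
pose u : pwpoly T := [ffun K => f K + mpolyC 2 (c K)].
have uE K : u K = f K + mpolyC 2 (c K) by rewrite ffunE.
have d1u K : d1 (u K) = - v.2 K.
  by have [_ _ <-] := hf K; rewrite uE opprK /d1 mderivD mderivC addr0.
have d2u K : d2 (u K) = v.1 K.
  by have [_ <- _] := hf K; rewrite uE /d2 mderivD mderivC addr0.
have cu : curl u = v.
  rewrite [RHS]surjective_pairing; congr (_, _); apply/ffunP => K; rewrite ffunE.
    exact: d2u.
  by rewrite d1u opprK.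
have u0 x K L : x \in corners K -> x \in corners L -> eval_at (u K - u L) (pos x) = 0.
  move=> xK xL; have := hc K L x xK xL; rewrite !ffunE evalB !evalD !evalC => ->.
  exact: subrr.
have step n (y : plane R) K L : eval_at (u K - u L) y = 0 -> van n y (v.1 K - v.1 L) ->
    van n y (v.2 K - v.2 L) -> van n.+1 y (u K - u L).
  move=> e h1 h2; split=> //; last by rewrite d2B !d2u.
  by rewrite d1B !d1u opprK addrC -opprB; exact: vanN.
exists u => //; split.
- move=> K; rewrite uE; apply: msizeD; first by have [] := hf K.
  by rewrite msizeC (leq_trans (leq_b1 _)).
- by move=> x K L xK xL; have [h1 h2] := hv x K L xK xL; apply: step => //; exact: u0.
- move=> x y K L xy xK yK xL yL t; have [_ h1 h2 _] := he x y K L xy xK yK xL yL t.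
  (* The jump of the potential is constant along the edge and zero at its end [x]. *)
  apply: step => //; rewrite -(u0 x K L xK xL) -[in RHS](on_line0 (pos x) (pos y)).
  apply: eval_line_const => r; rewrite -flux_curl cu.
  by have [] := he x y K L xy xK yK xL yL r.
Qed.
End Sequence.

Theorem proposition6p4 (R : realType) (Omega : set 'rV[R]_2) (T : grid R)
  (hOmega : polygonal_domain Omega) (hT : grid_of Omega T)
  (l : int) (hl : -1 <= l) (r1 : rat) (hr1 : r1 = l%:~R + 1 / 2)
  (r2 : nat) (hr2 : 2 * r1 + 1 <= r2%:R)
  (k : nat) (hk : (2 * r2 + 2 <= k)%N) :
  is_complex (Vspace T (k + 1)%N (l + 1) (r2%:Z + 1)) (Stenberg T k r1 r2)
             (Vspace T (k - 1)%N l (r2%:Z - 1)) /\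
  (simply_connected Omega ->
   is_exact (Vspace T (k + 1)%N (l + 1) (r2%:Z + 1)) (Stenberg T k r1 r2)
            (Vspace T (k - 1)%N l (r2%:Z - 1))).
Proof.
(* Since 2 r1 + 1 = 2 l + 2 = 2 N, the hypothesis on [r2] reads 2 N <= r2, that is 2 N < M for M =
   r2 + 1. *)
have [N hN] : exists N : nat, N%:Z = l + 1 by exists (absz (l + 1)); lia.
have hNr : (2 * N <= r2)%N.
  rewrite -(ler_nat rat) natrM; apply: le_trans hr2; rewrite hr1.
  have -> : N%:R = l%:~R + 1 :> rat by rewrite -[N%:R]/(N%:Z%:~R) hN rmorphD.
  by lra.
have VX u : Vspace T (k + 1)%N (l + 1) (r2%:Z + 1) u <-> smooth k.+1 N.+1 r2.+2 u.
  by rewrite addn1; apply: Vspace_smooth; lia.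
have VY v : Stenberg T k r1 r2 v <-> smooth_div k N r2.+1 v.
  by apply: (Stenberg_smooth_div _ _ hN hr1); lia.
have VZ w : Vspace T (k - 1)%N l (r2%:Z - 1) w <-> smooth k.-1 N r2 w.
  by rewrite subn1; apply: Vspace_smooth; lia.
have const_X c : Vspace T (k + 1)%N (l + 1) (r2%:Z + 1) (pwconst c).
  by apply/VX; exact: smooth_const.
have curl_Y u : Vspace T (k + 1)%N (l + 1) (r2%:Z + 1) u -> Stenberg T k r1 r2 (curl u).
  by move=> /VX hu; apply/VY; exact: smooth_curl.
have div_Z v : Stenberg T k r1 r2 v -> Vspace T (k - 1)%N l (r2%:Z - 1) (div v).
  by move=> /VY hv; apply/VZ; apply: (@smooth_divergence _ _ k N r2.+1) => //; lia.
split=> [|sc]; split.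
- by move=> _ [c _ <-].
- by move=> _ [u hu <-]; exact: curl_Y.
- by move=> _ [v hv <-]; exact: div_Z.
- exact: curl_const.
- by move=> u _; exact: div_curl.
- move=> c c' e; have [K _] := domain_cell hOmega hT.
  have := congr1 (fun u : pwpoly T => eval_at (u K) 0) e.
  by rewrite !ffunE !evalC.
- apply/seteqP; split=> [_ [c _ <-]|u [/VX hu cu]]; first by split; [|exact: curl_const].
  by have [c <-] := kernel_curl hOmega hT sc hu cu; exists c.
- apply/seteqP; split=> [_ [u hu <-]|v [/VY hv dv]].
    by split; [exact: curl_Y|exact: div_curl].
  by have [u hu <-] := kernel_div hOmega hT sc hv dv; exists u => //; apply/VX.
- apply/seteqP; split=> [_ [v hv <-]|w /VZ hw]; first exact: div_Z.
  have [v hv <-] : exists2 v, smooth_div k N r2.+1 v & div v = w.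
    by apply: div_surjective => //; lia.
  by exists v => //; apply/VY.
Qed.
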